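(* Let $V$ be an evaluation representation of $\widehat{\mathfrak g}$ and suppose that the endomorphism of $V$ representing $\Lambda=e_0+e$ has a maximal eigenvalue $\lambda$, with eigenvector $\psi\in V$ (unique up to a constant). Then there exists a unique solution $\Psi(x,E):\widetilde{\mathbb C}\to V$ of $$\Psi'(x)+\Big(\frac{\ell}{x}+e+p(x,E)e_0\Big)\Psi(x)=0$$ with asymptotic behaviour $\Psi(x,E)=e^{-\lambda S(x,E)}q(x,E)^{-h}(\psi+o(1))$ as $x\to+\infty$. Moreover, the same asymptotic behaviour holds in the sector $|\arg x|<\frac{\pi}{2(M+1)}$: for every $\delta>0$, $$\Psi(x,E)=e^{-\lambda S(x,E)}q(x,E)^{-h}(\psi+o(1))\quad\text{as }x\to\infty\text{ in }|\arg x|<\tfrac{\pi}{2(M+1)}-\delta.$$ Finally, $\Psi(x,E)$ is an entire function of $E$.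
   Context: $\mathfrak g$ is a simple complex Lie algebra of type $A$, $D$ or $E$ of rank $n$, with Chevalley generators $\{f_i,h_i,e_i\}_{i=1}^n$, Cartan subalgebra $\mathfrak h=\bigoplus\mathbb Ch_i$, simple roots $\alpha_i$, dual Coxeter number $h^\vee$, invariant form $(a|b)=\kappa(a,b)/h^\vee$. $\widehat{\mathfrak g}=\mathfrak g\otimes\mathbb C[t,t^{-1}]\oplus\mathbb Cc$ with $[a\otimes f,b\otimes g]=[a,b]\otimes fg+(a|b)\operatorname{res}_{t=0}(f'g\,dt)c$, $c$ central; $e_0=a_0\otimes t$ with $0\neq a_0\in\mathfrak g_{-\theta}$, $-\theta$ the lowest root; $e=\sum_{i=1}^ne_i$. For a finite-dimensional $\mathfrak g$-module $V$ and $\zeta\in\mathbb C^*$, the evaluation representation $V(\zeta)$ is $V$ with $(a\otimes f(t))v=f(\zeta)(av)$, $cv=0$. $h\in\mathfrak h$ is the element with $\alpha_i(h)=1$ for all $i$ (so $[h,e]=e$, $[h,e_0]=-(h^\vee-1)e_0$). An eigenvalue $\lambda$ of an endomorphism $A$ is maximal if it is real, of algebraic multiplicity one, and $\lambda>\operatorname{Re}\mu$ for every other eigenvalue $\mu$ of $A$. Fix $\ell\in\mathfrak h$, $M>0$, $E\in\mathbb C$; $p(x,E)=x^{Mh^\vee}-E$; $\widetilde{\mathbb C}=\mathbb C\setminus\mathbb R_{\le0}$. Let $s=\lfloor\frac{M+1}{h^\vee M}\rfloor$, $c_0=1$, $c_j(E)=\binom{1/h^\vee}{j}(-E)^j$,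 $q(x,E)=\sum_{j=0}^s c_j(E)x^{M(1-h^\vee j)}$ (the truncation of the large-$x$ expansion of $p(x,E)^{1/h^\vee}$, with branch $q\sim|x|^M$ on the positive axis). The action is $S(x,E)=\int_0^xq(y,E)\,dy$ if $\frac{M+1}{h^\vee M}\notin\mathbb Z_+$, and $S(x,E)=\sum_{j=0}^{s-1}\int_0^xc_j(E)y^{M(1-h^\vee j)}dy+c_s(E)\log x$ if $\frac{M+1}{h^\vee M}\in\mathbb Z_+$. $q(x,E)^{-h}$ denotes $\exp(-h\log q(x,E))$ acting on $V$. *)

(* Defs.v *)
From HB Require Import structures.
From mathcomp Require Import all_boot all_order all_algebra.
From mathcomp Require Import all_classical all_reals all_analysis.
From mathcomp Require Import complex.
Import numFieldNormedType.Exports.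
Import Order.TTheory GRing.Theory Num.Theory.

Set Implicit Arguments.
Unset Strict Implicit.
Unset Printing Implicit Defensive.

Local Open Scope ring_scope.
Local Open Scope complex_scope.

Section LieAlgebra.
Variables (K : fieldType) (L : lmodType K) (br : L -> L -> L).

Definition is_lie_bracket : Prop :=
  (forall (a : K) (x y z : L), br (a *: x + y) z = a *: br x z + br y z) /\
  (forall (a : K) (x y z : L), br z (a *: x + y) = a *: br z x + br z y) /\
  (forall x : L, br x x = 0) /\
  (forall x y z : L, br x (br y z) + br y (br z x) + br z (br x y) = 0).

Definition is_subspace (P : L -> Prop) : Prop :=
  P 0 /\ (forall (a : K) (x y : L), P x -> P y -> P (a *: x + y)).

Definition is_ideal (P : L -> Prop) : Prop :=
  is_subspace P /\ (forall x y : L, P y -> P (br x y)).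

Definition is_simple_lie : Prop :=
  (exists x y : L, br x y <> 0) /\
  (forall P, is_ideal P -> (forall x, P x -> x = 0) \/ (forall x, P x)).

Definition lie_generates (S : L -> Prop) : Prop :=
  forall P : L -> Prop, is_subspace P -> (forall x y, P x -> P y -> P (br x y)) ->
    (forall x, S x -> P x) -> forall x, P x.

Definition chevalley_generators (n : nat) (A : 'M[int]_n) (e f h : 'I_n -> L) : Prop :=
  (forall i j, br (h i) (h j) = 0) /\
  (forall i j, br (e i) (f j) = if i == j then h i else 0) /\
  (forall i j, br (h i) (e j) = (A i j)%:~R *: e j) /\
  (forall i j, br (h i) (f j) = - ((A i j)%:~R *: f j)) /\
  (forall i j, i != j -> iter `|1 - A i j|%N (br (e i)) (e j) = 0) /\
  (forall i j, i != j -> iter `|1 - A i j|%N (br (f i)) (f j) = 0) /\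
  lie_generates (fun x => exists i, x = e i \/ x = f i \/ x = h i).

Definition in_cartan (n : nat) (h : 'I_n -> L) (x : L) : Prop :=
  exists c : 'I_n -> K, x = \sum_i c i *: h i.

(* root space g_beta, for beta = sum_i beta_i alpha_i (alpha_i(h_j) = A j i) *)
Definition in_root_space (n : nat) (A : 'M[int]_n) (h : 'I_n -> L)
    (beta : 'I_n -> int) (x : L) : Prop :=
  forall j, br (h j) x = (\sum_i beta i * A j i)%:~R *: x.

Definition is_root (n : nat) (A : 'M[int]_n) (h : 'I_n -> L) (beta : 'I_n -> int) : Prop :=
  (exists i, beta i != 0) /\ (exists x, x <> 0 /\ in_root_space A h beta x).

Definition is_lowest_root (n : nat) (A : 'M[int]_n) (h : 'I_n -> L) (beta : 'I_n -> int) : Prop :=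
  is_root A h beta /\ (forall gamma, is_root A h gamma -> forall i, beta i <= gamma i).

Definition is_representation (N : nat) (rho : L -> 'M[K]_N) : Prop :=
  (forall (a : K) (x y : L), rho (a *: x + y) = a *: rho x + rho y) /\
  (forall x y : L, rho (br x y) = rho x *m rho y - rho y *m rho x).

End LieAlgebra.

Definition is_ADE_cartan (n : nat) (A : 'M[int]_n) : Prop :=
  (0 < n)%N /\
  (forall i, A i i = 2) /\
  (forall i j, i != j -> A i j = 0 \/ A i j = -1) /\
  (forall i j, A i j = A j i) /\
  (forall x : 'cV[rat]_n, x != 0 -> 0 < (x^T *m map_mx intr A *m x) ord0 ord0).

(* dual Coxeter number  h^vee = 1 + ht(theta), theta = - (lowest root) *)
Definition dual_coxeter (n : nat) (beta : 'I_n -> int) : nat :=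
  (1 + `|- \sum_i beta i|)%N.

Section Complex.
Variable R : realType.
Local Notation Re := (@complex.Re R).
Local Notation Im := (@complex.Im R).

Definition cabs (z : R[i]) : R := Num.sqrt (Re z ^+ 2 + Im z ^+ 2).

(* principal argument, in (-pi, pi] *)
Definition carg (z : R[i]) : R :=
  if (Im z == 0) && (Re z <= 0) then (if Re z == 0 then 0 else pi)
  else 2 * atan (Im z / (cabs z + Re z)).

Definition cexp (z : R[i]) : R[i] := (expR (Re z))%:C * (cos (Im z) +i* sin (Im z)).

Definition clog (z : R[i]) : R[i] := (ln (cabs z))%:C + 'i * (carg z)%:C.

Definition cpow (z a : R[i]) : R[i] := cexp (a * clog z).

Definition slit_plane (z : R[i]) : Prop := ~ (Im z = 0 /\ Re z <= 0).

Definition mpow (N : nat) (A : 'M[R[i]]_N) (k : nat) : 'M[R[i]]_N := iter k (mulmx A) 1%:M.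
Definition mexp (N : nat) (A : 'M[R[i]]_N) : 'M[R[i]]_N :=
  limn (fun m : nat => (\sum_(k < m) (k`!%:R)^-1 *: mpow A k : ('M[R[i]]_N : normedModType R[i]))).

Definition is_maximal_eigenvalue (N : nat) (Lam : 'M[R[i]]_N) (lam : R) : Prop :=
  root (char_poly Lam) lam%:C /\
  mup lam%:C (char_poly Lam) = 1%N /\
  (forall mu : R[i], root (char_poly Lam) mu -> mu != lam%:C -> Re mu < lam).

Definition gbinom (a : R[i]) (j : nat) : R[i] :=
  (\prod_(k < j) (a - k%:R)) / (j`!)%:R.

Section Potential.
Variables (hv : nat) (M : R).

Definition p_fun (x E : R[i]) : R[i] := cpow x ((M * hv%:R)%:C) - E.

Definition s_idx : nat := Num.truncn ((M + 1) / (hv%:R * M)).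

Definition res_case : bool := ((s_idx%:R : R) == (M + 1) / (hv%:R * M)).

Definition c_coef (j : nat) (E : R[i]) : R[i] := gbinom (hv%:R^-1) j * (- E) ^+ j.

Definition a_exp (j : nat) : R := M * (1 - hv%:R * j%:R).

Definition q_fun (x E : R[i]) : R[i] :=
  \sum_(j < s_idx.+1) c_coef j E * cpow x (a_exp j)%:C.

(* int_0^x c_j y^{a_j} dy = c_j x^{a_j+1}/(a_j+1)  (here a_j + 1 > 0) *)
Definition S_fun (x E : R[i]) : R[i] :=
  if res_case then
    \sum_(j < s_idx) c_coef j E * cpow x (a_exp j + 1)%:C / (a_exp j + 1)%:C
      + c_coef s_idx E * clog x
  else
    \sum_(j < s_idx.+1) c_coef j E * cpow x (a_exp j + 1)%:C / (a_exp j + 1)%:C.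

End Potential.

Section ODE.
Variables (N : nat) (hv : nat) (M : R).
(* matrices by which ell, e = sum e_i, e_0 and h act on V *)
Variables (Lop Eop E0op Hop : 'M[R[i]]_N).

Definition solves_ode (E : R[i]) (Psi : R[i] -> 'cV[R[i]]_N) : Prop :=
  forall x : R[i], slit_plane x ->
    derivable (Psi : R[i]^o -> ('cV[R[i]]_N : normedModType R[i])) x 1 /\
    'D_1 (Psi : R[i]^o -> ('cV[R[i]]_N : normedModType R[i])) x
      + (x^-1 *: Lop + Eop + p_fun hv M x E *: E0op) *m Psi x = 0.

Definition asym_factor (lam : R) (E x : R[i]) : 'M[R[i]]_N :=
  cexp (- lam%:C * S_fun hv M x E) *: mexp (- clog (q_fun hv M x E) *: Hop).

Definition asym_positive (lam : R) (psi : 'cV[R[i]]_N) (E : R[i])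
    (Psi : R[i] -> 'cV[R[i]]_N) : Prop :=
  exists r : R -> 'cV[R[i]]_N,
    (forall t : R, 0 < t -> Psi t%:C = asym_factor lam E t%:C *m (psi + r t)) /\
    (forall eps : R, 0 < eps -> exists T : R, forall t : R, T < t -> `|r t| < eps%:C).

Definition asym_sector (lam : R) (psi : 'cV[R[i]]_N) (E : R[i]) (delta : R)
    (Psi : R[i] -> 'cV[R[i]]_N) : Prop :=
  exists r : R[i] -> 'cV[R[i]]_N,
    (forall x : R[i], `|carg x| < pi / (2 * (M + 1)) - delta ->
        Psi x = asym_factor lam E x *m (psi + r x)) /\
    (forall eps : R, 0 < eps -> exists T : R, forall x : R[i],
        T < cabs x -> `|carg x| < pi / (2 * (M + 1)) - delta -> `|r x| < eps%:C).

End ODE.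
End Complex.

(* Main.v *)
(* Put v = (M + 1) log x and z = exp v = x^(M+1), and write Psi = exp(-lam S) x^(-M h) y. Conjugation by
   the grading element turns the equation into y' = (z (lam Q(u) - Lam + u E e_0) + D) y up to the
   factor 1/(M + 1), where u = z^(-nu) and lam Q is the truncated root; [Lam, f] = h for a combination
   f of the f_i, because a_0 commutes with every f_i, and likewise for ell.  The binomial gauge
   sum_j C(h/h^vee, j) (-E u)^j followed by 1 - X/z, with [Lam, X] = D, makes the leading part a
   multiple of B = lam - Lam, up to a remainder integrable in v.  Since lam is maximal, B has a
   Lyapunov function off its kernel; its energy can then be estimated backwards along any line
   in Re z >= 0 that is nearly parallel to the positive axis.  This gives the existence and uniqueness
   of y with y -> psi, on the whole half plane Re z >= 0, that is |arg x| <= pi/(2(M+1)), and its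
   continuity in E.  All of this works for a matrix parameter commuting with the coefficients; for
   the parameter [[E, 0], [1, E']] on V + V the second component is the divided difference of y in
   E, so continuity of the doubled solution gives complex differentiability in E. *)
Require Import Defs.
From HB Require Import structures.
From mathcomp Require Import all_boot all_order all_algebra.
From mathcomp Require Import all_classical all_reals all_analysis.
From mathcomp Require Import complex.
From mathcomp Require Import zify ring lra.
Import numFieldNormedType.Exports.
Import Order.TTheory GRing.Theory Num.Theory.
Set Implicit Arguments.
Unset Strict Implicit.
Unset Printing Implicit Defensive.
Local Open Scope ring_scope.
Local Open Scope complex_scope.

(** * Absolute values, matrix norms and complex derivatives *)

(** The eigenvalues of B off its kernel have positive real part, so every direction other than that
    of [psi] grows as Re z increases. Stability therefore holds only from large z towards smaller z:
    the solution is obtained by prescribing [psi] at v = k and letting k grow, and uniqueness is the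
    statement that a solution tending to 0 vanishes. The constants are kept uniform over parameter
    matrices of bounded norm; this uniformity is what makes the limit continuous in the parameter.
    In the variable v the coefficients are finite sums of exponentials, so every solution is entire
    in v, and the slit and the branches of powers enter only through the substitution v = (M + 1)
    log x. Multiplication by a direction far from 1 can destroy the positivity of B, so a point of
    the half plane cannot be joined to the real axis by a steep line; a line of small slope with a
    sufficiently distant endpoint reaches the axis from every such point. *)

Section Modulus.
Variable R : realType.
Local Notation C := R[i].
Implicit Types z w : C.

Lemma normC_cabs z : `|z| = (cabs z)%:C.
Proof. by rewrite normc_def. Qed.

Lemma cabs_ge0 z : 0 <= cabs z.
Proof. exact: sqrtr_ge0. Qed.

Lemma cabsM z w : cabs (z * w) = cabs z * cabs w.
Proof. by apply: complexI; rewrite rmorphM /= -!normC_cabs normrM. Qed.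

Lemma cabsD z w : cabs (z + w) <= cabs z + cabs w.
Proof. by rewrite -lecR rmorphD /= -!normC_cabs ler_normD. Qed.

Lemma cabsN z : cabs (- z) = cabs z.
Proof. by apply: complexI; rewrite -!normC_cabs normrN. Qed.

Lemma cabsB z w : cabs (z - w) <= cabs z + cabs w.
Proof. by rewrite -(cabsN w); exact: cabsD. Qed.

Lemma cabs_distC z w : cabs (z - w) = cabs (w - z).
Proof. by rewrite -cabsN opprB. Qed.

Lemma cabs_sub_ge z w : cabs z - cabs w <= cabs (z + w).
Proof. by rewrite lerBlDr -{1}(addrK w z); exact: cabsB. Qed.

Lemma cabs0 : cabs (0 : C) = 0.
Proof. by apply: complexI; rewrite -normC_cabs normr0. Qed.

Lemma cabs1 : cabs (1 : C) = 1.
Proof. by apply: complexI; rewrite -normC_cabs normr1. Qed.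

Lemma cabs_eq0 z : (cabs z == 0) = (z == 0).
Proof. by rewrite -(inj_eq (@complexI R)) -normC_cabs normr_eq0. Qed.

Lemma cabs_gt0 z : (0 < cabs z) = (z != 0).
Proof. by rewrite lt_def cabs_ge0 andbT cabs_eq0. Qed.

Lemma cabsR (x : R) : cabs x%:C = `|x|.
Proof. by rewrite /cabs /= expr0n addr0 sqrtr_sqr. Qed.

Lemma cabsV z : cabs z^-1 = (cabs z)^-1.
Proof. by apply: complexI; rewrite fmorphV /= -!normC_cabs normfV. Qed.

Lemma cabsX z n : cabs (z ^+ n) = cabs z ^+ n.
Proof. by apply: complexI; rewrite rmorphXn /= -!normC_cabs normrX. Qed.

Lemma cabs_i : cabs ('i : C) = 1.
Proof. by rewrite /cabs /= expr0n add0r expr1n sqrtr1. Qed.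

Lemma sqr_cabs z : cabs z ^+ 2 = complex.Re z ^+ 2 + complex.Im z ^+ 2.
Proof. by rewrite sqr_sqrtr // addr_ge0 ?sqr_ge0. Qed.

Lemma Re_le_cabs z : `|complex.Re z| <= cabs z.
Proof.
by rewrite -[X in X <= _]sqrtr_sqr ler_wsqrtr // lerDl sqr_ge0.
Qed.

Lemma Im_le_cabs z : `|complex.Im z| <= cabs z.
Proof.
by rewrite -[X in X <= _]sqrtr_sqr ler_wsqrtr // lerDr sqr_ge0.
Qed.

Lemma cabs_le_ReIm z : cabs z <= `|complex.Re z| + `|complex.Im z|.
Proof.
rewrite {1}[z]complexE; apply: le_trans (cabsD _ _) _.
by rewrite cabsM cabs_i mul1r !cabsR.
Qed.

End Modulus.

Ltac mxring := apply/matrixP => ? ?; rewrite !mxE; ring.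

Section MatrixNorm.
Variable R : realType.
Local Notation C := R[i].

(** The entrywise l^1 norm: real-valued and submultiplicative for rectangular matrices, at the price
    of dimension factors in comparisons with other norms. *)
Definition nm m n (A : 'M[C]_(m, n)) : R := \sum_i \sum_j cabs (A i j).

Lemma nm_ge0 m n (A : 'M[C]_(m, n)) : 0 <= nm A.
Proof. by do 2![apply: sumr_ge0 => ? _]; exact: cabs_ge0. Qed.

Lemma nm_entry m n (A : 'M[C]_(m, n)) i j : cabs (A i j) <= nm A.
Proof.
rewrite /nm (bigD1 i) //= (bigD1 j) //= -addrA lerDl addr_ge0 //.
  by apply: sumr_ge0 => ? _; exact: cabs_ge0.
by do 2![apply: sumr_ge0 => ? _]; exact: cabs_ge0.
Qed.

Lemma nm0 m n : nm (0 : 'M[C]_(m, n)) = 0.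
Proof. by apply: big1 => i _; apply: big1 => j _; rewrite mxE cabs0. Qed.

Lemma nm_eq0 m n (A : 'M[C]_(m, n)) : nm A <= 0 -> A = 0.
Proof.
move=> A0; apply/matrixP => i j; rewrite mxE; apply/eqP.
by rewrite -cabs_eq0 eq_le cabs_ge0 (le_trans (nm_entry A i j) A0).
Qed.

Lemma nmD m n (A B : 'M[C]_(m, n)) : nm (A + B) <= nm A + nm B.
Proof.
rewrite /nm -big_split; apply: ler_sum => i _ /=; rewrite -big_split.
by apply: ler_sum => j _ /=; rewrite mxE cabsD.
Qed.

Lemma nmN m n (A : 'M[C]_(m, n)) : nm (- A) = nm A.
Proof.
by apply: eq_bigr => i _; apply: eq_bigr => j _; rewrite mxE cabsN.
Qed.

Lemma nmB m n (A B : 'M[C]_(m, n)) : nm (A - B) <= nm A + nm B.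
Proof. by rewrite -(nmN B) nmD. Qed.

Lemma nm_distC m n (A B : 'M[C]_(m, n)) : nm (A - B) = nm (B - A).
Proof. by rewrite -nmN opprB. Qed.

Lemma nmZ m n (c : C) (A : 'M[C]_(m, n)) : nm (c *: A) = cabs c * nm A.
Proof.
rewrite /nm mulr_sumr; apply: eq_bigr => i _; rewrite mulr_sumr.
by apply: eq_bigr => j _; rewrite mxE cabsM.
Qed.

Lemma nm_sum m n (I : Type) (r : seq I) (P : pred I) (F : I -> 'M[C]_(m, n)) :
  nm (\sum_(i <- r | P i) F i) <= \sum_(i <- r | P i) nm (F i).
Proof.
elim/big_ind2: _ => [|A a B b Aa Bb|//]; first by rewrite nm0.
exact: le_trans (nmD _ _) (lerD Aa Bb).
Qed.

Lemma cabs_sum (I : Type) (r : seq I) (P : pred I) (F : I -> C) :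
  cabs (\sum_(i <- r | P i) F i) <= \sum_(i <- r | P i) cabs (F i).
Proof.
elim/big_ind2: _ => [|a x b y ax bY|//]; first by rewrite cabs0.
exact: le_trans (cabsD _ _) (lerD ax bY).
Qed.

Lemma nmM m n p (A : 'M[C]_(m, n)) (B : 'M[C]_(n, p)) :
  nm (A *m B) <= nm A * nm B.
Proof.
rewrite /nm mulr_suml; apply: ler_sum => i _.
apply: (@le_trans _ _ (\sum_k \sum_j cabs (A i j) * cabs (B j k))).
  apply: ler_sum => k _; rewrite mxE; apply: le_trans (cabs_sum _ _ _) _.
  by apply: ler_sum => j _; rewrite cabsM.
rewrite exchange_big mulr_suml /=; apply: ler_sum => j _.
rewrite -mulr_sumr ler_wpM2l ?cabs_ge0 //.
rewrite [X in _ <= X](bigD1 j) //= lerDl.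
by do 2![apply: sumr_ge0 => ? _]; exact: cabs_ge0.
Qed.

Lemma nm_scalar n (c : C) : nm (c%:M : 'M[C]_n) = n%:R * cabs c.
Proof.
rewrite /nm (eq_bigr (fun=> cabs c)); last first.
  move=> i _; rewrite (bigD1 i) //= mxE eqxx mulr1n big1 ?addr0 // => j ji.
  by rewrite mxE eq_sym (negbTE ji) mulr0n cabs0.
by rewrite sumr_const card_ord mulr_natl.
Qed.

Lemma nm_tr m n (A : 'M[C]_(m, n)) : nm A^T = nm A.
Proof.
rewrite /nm exchange_big; apply: eq_bigr => i _; apply: eq_bigr => j _.
by rewrite mxE.
Qed.

Lemma nm_le_entries m n (A : 'M[C]_(m, n)) (k : R) :
  (forall i j, cabs (A i j) <= k) -> nm A <= (m * n)%:R * k.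
Proof.
move=> Ak; apply: (@le_trans _ _ (\sum_(i < m) \sum_(j < n) k)).
  by apply: ler_sum => i _; apply: ler_sum => j _; exact: Ak.
rewrite (eq_bigr (fun=> n%:R * k)); last first.
  by move=> i _; rewrite sumr_const card_ord mulr_natl.
by rewrite sumr_const card_ord -[_ *+ m]mulr_natl natrM mulrA.
Qed.

End MatrixNorm.

Section ComplexDerivative.
Variable R : realType.
Local Notation C := R[i].

(** Complex differentiability without quotients: the increment h = 0 is allowed, and products and
    compositions reduce to norm inequalities. [mder_is_derive] and [derivable_mder] connect it with
    the derivative of the statement. *)
Definition mder m n (F : C -> 'M[C]_(m, n)) (z : C) (L : 'M[C]_(m, n)) :=
  forall eps : R, 0 < eps -> exists2 d : R, 0 < d & forall h : C, cabs h < d ->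
    nm (F (z + h) - F z - h *: L) <= eps * cabs h.

Definition cder (f : C -> C) (z l : C) :=
  forall eps : R, 0 < eps -> exists2 d : R, 0 < d & forall h : C, cabs h < d ->
    cabs (f (z + h) - f z - h * l) <= eps * cabs h.

Lemma mder_eq m n (F : C -> 'M[C]_(m, n)) z L L' :
  mder F z L -> L = L' -> mder F z L'.
Proof. by move=> ? <-. Qed.

Lemma cder_eq (f : C -> C) z l l' : cder f z l -> l = l' -> cder f z l'.
Proof. by move=> ? <-. Qed.

Lemma mder_near m n (F G : C -> 'M[C]_(m, n)) z L (d : R) : 0 < d ->
  (forall h, cabs h < d -> G (z + h) = F (z + h)) -> mder F z L -> mder G z L.
Proof.
move=> d0 GF dF e e0; have [d1 d10 H] := dF e e0.
exists (Num.min d d1); first by rewrite lt_min d0.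
move=> h; rewrite lt_min => /andP[hd hd1].
by rewrite GF // -{2}(addr0 z) GF ?cabs0 // addr0; exact: H.
Qed.

Lemma mder_ext m n (F G : C -> 'M[C]_(m, n)) z L :
  (forall x, G x = F x) -> mder F z L -> mder G z L.
Proof. by move=> GF; apply: (mder_near ltr01) => h _; exact: GF. Qed.

Lemma mder_const m n (A : 'M[C]_(m, n)) z : mder (fun=> A) z 0.
Proof.
move=> e e0; exists 1 => // h _.
by rewrite subrr scaler0 subr0 nm0 mulr_ge0 ?cabs_ge0 ?ltW.
Qed.

Lemma mderD m n (F G : C -> 'M[C]_(m, n)) z A B :
  mder F z A -> mder G z B -> mder (fun x => F x + G x) z (A + B).
Proof.
move=> dF dG e e0; have e2 : 0 < e / 2 by rewrite divr_gt0.
have [d1 d10 H1] := dF _ e2; have [d2 d20 H2] := dG _ e2.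
exists (Num.min d1 d2); first by rewrite lt_min d10.
move=> h; rewrite lt_min => /andP[hd1 hd2].
have -> : F (z + h) + G (z + h) - (F z + G z) - h *: (A + B) =
  (F (z + h) - F z - h *: A) + (G (z + h) - G z - h *: B).
  by mxring.
apply: le_trans (nmD _ _) _; rewrite [e]splitr mulrDl.
by apply: lerD; [exact: H1|exact: H2].
Qed.

Lemma mder_lip m n (F : C -> 'M[C]_(m, n)) z A : mder F z A ->
  exists2 d : R, 0 < d & forall h : C, cabs h < d ->
    nm (F (z + h) - F z) <= (1 + nm A) * cabs h.
Proof.
move=> dF; have [d d0 H] := dF 1 ltr01; exists d => // h hd.
rewrite -[X in nm X](subrK (h *: A)); apply: le_trans (nmD _ _) _.
by rewrite mulrDl nmZ [nm A * _]mulrC lerD // H.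
Qed.

Lemma mder_cont m n (F : C -> 'M[C]_(m, n)) z A : mder F z A ->
  forall e : R, 0 < e -> exists2 d : R, 0 < d & forall h : C, cabs h < d ->
    nm (F (z + h) - F z) < e.
Proof.
move=> /mder_lip[d d0 H] e e0.
have k0 : 0 < 1 + nm A by rewrite ltr_wpDr ?nm_ge0.
exists (Num.min d (e / (1 + nm A))); first by rewrite lt_min d0 divr_gt0.
move=> h; rewrite lt_min => /andP[hd he]; apply: le_lt_trans (H _ hd) _.
by rewrite mulrC -ltr_pdivlMr.
Qed.

Lemma mderM m n p (F : C -> 'M[C]_(m, n)) (G : C -> 'M[C]_(n, p)) z A B :
  mder F z A -> mder G z B ->
  mder (fun x => F x *m G x) z (A *m G z + F z *m B).
Proof.
move=> dF dG e e0.
have [d0 d00 HG] := mder_lip dG.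
pose k : R := 1 + nm A + nm (F z) + nm (G z) + (1 + nm B).
have k0 : 0 < k.
  by rewrite /k !ltr_wpDr ?addr_ge0 ?nm_ge0 ?ler01.
have e3 : 0 < e / (3 * k) by rewrite divr_gt0 // mulr_gt0.
have [d1 d10 H1] := dF _ e3; have [d2 d20 H2] := dG _ e3.
pose d3 : R := Num.min 1 (e / (3 * k * k)).
exists (Num.min (Num.min d0 d3) (Num.min d1 d2)).
  by rewrite !lt_min d00 d10 d20 ltr01 divr_gt0 // !mulr_gt0.
move=> h; rewrite !lt_min => /andP[/andP[hd0 /andP[h1 he]] /andP[hd1 hd2]].
have c0 := cabs_ge0 h.
have -> : F (z + h) *m G (z + h) - F z *m G z - h *: (A *m G z + F z *m B) =
  (F (z + h) - F z - h *: A) *m G (z + h)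
  + h *: (A *m (G (z + h) - G z)) + F z *m (G (z + h) - G z - h *: B).
  rewrite !mulmxBl !mulmxBr scalerDr scalerBr -!scalemxAl -!scalemxAr.
  move: (F (z + h) *m G (z + h)) (F z *m G z) (F z *m G (z + h)).
  move: (F z *m B) (A *m G z) (A *m G (z + h)) => ? ? ? ? ? ?; mxring.
apply: le_trans (nmD _ _) _; apply: le_trans (lerD (nmD _ _) (lexx _)) _.
have nG : nm (G (z + h)) <= k.
  rewrite -[G _](subrK (G z)); apply: le_trans (nmD _ _) _.
  apply: le_trans (lerD (HG _ hd0) (lexx _)) _.
  have : (1 + nm B) * cabs h <= 1 + nm B.
    by rewrite ler_piMr ?(ltW h1) // addr_ge0 ?ler01 ?nm_ge0.
  rewrite /k; have := nm_ge0 A; have := nm_ge0 (F z); lra.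
have T1 : nm ((F (z + h) - F z - h *: A) *m G (z + h)) <= e / 3 * cabs h.
  apply: le_trans (nmM _ _) _.
  apply: le_trans (ler_pM (nm_ge0 _) (nm_ge0 _) (H1 _ hd1) nG) _.
  rewrite le_eqVlt; apply/orP; left; apply/eqP; field; rewrite gt_eqF //.
have T2 : nm (h *: (A *m (G (z + h) - G z))) <= e / 3 * cabs h.
  rewrite nmZ mulrC ler_wpM2r //; apply: le_trans (nmM _ _) _.
  apply: (@le_trans _ _ (k * (k * (e / (3 * k * k))))).
    apply: ler_pM; rewrite ?nm_ge0 //.
      rewrite /k; have := nm_ge0 B; have := nm_ge0 (F z); have := nm_ge0 (G z); lra.
    apply: le_trans (HG _ hd0) _; apply: ler_pM; rewrite ?addr_ge0 ?nm_ge0 ?(ltW he) //.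
    rewrite /k; have := nm_ge0 A; have := nm_ge0 (F z); have := nm_ge0 (G z); lra.
  rewrite le_eqVlt; apply/orP; left; apply/eqP; field; rewrite gt_eqF //.
have T3 : nm (F z *m (G (z + h) - G z - h *: B)) <= e / 3 * cabs h.
  apply: le_trans (nmM _ _) _.
  apply: (@le_trans _ _ (k * (e / (3 * k) * cabs h))).
    apply: ler_pM; rewrite ?nm_ge0 ?H2 //.
    rewrite /k; have := nm_ge0 B; have := nm_ge0 A; have := nm_ge0 (G z); lra.
  rewrite le_eqVlt; apply/orP; left; apply/eqP; field; rewrite gt_eqF //.
lra.
Qed.

Lemma mder_mull m n p (A : 'M[C]_(m, n)) (G : C -> 'M[C]_(n, p)) z B :
  mder G z B -> mder (fun x => A *m G x) z (A *m B).
Proof.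
by move=> dG; apply: mder_eq (mderM (mder_const A z) dG) _; rewrite mul0mx add0r.
Qed.

Lemma mder_mulr m n p (A : 'M[C]_(n, p)) (G : C -> 'M[C]_(m, n)) z B :
  mder G z B -> mder (fun x => G x *m A) z (B *m A).
Proof.
by move=> dG; apply: mder_eq (mderM dG (mder_const A z)) _; rewrite mulmx0 addr0.
Qed.

Lemma mder_tr m n (F : C -> 'M[C]_(m, n)) z A :
  mder F z A -> mder (fun x => (F x)^T) z A^T.
Proof.
move=> dF e e0; have [d d0 H] := dF e e0; exists d => // h hd.
by rewrite -!linearB -linearZ -linearB nm_tr; exact: H.
Qed.

Lemma cder_scalar (f : C -> C) z l n : cder f z l ->
  mder (fun x => (f x)%:M : 'M[C]_n) z l%:M.
Proof.
move=> df e e0; have n0 : 0 < (n%:R + 1 : R) by rewrite ltr_wpDl ?ler0n.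
have [d d0 H] := df (e / (n%:R + 1)) (divr_gt0 e0 n0); exists d => // h hd.
rewrite scale_scalar_mx -!raddfB /= nm_scalar.
apply: le_trans (ler_wpM2l (ler0n _ _) (H _ hd)) _.
rewrite mulrA ler_wpM2r ?cabs_ge0 // mulrA ler_pdivrMr //; lra.
Qed.

Lemma cder_mx1 (f : C -> C) z l :
  mder (fun x => (f x)%:M : 'M[C]_1) z l%:M -> cder f z l.
Proof.
move=> df e e0; have [d d0 H] := df e e0; exists d => // h hd.
have := H _ hd; rewrite scale_scalar_mx -!raddfB /= nm_scalar mul1r; exact.
Qed.

Lemma mderZ m n (f : C -> C) (F : C -> 'M[C]_(m, n)) z l A :
  cder f z l -> mder F z A ->
  mder (fun x => f x *: F x) z (l *: F z + f z *: A).
Proof.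
move=> df dF; have := mderM (cder_scalar m df) dF.
rewrite !mul_scalar_mx; apply: mder_ext => x; by rewrite mul_scalar_mx.
Qed.

Lemma mderZl m n (f : C -> C) (A : 'M[C]_(m, n)) z l :
  cder f z l -> mder (fun x => f x *: A) z (l *: A).
Proof.
by move=> df; apply: mder_eq (mderZ df (mder_const A z)) _; rewrite scaler0 addr0.
Qed.

Lemma cder_id z : cder id z 1.
Proof.
move=> e e0; exists 1 => // h _.
have -> : id (z + h) - id z - h * 1 = 0 by rewrite /=; ring.
by rewrite cabs0 mulr_ge0 ?cabs_ge0 ?ltW.
Qed.

Lemma cder_const c z : cder (fun=> c) z 0.
Proof.
move=> e e0; exists 1 => // h _.
by rewrite subrr mulr0 subrr cabs0 mulr_ge0 ?cabs_ge0 ?ltW.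
Qed.

Lemma cderD f g z a b : cder f z a -> cder g z b ->
  cder (fun x => f x + g x) z (a + b).
Proof.
move=> df dg; apply: cder_mx1; rewrite raddfD.
apply: mder_ext (mderD (cder_scalar 1 df) (cder_scalar 1 dg)) => x.
by rewrite raddfD.
Qed.

Lemma cderM f g z a b : cder f z a -> cder g z b ->
  cder (fun x => f x * g x) z (a * g z + f z * b).
Proof.
move=> df dg; apply: cder_mx1; rewrite raddfD /= -!scale_scalar_mx.
apply: mder_ext (mderZ df (cder_scalar 1 dg)) => x.
by rewrite scale_scalar_mx.
Qed.

Lemma cderZ c g z b : cder g z b -> cder (fun x => c * g x) z (c * b).
Proof.
by move=> dg; apply: cder_eq (cderM (cder_const c z) dg) _; rewrite mul0r add0r.
Qed.

Lemma mder_scale m n c (F : C -> 'M[C]_(m, n)) z A :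
  mder F z A -> mder (fun x => c *: F x) z (c *: A).
Proof.
move=> dF; apply: mder_eq (mderZ (cder_const c z) dF) _.
by rewrite scale0r add0r.
Qed.

Lemma mderB m n (F G : C -> 'M[C]_(m, n)) z A B :
  mder F z A -> mder G z B -> mder (fun x => F x - G x) z (A - B).
Proof.
move=> dF dG; rewrite -scaleN1r.
apply: mder_ext (mderD dF (mder_scale (-1) dG)) => x; by rewrite scaleN1r.
Qed.

Lemma mder_sum m n (I : Type) (r : seq I) (F : I -> C -> 'M[C]_(m, n)) z L :
  (forall i, mder (F i) z (L i)) ->
  mder (fun x => \sum_(i <- r) F i x) z (\sum_(i <- r) L i).
Proof.
move=> dF; elim: r => [|i r IH].
  by rewrite big_nil; apply: mder_ext (mder_const 0 z) => x; rewrite big_nil.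
rewrite big_cons; apply: mder_ext (mderD (dF i) IH) => x.
by rewrite big_cons.
Qed.

Lemma cder_sum (I : Type) (r : seq I) (F : I -> C -> C) z L :
  (forall i, cder (F i) z (L i)) ->
  cder (fun x => \sum_(i <- r) F i x) z (\sum_(i <- r) L i).
Proof.
move=> dF; apply: cder_mx1; rewrite raddf_sum.
apply: mder_ext (mder_sum r (fun i => cder_scalar 1 (dF i))) => x.
by rewrite raddf_sum.
Qed.

Lemma cderX z n : cder (fun x => x ^+ n) z (n%:R * z ^+ n.-1).
Proof.
elim: n => [|n IH].
  by rewrite mul0r; exact: cder_const.
have H := cderM (cder_id z) IH; rewrite /= in H.
have -> : (fun x : C => x ^+ n.+1) = (fun x => x * x ^+ n).
  by apply/funext => x; rewrite exprS.
apply: cder_eq H _; rewrite mul1r /=.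
by case: n IH => [|n] _; rewrite ?mul0r ?mulr0 ?expr0 ?mulr1 ?addr0 // mulrCA -exprS -[in RHS]nat1r mulrDl mul1r.
Qed.

Lemma mder_comp m n (g : C -> C) (F : C -> 'M[C]_(m, n)) z l L :
  cder g z l -> mder F (g z) L -> mder (fun x => F (g x)) z (l *: L).
Proof.
move=> dg dF e e0.
pose k : R := 1 + cabs l + nm L.
have k0 : 0 < k by rewrite /k -addrA ltr_wpDr // addr_ge0 ?cabs_ge0 ?nm_ge0.
have [d1 d10 H1] := dF (e / (2 * k)) (divr_gt0 e0 (mulr_gt0 (ltr0n _ 2) k0)).
have m0 : 0 < Num.min 1 (e / (2 * k)).
  by rewrite lt_min ltr01 divr_gt0 // mulr_gt0.
have [d2 d20 H2] := dg _ m0.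
exists (Num.min d2 (d1 / k)); first by rewrite lt_min d20 divr_gt0.
move=> h; rewrite lt_min => /andP[hd2 hd1].
have c0 := cabs_ge0 h.
pose w := g (z + h) - g z.
have H2h : cabs (w - h * l) <= Num.min 1 (e / (2 * k)) * cabs h := H2 _ hd2.
have H2a : cabs (w - h * l) <= cabs h.
  by apply: le_trans H2h _; rewrite ler_piMl // ge_min lexx.
have H2b : cabs (w - h * l) <= e / (2 * k) * cabs h.
  by apply: le_trans H2h _; rewrite ler_wpM2r // ge_min lexx orbT.
have wk : cabs w <= k * cabs h.
  rewrite -[w](subrK (h * l)); apply: le_trans (cabsD _ _) _.
  rewrite cabsM /k; have := mulr_ge0 (nm_ge0 L) c0; nra.
have wd : cabs w < d1.
  by apply: le_lt_trans wk _; rewrite mulrC -ltr_pdivlMr.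
have -> : F (g (z + h)) - F (g z) - h *: (l *: L) =
  (F (g z + w) - F (g z) - w *: L) + (w - h * l) *: L.
  have -> : g (z + h) = g z + w by rewrite /w; ring.
  by mxring.
apply: le_trans (nmD _ _) _; rewrite nmZ.
apply: le_trans (lerD (H1 _ wd) (ler_wpM2r (nm_ge0 L) H2b)) _.
have e1 : e / (2 * k) * cabs w <= e / 2 * cabs h.
  apply: (@le_trans _ _ (e / (2 * k) * (k * cabs h))).
    by rewrite ler_wpM2l // ltW // divr_gt0 // mulr_gt0.
  by rewrite le_eqVlt; apply/orP; left; apply/eqP; field; rewrite gt_eqF.
have e2 : e / (2 * k) * cabs h * nm L <= e / 2 * cabs h.
  apply: (@le_trans _ _ (e / (2 * k) * cabs h * k)).
    rewrite ler_wpM2l //; first by rewrite mulr_ge0 // ltW // divr_gt0 // mulr_gt0.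
    by rewrite /k; have := cabs_ge0 l; lra.
  by rewrite le_eqVlt; apply/orP; left; apply/eqP; field; rewrite gt_eqF.
lra.
Qed.

Lemma cder_comp (g f : C -> C) z l k :
  cder g z l -> cder f (g z) k -> cder (fun x => f (g x)) z (l * k).
Proof.
move=> dg df; apply: cder_mx1.
have := mder_comp dg (cder_scalar 1 df); rewrite scale_scalar_mx; exact.
Qed.

Lemma mder_shift m n (F : C -> 'M[C]_(m, n)) z a L :
  mder F (a + z) L -> mder (fun x => F (a + x)) z L.
Proof.
move=> dF; have H : cder (fun x => a + x) z 1.
  by apply: cder_eq (cderD (cder_const a z) (cder_id z)) _; rewrite add0r.
by have := mder_comp H dF; rewrite scale1r.
Qed.

End ComplexDerivative.

Local Open Scope classical_set_scope.
Local Open Scope ring_scope.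
Local Open Scope complex_scope.

(** * Real derivatives and a backward Gronwall inequality *)

Section RealLine.
Variable R : realType.
Local Notation C := R[i].

Definition rder (f : R -> R) (t l : R) :=
  forall eps : R, 0 < eps -> exists2 d : R, 0 < d & forall h : R, `|h| < d ->
    `|f (t + h) - f t - h * l| <= eps * `|h|.

Lemma rder_is_derive (f : R -> R) t l : rder f t l -> is_derive t 1 f l.
Proof.
move=> df.
have H : (fun h : R => h^-1 *: (f (h *: 1 + t) - f t)) @ 0^' --> l.
  apply/cvgrPdist_le => e e0; have [d d0 Hd] := df e e0.
  near=> h.
  have h0 : h != 0 by near: h; exact: nbhs_dnbhs_neq.
  have hd : `|h| < d.
    near: h; apply: dnbhs0_lt => //.
  rewrite distrC; set w := _ - l.
  have -> : w = (f (t + h) - f t - h * l) / h.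
    rewrite /w -[h *: 1]/(h * 1) mulr1 [h + t]addrC -[_ *: _]/(_ * _).
    by field.
  by rewrite normf_div ler_pdivrMr ?normr_gt0 //; exact: Hd.
apply: DeriveDef; first by apply/cvg_ex; exists l.
exact: (cvg_lim _ H).
Unshelve. all: by end_near. Qed.

Lemma is_derive_nincr (f df : R -> R) (a b : R) : a <= b ->
  (forall t, a <= t <= b -> is_derive t 1 f (df t)) ->
  (forall t, a <= t <= b -> df t <= 0) -> f b <= f a.
Proof.
move=> ab Hd Hn.
have [c cab] : exists2 c, c \in `[a, b]%R & f b - f a = df c * (b - a).
  apply: MVT_segment => // [x|].
    by rewrite in_itv /= => /andP[xa xb]; apply: Hd; rewrite !ltW.
  apply: derivable_within_continuous => x; rewrite in_itv /= => xab.
  by have [] := Hd x xab.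
rewrite -subr_le0 => ->; rewrite mulr_le0_ge0 ?subr_ge0 //.
by apply: Hn; move: cab; rewrite in_itv.
Qed.

Lemma rder_le (f g df dg : R -> R) (a b : R) : a <= b ->
  (forall t, a <= t <= b -> rder f t (df t)) ->
  (forall t, a <= t <= b -> is_derive t 1 g (dg t)) ->
  (forall t, a <= t <= b -> df t <= dg t) -> f b - f a <= g b - g a.
Proof.
move=> ab Df Dg H.
suff : (f - g) b <= (f - g) a by rewrite !fctE; lra.
apply: (@is_derive_nincr _ (fun t => df t - dg t)) => // t tab.
  by apply: is_deriveB; [exact/rder_is_derive/Df|exact: Dg].
by rewrite subr_le0 H.
Qed.

(** By hypothesis (m + c) exp(- G) is nondecreasing, so the value at the left end is controlled by
    the value at the right end. *)
Lemma energy_bound (m dm G dG : R -> R) (a b c : R) : a <= b ->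
  (forall t, a <= t <= b -> rder m t (dm t)) ->
  (forall t, a <= t <= b -> is_derive t 1 G (dG t)) ->
  (forall t, a <= t <= b -> dG t * (m t + c) <= dm t) ->
  m a + c <= (m b + c) * expR (G a - G b).
Proof.
move=> ab Dm DG H.
pose f : R -> R := - (m + cst c) * (expR \o - G).
suff Hf : f b <= f a.
  move: Hf; rewrite /f !fctE /= !mulNr lerN2 !expRN => Hf.
  by rewrite expRB mulrA mulrAC -ler_pdivrMr ?expR_gt0.
have L t : a <= t <= b -> is_derive t 1 f (- (dm t - dG t * (m t + c)) * expR (- G t)).
  move=> tab.
  have d1 : is_derive t 1 m (dm t) by exact/rder_is_derive/Dm.
  have d2 := DG t tab.
  have d3 : is_derive t 1 (m + cst c) (dm t + 0) by exact: is_deriveD.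
  have d4 : is_derive t 1 (expR \o - G) (expR (- G t) * - dG t).
    by apply: is_derive1_comp; exact: is_deriveN.
  apply: is_derive_eq (is_deriveM (is_deriveN d3) d4) _.
  by rewrite -!/(_ * _) !fctE /= -![_ *: _]/(_ * _); ring.
apply: is_derive_nincr ab L _ => t tab.
rewrite mulNr oppr_le0 mulr_ge0 ?expR_ge0 // subr_ge0; exact: H.
Qed.

End RealLine.

(** * Mean value and Taylor bounds along complex segments *)

Section MeanValue.
Variable R : realType.
Local Notation C := R[i].
Local Notation Re := (@complex.Re R).
Local Notation Im := (@complex.Im R).

(** The real part of the Hermitian inner product, which suffices for energies along real lines. *)
Definition ip m n (A B : 'M[C]_(m, n)) : R :=
  \sum_i \sum_j (Re (A i j) * Re (B i j) + Im (A i j) * Im (B i j)).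

Lemma ReD (z w : C) : Re (z + w) = Re z + Re w.
Proof. by case: z; case: w. Qed.

Lemma ImD (z w : C) : Im (z + w) = Im z + Im w.
Proof. by case: z; case: w. Qed.

Lemma ReN (z : C) : Re (- z) = - Re z.
Proof. by case: z. Qed.

Lemma ImN (z : C) : Im (- z) = - Im z.
Proof. by case: z. Qed.

Lemma ReRM (t : R) (z : C) : Re (t%:C * z) = t * Re z.
Proof. by case: z => a b; rewrite /= mul0r subr0. Qed.

Lemma ImRM (t : R) (z : C) : Im (t%:C * z) = t * Im z.
Proof. by case: z => a b; rewrite /= mul0r addr0. Qed.

Lemma ipC m n (A B : 'M[C]_(m, n)) : ip A B = ip B A.
Proof. by apply: eq_bigr => i _; apply: eq_bigr => j _; ring. Qed.

Lemma ipDr m n (A B D : 'M[C]_(m, n)) : ip A (B + D) = ip A B + ip A D.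
Proof.
rewrite /ip -big_split; apply: eq_bigr => i _ /=; rewrite -big_split.
by apply: eq_bigr => j _ /=; rewrite mxE ReD ImD; ring.
Qed.

Lemma ipZr m n (t : R) (A B : 'M[C]_(m, n)) : ip A (t%:C *: B) = t * ip A B.
Proof.
rewrite /ip mulr_sumr; apply: eq_bigr => i _; rewrite mulr_sumr.
by apply: eq_bigr => j _; rewrite mxE ReRM ImRM; ring.
Qed.

Lemma ipNr m n (A B : 'M[C]_(m, n)) : ip A (- B) = - ip A B.
Proof. by rewrite -scaleN1r -[-1](rmorphN1 (real_complex R)) ipZr mulN1r. Qed.

Lemma ipBr m n (A B D : 'M[C]_(m, n)) : ip A (B - D) = ip A B - ip A D.
Proof. by rewrite ipDr ipNr. Qed.

Lemma ipBl m n (A B D : 'M[C]_(m, n)) : ip (B - D) A = ip B A - ip D A.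
Proof. by rewrite !(ipC _ A) ipBr. Qed.

Lemma ip0r m n (A : 'M[C]_(m, n)) : ip A 0 = 0.
Proof. by rewrite -(scale0r A) -[0](rmorph0 (real_complex R)) ipZr mul0r. Qed.

Lemma ip_le m n (A B : 'M[C]_(m, n)) : `|ip A B| <= nm A * nm B.
Proof.
apply: le_trans (ler_norm_sum _ _ _) _; rewrite /nm mulr_suml; apply: ler_sum => i _.
apply: le_trans (ler_norm_sum _ _ _) _; rewrite mulr_suml; apply: ler_sum => j _.
apply: (@le_trans _ _ (cabs (A i j) * cabs (B i j))); last first.
  by rewrite ler_wpM2l ?cabs_ge0 //; exact: nm_entry.
rewrite -ler_sqr ?nnegrE ?normr_ge0 ?mulr_ge0 ?cabs_ge0 //.
rewrite real_normK ?num_real // exprMn !sqr_cabs.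
set a := Re _; set b := Im _; set c := Re _; set d := Im _.
have := sqr_ge0 (a * d - b * c); nra.
Qed.

Lemma ip_ge0 m n (A : 'M[C]_(m, n)) : 0 <= ip A A.
Proof.
by do 2![apply: sumr_ge0 => ? _]; rewrite addr_ge0 // -expr2 sqr_ge0.
Qed.

Lemma nm_sqr_le m n (A : 'M[C]_(m, n)) : nm A ^+ 2 <= (m * n)%:R ^+ 2 * ip A A.
Proof.
have H : nm A <= (m * n)%:R * Num.sqrt (ip A A).
  apply: nm_le_entries => i j; rewrite ler_sqrt ?ip_ge0 //.
  rewrite !expr2 /ip (bigD1 i) //= (bigD1 j) //= -addrA lerDl addr_ge0 //.
    by apply: sumr_ge0 => ? _; rewrite addr_ge0 // -expr2 sqr_ge0.
  by do 2![apply: sumr_ge0 => ? _]; rewrite addr_ge0 // -expr2 sqr_ge0.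
rewrite -[ip A A]sqr_sqrtr ?ip_ge0 // -exprMn.
by rewrite ler_sqr ?nnegrE ?nm_ge0 ?mulr_ge0 ?ler0n ?sqrtr_ge0.
Qed.

Lemma ip_line m n (V : 'M[C]_(m, n)) (F : C -> 'M[C]_(m, n)) a b t L :
  mder F (a + t%:C * b) L -> rder (fun t => ip V (F (a + t%:C * b))) t (ip V (b *: L)).
Proof.
move=> dF e e0; have k0 : 0 < 1 + nm V * cabs b.
  by rewrite ltr_wpDr ?mulr_ge0 ?nm_ge0 ?cabs_ge0.
have [d d0 H] := dF (e / (1 + nm V * cabs b)) (divr_gt0 e0 k0).
have b0 : 0 < 1 + cabs b by rewrite ltr_wpDr ?cabs_ge0.
exists (d / (1 + cabs b)); first by rewrite divr_gt0.
move=> h hd.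
have hb : cabs (h%:C * b) < d.
  rewrite cabsM cabsR; move: hd; rewrite ltr_pdivlMr //; apply: le_lt_trans.
  by rewrite mulrDr mulr1 lerDr.
have -> : a + (t + h)%:C * b = (a + t%:C * b) + h%:C * b.
  by rewrite rmorphD /=; ring.
rewrite -ipBr -ipZr -ipBr scalerA; apply: le_trans (ip_le _ _) _.
apply: le_trans (ler_wpM2l (nm_ge0 _) (H _ hb)) _.
rewrite cabsM cabsR mulrCA -[e / _ * _]mulrA ler_wpM2l ?(ltW e0) //.
rewrite mulrC ler_pdivrMr //.
by rewrite mulrCA ler_wpM2l ?normr_ge0 // lerDr ler01.
Qed.

(** Pairing F with the fixed matrix V = F (a + b) - F a gives a real function, compared with nm V *
    k * t^(j+1) / (j+1). The resulting bound on the square of V is divided by [nm V]; the dimension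
    factor converts [ip] into [nm]. The power t^j is kept because its primitive supplies the
    factorials of the Picard series. *)
Lemma ray_bound m n (F L : C -> 'M[C]_(m, n)) a b k j : 0 <= k ->
  (forall t : R, 0 <= t <= 1 -> mder F (a + t%:C * b) (L (a + t%:C * b))) ->
  (forall t : R, 0 <= t <= 1 -> nm (b *: L (a + t%:C * b)) <= k * t ^+ j) ->
  nm (F (a + b) - F a) <= (m * n)%:R ^+ 2 * (k / j.+1%:R).
Proof.
move=> k0 dF bL; set V := F (a + b) - F a.
have j0 : (0 : R) < j.+1%:R by rewrite ltr0n.
pose g : R -> R := nm V * k / j.+1%:R *: id ^+ j.+1.
have K : ip V V <= nm V * (k / j.+1%:R).
  have -> : nm V * (k / j.+1%:R) = g 1 - g 0.
    by rewrite /g !fctE /= expr1n expr0n /= scaler0 subr0 -[_ *: _]/(_ * _) mulr1 mulrA.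
  have {2}-> : V = F (a + (1 : R)%:C * b) - F (a + (0 : R)%:C * b).
    by rewrite mul1r mul0r addr0.
  rewrite ipBr.
  apply: (@rder_le _ (fun t => ip V (F (a + t%:C * b))) _
     (fun t => ip V (b *: L (a + t%:C * b))) (fun t => nm V * k * t ^+ j)) => //.
  - by move=> t t01; apply: ip_line; exact: dF.
  - move=> t t01; rewrite /g.
    apply: is_derive_eq (is_deriveZ _ (is_deriveX j.+1 (is_derive_id t (1 : R)))) _.
    rewrite -![_ *: _]/(_ * _) /= mulr1; field; by rewrite gt_eqF.
  - move=> t t01; rewrite -mulrA; apply: le_trans (ler_norm _) _.
    apply: le_trans (ip_le _ _) _; rewrite ler_wpM2l ?nm_ge0 //; exact: bL.
have [V0|V0] := eqVneq (nm V) 0.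
  by rewrite V0 !mulr_ge0 ?exprn_ge0 ?ler0n ?invr_ge0.
have V1 : 0 < nm V by rewrite lt_def V0 nm_ge0.
rewrite -(ler_pM2l V1) -expr2; apply: le_trans (nm_sqr_le V) _.
by rewrite mulrCA ler_wpM2l // exprn_ge0.
Qed.

Lemma mean_value m n (F L : C -> 'M[C]_(m, n)) a b k :
  (forall t : R, 0 <= t <= 1 -> mder F (a + t%:C * b) (L (a + t%:C * b))) ->
  (forall t : R, 0 <= t <= 1 -> nm (L (a + t%:C * b)) <= k) ->
  nm (F (a + b) - F a) <= (m * n)%:R ^+ 2 * (k * cabs b).
Proof.
move=> dF bL.
have k0 : 0 <= k by apply: le_trans (nm_ge0 _) (bL 0 _); rewrite lexx ler01.
rewrite -[k * _]divr1; apply: (ray_bound (j := 0)) dF _; first by rewrite mulr_ge0 ?cabs_ge0.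
by move=> t t01; rewrite expr0 mulr1 nmZ mulrC ler_wpM2r ?cabs_ge0 // bL.
Qed.

Lemma const_on_segment m n (F : C -> 'M[C]_(m, n)) a b :
  (forall t : R, 0 <= t <= 1 -> mder F (a + t%:C * b) 0) -> F (a + b) = F a.
Proof.
move=> dF; apply/eqP; rewrite -subr_eq0; apply/eqP/nm_eq0.
have := @mean_value _ _ F (fun=> 0) a b 0 dF.
by rewrite mul0r mulr0; apply=> t _; rewrite nm0.
Qed.

(** The mean value bound is applied to F z - (z - a) L a, whose derivative L z - L a is itself
    bounded by the mean value bound for L; hence the fourth power of the dimension. *)
Lemma taylor2 m n (F L L2 : C -> 'M[C]_(m, n)) a b k :
  (forall t : R, 0 <= t <= 1 -> mder F (a + t%:C * b) (L (a + t%:C * b))) ->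
  (forall t : R, 0 <= t <= 1 -> mder L (a + t%:C * b) (L2 (a + t%:C * b))) ->
  (forall t : R, 0 <= t <= 1 -> nm (L2 (a + t%:C * b)) <= k) ->
  nm (F (a + b) - F a - b *: L a) <= (m * n)%:R ^+ 4 * (k * cabs b ^+ 2).
Proof.
move=> dF dL bL2.
have k0 : 0 <= k by apply: le_trans (nm_ge0 _) (bL2 0 _); rewrite lexx ler01.
pose G z := F z - (z - a) *: L a.
have dG t : 0 <= t <= 1 -> mder G (a + t%:C * b) (L (a + t%:C * b) - L a).
  move=> t01; apply: mderB; first exact: dF.
  apply: mder_eq (mderZl _ _) _; last exact: scale1r.
  by apply: cder_eq (cderD (cder_id _) (cder_const _ _)) _; rewrite addr0.
have := @mean_value _ _ G (fun z => L z - L a) a b ((m * n)%:R ^+ 2 * (k * cabs b)) dG.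
rewrite /G subrr scale0r subr0 [a + b - a]addrC addKr addrAC => H.
apply: le_trans (H _) _.
  move=> t t01.
  have tt s : 0 <= s <= 1 -> 0 <= s * t <= 1.
    by move=> s01; have := andP s01; have := andP t01 => -[t0 t1] [s0 s1];
      rewrite mulr_ge0 //= -[1]mulr1 ler_pM.
  have E s : a + s%:C * (t%:C * b) = a + (s * t)%:C * b by rewrite rmorphM /= mulrA.
  apply: le_trans (@mean_value _ _ L L2 a (t%:C * b) k _ _) _.
  - by move=> s s01; rewrite E; apply: dL; exact: tt.
  - by move=> s s01; rewrite E; apply: bL2; exact: tt.
  rewrite ler_wpM2l ?exprn_ge0 // ler_wpM2l // cabsM cabsR.
  have := andP t01 => -[t0 t1]; rewrite ger0_norm //.
  by rewrite ler_piMl ?cabs_ge0.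
rewrite le_eqVlt; apply/orP; left; apply/eqP; ring.
Qed.

Lemma mder_of_quadratic m n (F : C -> 'M[C]_(m, n)) z L (k d : R) : 0 < d ->
  (forall h, cabs h < d -> nm (F (z + h) - F z - h *: L) <= k * cabs h ^+ 2) ->
  mder F z L.
Proof.
move=> d0 H e e0; have k0 : 0 < 1 + `|k| by rewrite ltr_wpDr.
exists (Num.min d (e / (1 + `|k|))); first by rewrite lt_min d0 divr_gt0.
move=> h; rewrite lt_min => /andP[hd he]; apply: le_trans (H _ hd) _.
rewrite expr2 mulrA ler_wpM2r ?cabs_ge0 //.
move: he; rewrite ltr_pdivlMr // => /ltW; apply: le_trans.
by rewrite mulrC ler_wpM2l ?cabs_ge0 // (le_trans (ler_norm _)) // lerDr.
Qed.

End MeanValue.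

(** * Completeness with an explicit rate *)

Section Completeness.
Variable R : realType.
Local Notation C := R[i].

(** The limit is the supremum of the numbers u n - e n, each of which lies below every u m + e m.
    The modulus e is kept unchanged, so that rates are available to [picard]. *)
Lemma real_complete (u e : nat -> R) :
  (forall n m, (n <= m)%N -> `|u m - u n| <= e n) ->
  exists l, forall n, `|l - u n| <= e n.
Proof.
move=> H; pose S : set R := range (fun n => u n - e n).
have ub n : ubound S (u n + e n).
  move=> _ [m _ <-]; have [nm|/ltnW mn] := leqP n m.
    have := H n m nm; have := le_trans (normr_ge0 _) (H m m (leqnn m)).
    by rewrite ler_norml => em /andP[_]; lra.
  have := H m n mn; have := le_trans (normr_ge0 _) (H n n (leqnn n)).
  by rewrite ler_norml => en /andP[]; lra.
have hS : has_sup S by split; [exists (u 0%N - e 0%N), 0%N | exists (u 0%N + e 0%N)].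
exists (sup S) => n; rewrite ler_norml; apply/andP; split.
  have : u n - e n <= sup S by apply: sup_upper_bound => //; exists n.
  lra.
have : sup S <= u n + e n by apply: ge_sup; [case: hS | exact: ub].
lra.
Qed.

Lemma mx_complete m n (u : nat -> 'M[C]_(m, n)) (e : nat -> R) :
  (forall j k, (j <= k)%N -> nm (u k - u j) <= e j) ->
  exists l, forall j, nm (l - u j) <= (m * n)%:R * (2 * e j).
Proof.
move=> H.
have [lr Hr] : exists lr : 'I_m -> 'I_n -> R, forall i j k,
    `|lr i j - complex.Re (u k i j)| <= e k.
  have P i j : exists l, forall k, `|l - complex.Re (u k i j)| <= e k.
    apply: real_complete => a b ab; rewrite -ReN -ReD.
    apply: le_trans (Re_le_cabs _) (le_trans _ (H _ _ ab)).
    by have := nm_entry (u b - u a) i j; rewrite !mxE.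
  exists (fun i j => projT1 (cid (P i j))) => i j; exact: (projT2 (cid (P i j))).
have [li Hi] : exists lr : 'I_m -> 'I_n -> R, forall i j k,
    `|lr i j - complex.Im (u k i j)| <= e k.
  have P i j : exists l, forall k, `|l - complex.Im (u k i j)| <= e k.
    apply: real_complete => a b ab; rewrite -ImN -ImD.
    apply: le_trans (Im_le_cabs _) (le_trans _ (H _ _ ab)).
    by have := nm_entry (u b - u a) i j; rewrite !mxE.
  exists (fun i j => projT1 (cid (P i j))) => i j; exact: (projT2 (cid (P i j))).
exists (\matrix_(i, j) (lr i j +i* li i j)) => k.
apply: nm_le_entries => i j; rewrite !mxE; apply: le_trans (cabs_le_ReIm _) _.
rewrite ReD ImD ReN ImN /= mulr_natl mulr2n; apply: lerD; [exact: Hr|exact: Hi].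
Qed.

End Completeness.

(** * The complex exponential and Picard iteration *)

Section ComplexExponential.
Variable R : realType.
Local Notation C := R[i].
Local Notation Re := (@complex.Re R).
Local Notation Im := (@complex.Im R).

Lemma is_derive_rder (f : R -> R) (t l : R) : is_derive t 1 f l -> rder f t l.
Proof.
move=> df e e0.
have H : (fun h : R => h^-1 *: (f (h *: 1 + t) - f t)) @ 0^' --> l.
  by rewrite -[l]derive_val; exact: (@ex_derive _ _ _ _ _ _ _ df).
move/cvgrPdist_le : H => /(_ e e0); rewrite near_withinE.
move=> /nbhs_ballP[d /= d0 Hd]; exists d => // h hd.
have [->|h0] := eqVneq h 0.
  by rewrite addr0 subrr mul0r subr0 normr0 mulr0.
have := Hd h; rewrite /ball /= sub0r normrN => /(_ hd h0).
rewrite distrC -(ler_pM2r (_ : 0 < `|h|)) ?normr_gt0 // -normrM.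
suff -> : (h^-1 *: (f (h *: 1 + t) - f t) - l) * h = f (t + h) - f t - h * l by [].
rewrite -[h *: 1]/(h * 1) mulr1 [h + t]addrC -[_ *: _]/(_ * _).
by field.
Qed.

Lemma cexpD (z w : C) : cexp (z + w) = cexp z * cexp w.
Proof.
rewrite /cexp ReD ImD expRD cosD sinD; apply/eqP; rewrite eq_complex /=.
by apply/andP; split; apply/eqP; ring.
Qed.

Lemma cexp0 : cexp (0 : C) = 1.
Proof. by rewrite /cexp /= expR0 cos0 sin0 mul1r. Qed.

Lemma cexpN (z : C) : cexp (- z) * cexp z = 1.
Proof. by rewrite -cexpD addNr cexp0. Qed.

Lemma cexpNr (z : C) : cexp z * cexp (- z) = 1.
Proof. by rewrite -cexpD addrN cexp0. Qed.

Lemma cexp_neq0 (z : C) : cexp z != 0.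
Proof.
by apply/eqP => z0; have := cexpN z; rewrite z0 mulr0 => /eqP; rewrite eq_sym oner_eq0.
Qed.

Lemma cexpV (z : C) : (cexp z)^-1 = cexp (- z).
Proof. by apply: (mulfI (cexp_neq0 z)); rewrite cexpNr mulfV ?cexp_neq0. Qed.

Lemma cabs_cexp (z : C) : cabs (cexp z) = expR (Re z).
Proof.
rewrite /cexp cabsM cabsR ger0_norm ?expR_ge0 //.
by rewrite /cabs /= cos2Dsin2 sqrtr1 mulr1.
Qed.

Lemma cexpR (t : R) : cexp t%:C = (expR t)%:C.
Proof. by rewrite /cexp /= cos0 sin0 mulr1. Qed.

Lemma cexpX (z : C) n : cexp (n%:R * z) = cexp z ^+ n.
Proof.
elim: n => [|n IH]; first by rewrite mul0r cexp0.
by rewrite -natr1 mulrDl mul1r cexpD IH exprSr.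
Qed.

Lemma cder_cexp0 : cder (@cexp R) 0 1.
Proof.
move=> e e0.
have dE : rder (@expR R) 0 1.
  exact: (is_derive_rder (is_derive_eq (is_derive_expR 0) (@expR0 R))).
have dc : rder (@cos R) 0 0.
  apply: (is_derive_rder (is_derive_eq (is_derive_cos 0) _)).
  by rewrite sin0 oppr0.
have ds : rder (@sin R) 0 1.
  exact: (is_derive_rder (is_derive_eq (is_derive_sin 0) (@cos0 R))).
(* Nine is 1 + 3 + 3 + 2, the sum of the coefficients of e1 * |h| in the four error terms below. *)
pose e1 : R := Num.min 1 (e / 9).
have e10 : 0 < e1 by rewrite lt_min ltr01 divr_gt0.
have e1e : e1 <= e / 9 by rewrite ge_min lexx orbT.
have e11 : e1 <= 1 by rewrite ge_min lexx.
clearbody e1.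
have [d1 d10 H1] := dE _ e10; have [d2 d20 H2] := dc _ e10.
have [d3 d30 H3] := ds _ e10.
exists (Num.min (Num.min 1 e1) (Num.min d1 (Num.min d2 d3))).
  by rewrite !lt_min d10 d20 d30 ltr01 e10.
move=> h; rewrite !lt_min => /andP[/andP[h1 he] /andP[hd1 /andP[hd2 hd3]]].
have ha := Re_le_cabs h; have hb := Im_le_cabs h.
have := H1 _ (le_lt_trans ha hd1); have := H2 _ (le_lt_trans hb hd2).
have := H3 _ (le_lt_trans hb hd3).
rewrite !add0r expR0 cos0 sin0 subr0 mulr0 subr0 !mulr1.
rewrite cexp0; move: ha hb; set a := Re h; set b := Im h; set c := cabs h in h1 he *.
move=> ha hb E3 E2 E1; have c0 : 0 <= c := cabs_ge0 h.
have H4 : e1 * `|a| <= e1 * c by rewrite ler_wpM2l ?(ltW e10).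
have H5 : e1 * `|b| <= e1 * c by rewrite ler_wpM2l ?(ltW e10).
have cc : c * c <= e1 * c by rewrite ler_wpM2r ?(ltW he).
have ec : e1 * c <= c by rewrite ler_piMl.
have E1' : `|expR a - 1| <= 2 * c.
  rewrite -[X in `|X|](subrK a); apply: le_trans (ler_normD _ _) _; lra.
have Ea : `|expR a| <= 3.
  rewrite -[X in `|X|](subrK 1); apply: le_trans (ler_normD _ _) _; rewrite normr1; lra.
apply: le_trans (cabs_le_ReIm _) _.
have -> : Re (cexp h - 1 - h) = (expR a - 1 - a) + expR a * (cos b - 1).
  by rewrite /cexp !ReD !ReN /= -/a -/b; ring.
have -> : Im (cexp h - 1 - h) = expR a * (sin b - b) + (expR a - 1) * b.
  by rewrite /cexp !ImD !ImN /= -/a -/b; ring.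
apply: le_trans (lerD (ler_normD _ _) (ler_normD _ _)) _; rewrite !normrM.
have T1 : `|expR a| * `|cos b - 1| <= 3 * (e1 * c).
  by apply: ler_pM => //; exact: le_trans E2 H5.
have T2 : `|expR a| * `|sin b - b| <= 3 * (e1 * c).
  by apply: ler_pM => //; exact: le_trans E3 H5.
have T3 : `|expR a - 1| * `|b| <= 2 * (e1 * c).
  apply: (@le_trans _ _ (2 * c * c)); first by apply: ler_pM.
  by rewrite -mulrA ler_wpM2l.
have : e1 * c <= e / 9 * c by rewrite ler_wpM2r.
lra.
Qed.

Lemma cder_cexp (z : C) : cder (@cexp R) z (cexp z).
Proof.
have H : cder (fun w => cexp z * cexp w) 0 (cexp z * 1) by exact/cderZ/cder_cexp0.
rewrite mulr1 in H => e e0; have [d d0 Hd] := H e e0; exists d => // h hd.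
by have := Hd h hd; rewrite add0r cexp0 mulr1 -cexpD.
Qed.

Lemma cder_cexpZ (k z : C) : cder (fun w => cexp (k * w)) z (k * cexp (k * z)).
Proof.
apply: (cder_comp (g := fun w => k * w)); last exact: cder_cexp.
by apply: cder_eq (cderZ k (cder_id z)) _; rewrite mulr1.
Qed.

End ComplexExponential.

(** * Exponential polynomials and their primitives *)

Section ExponentialPolynomials.
Variable R : realType.
Local Notation C := R[i].
Variables m n : nat.

(** Spanned by the functions w^j exp(k w) V. The class is stable under multiplication by exponential
    sums and has explicit primitives, so Picard iterates exist without complex integration. *)
Inductive exp_poly : (C -> 'M[C]_(m, n)) -> Prop :=
| exp_poly0 : exp_poly (fun=> 0)
| exp_polyS j k V F : exp_poly F ->
    exp_poly (fun w => (w ^+ j * cexp (k * w)) *: V + F w).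

Lemma exp_poly_ext F G : exp_poly F -> (forall w, G w = F w) -> exp_poly G.
Proof. by move=> eF GF; have -> : G = F by exact/funext. Qed.

Lemma exp_polyD F G : exp_poly F -> exp_poly G -> exp_poly (fun w => F w + G w).
Proof.
move=> eF eG; elim: eF => [|j k V F' _ IH].
  by apply: exp_poly_ext eG _ => w; rewrite add0r.
by apply: exp_poly_ext (exp_polyS j k V IH) _ => w; rewrite addrA.
Qed.

Lemma exp_poly1 j k V : exp_poly (fun w => (w ^+ j * cexp (k * w)) *: V).
Proof. by apply: exp_poly_ext (exp_polyS j k V exp_poly0) _ => w; rewrite addr0. Qed.

Lemma exp_poly_const V : exp_poly (fun=> V).
Proof.
apply: exp_poly_ext (exp_poly1 0 0 V) _ => w.
by rewrite mul0r cexp0 expr0 mulr1 scale1r.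
Qed.

Lemma exp_poly_mul k (A : 'M[C]_m) F :
  exp_poly F -> exp_poly (fun w => (cexp (k * w) *: A) *m F w).
Proof.
elim=> [|j k' V F' _ IH].
  by apply: exp_poly_ext exp_poly0 _ => w; rewrite mulmx0.
apply: exp_poly_ext (exp_polyS j (k + k') (A *m V) IH) _ => w.
rewrite mulmxDr; congr (_ + _).
rewrite -scalemxAl -scalemxAr !scalerA; congr (_ *: _).
by rewrite mulrDl cexpD; ring.
Qed.

Lemma exp_poly_prim1 j k V :
  exists2 G, exp_poly G & forall w, mder G w ((w ^+ j * cexp (k * w)) *: V).
Proof.
have [->|k0] := eqVneq k 0.
  exists (fun w => (w ^+ j.+1 * cexp (0 * w)) *: (j.+1%:R^-1 *: V)).
    exact: exp_poly1.
  move=> w; rewrite mul0r cexp0 mulr1.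
  have -> : (fun w => (w ^+ j.+1 * cexp (0 * w)) *: (j.+1%:R^-1 *: V)) =
            (fun w => w ^+ j.+1 *: (j.+1%:R^-1 *: V)).
    by apply/funext => x; rewrite mul0r cexp0 mulr1.
  apply: mder_eq (mderZl _ (cderX w j.+1)) _.
  by rewrite scalerA mulrAC mulfV ?mul1r // pnatr_eq0.
elim: j V => [|j IH] V.
  exists (fun w => (w ^+ 0 * cexp (k * w)) *: (k^-1 *: V)); first exact: exp_poly1.
  move=> w; apply: mder_ext (_ : forall x, _ = cexp (k * x) *: (k^-1 *: V)) _.
    by move=> x; rewrite expr0 mul1r.
  apply: mder_eq (mderZl _ (cder_cexpZ k w)) _.
  by rewrite scalerA expr0 mul1r mulrAC mulfV ?mul1r.
(* Integration by parts: the derivative of w^(j+1) exp(k w) / k exceeds the wanted function by (j+1)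
   w^j exp(k w) / k, which G removes. *)
have [G eG dG] := IH (- (j.+1%:R * k^-1) *: V).
exists (fun w => (w ^+ j.+1 * cexp (k * w)) *: (k^-1 *: V) + G w).
  exact: exp_polyS.
move=> w; apply: mder_eq (mderD (mderZl _ (cderM (cderX w j.+1) (cder_cexpZ k w))) (dG w)) _.
rewrite !scalerA -scalerDl; congr (_ *: _).
by rewrite /=; field.
Qed.

Lemma exp_poly_prim F : exp_poly F ->
  exists G, [/\ exp_poly G, (forall w, mder G w (F w)) & G 0 = 0].
Proof.
move=> eF; suff [G eG dG] : exists2 G, exp_poly G & forall w, mder G w (F w).
  exists (fun w => G w + - G 0); split; last by rewrite subrr.
    by apply: exp_polyD => //; exact: exp_poly_const.
  by move=> w; apply: mder_eq (mderD (dG w) (mder_const _ _)) _; rewrite addr0.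
elim: eF => [|j k V F' _ [G eG dG]].
  by exists (fun=> 0) => [|w]; [exact: exp_poly0|exact: mder_const].
have [H eH dH] := exp_poly_prim1 j k V.
by exists (fun w => H w + G w); [exact: exp_polyD|move=> w; exact: mderD].
Qed.

End ExponentialPolynomials.

(** * Convergence of the Picard series *)

Section Picard.
Variable R : realType.
Local Notation C := R[i].
Variables m n : nat.
Variables (A A' : C -> 'M[C]_m) (bnd : R -> R).
Hypothesis dA : forall w, mder A w (A' w).
Hypothesis bndA : forall rho w, cabs w <= rho -> nm (A w) <= bnd rho.
Hypothesis bndA' : forall rho, exists K, forall w, cabs w <= rho -> nm (A' w) <= K.
Variables (V : 'M[C]_(m, n)) (T : nat -> C -> 'M[C]_(m, n)).
Hypothesis T0 : forall w, T 0 w = V.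
Hypothesis TS0 : forall k, T k.+1 0 = 0.
Hypothesis dT : forall k w, mder (T k.+1) w (A w *m T k w).

Let c rho : R := (m * n)%:R ^+ 2 * bnd rho.
Let S k w := \sum_(j < k) T j w.
Let E (x : R) (k : nat) := \sum_(j < k) x ^+ j / (j`!)%:R.

Lemma exp_partial_le (x : R) k : 0 <= x -> E x k <= expR x.
Proof.
move=> x0; rewrite /E -(big_mkord xpredT (fun j => x ^+ j / (j`!)%:R)).
have -> : \sum_(0 <= j < k) x ^+ j / (j`!)%:R = series (exp_coeff x) k by [].
apply: nondecreasing_cvgn_le; last exact: is_cvg_series_exp_coeff.
by apply: nondecreasing_series => i _ _; exact: exp_coeff_ge0.
Qed.

Lemma exp_partial_cvg (x : R) eps : 0 <= x -> 0 < eps ->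
  exists k0, forall k, (k0 <= k)%N -> expR x - E x k <= eps.
Proof.
move=> x0 e0.
have : series (exp_coeff x) @ \oo --> expR x by exact: is_cvg_series_exp_coeff.
move/cvgrPdist_le => /(_ eps e0) [k0 _ H]; exists k0 => k kk.
by apply: le_trans (ler_norm _) _; have := H k kk; rewrite /E /series /= big_mkord.
Qed.

Lemma bnd_ge0 rho : 0 <= rho -> 0 <= bnd rho.
Proof. by move=> r0; apply: le_trans (nm_ge0 (A 0)) (bndA _); rewrite cabs0. Qed.

(** Induction through [ray_bound] with exponent k: the primitive of t^k contributes the factor 1 /
    (k+1) that turns k! into (k+1)!. The dimension factor of that bound is absorbed in [c rho]. *)
Lemma picard_term rho k w : cabs w <= rho ->
  nm (T k w) <= nm V * ((c rho * cabs w) ^+ k / (k`!)%:R).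
Proof.
elim: k w => [|k IH] w wr.
  by rewrite T0 expr0 fact0 divr1 mulr1.
have r0 : 0 <= rho := le_trans (cabs_ge0 w) wr.
have b0 := bnd_ge0 r0; have w0 := cabs_ge0 w.
have c0 : 0 <= c rho by rewrite mulr_ge0 ?exprn_ge0.
pose k0 : R := cabs w * (bnd rho * (nm V * ((c rho * cabs w) ^+ k / (k`!)%:R))).
have := @ray_bound _ _ _ (T k.+1) (fun w => A w *m T k w) 0 w k0 k.
rewrite add0r TS0 subr0 => H; apply: le_trans (H _ _ _) _.
- by rewrite !mulr_ge0 ?nm_ge0 ?exprn_ge0 ?mulr_ge0 ?invr_ge0 ?ler0n.
- by move=> t _; exact: dT.
- move=> t /andP[t0 t1]; rewrite add0r nmZ.
  have tw : cabs (t%:C * w) <= rho.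
    by rewrite cabsM cabsR ger0_norm // (le_trans _ wr) // ler_piMl.
  apply: le_trans (ler_wpM2l w0 (nmM _ _)) _.
  rewrite /k0 -[X in _ <= X]mulrA ler_wpM2l // -[X in _ <= X]mulrA.
  apply: ler_pM; rewrite ?nm_ge0 ?bndA //.
  apply: le_trans (IH _ tw) _.
  rewrite cabsM cabsR ger0_norm // -[X in _ <= X]mulrA ler_wpM2l ?nm_ge0 //.
  have -> : c rho * (t * cabs w) = t * (c rho * cabs w) by ring.
  by rewrite exprMn -mulrA mulrC.
have f0 : (k`!%:R : R) != 0 by rewrite pnatr_eq0 -lt0n fact_gt0.
have k10 : (k.+1%:R : R) != 0 by rewrite pnatr_eq0.
rewrite /k0 factS (natrM _ k.+1) (exprS (c rho * cabs w)); move: (_ ^+ k) => q; rewrite /c.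
move: k`!%:R k.+1%:R (m * n)%:R f0 k10 => f k1 mn f0 k10.
by rewrite le_eqVlt; apply/orP; left; apply/eqP; field; apply/andP.
Qed.

Lemma picard_sub rho j k w : cabs w <= rho -> (j <= k)%N ->
  nm (S k w - S j w) <= nm V * (expR (c rho * cabs w) - E (c rho * cabs w) j).
Proof.
move=> wr jk; have r0 : 0 <= rho := le_trans (cabs_ge0 w) wr.
have x0 : 0 <= c rho * cabs w.
  by rewrite mulr_ge0 ?cabs_ge0 ?mulr_ge0 ?exprn_ge0 ?bnd_ge0.
apply: (@le_trans _ _ (nm V * (E (c rho * cabs w) k - E (c rho * cabs w) j))); last first.
  by rewrite ler_wpM2l ?nm_ge0 // lerD2r exp_partial_le.
rewrite /S /E -(subnKC jk) !big_split_ord /= ![_ + _ - _]addrAC !subrr !add0r.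
apply: le_trans (nm_sum _ _ _) _; rewrite mulr_sumr; apply: ler_sum => i _.
exact: picard_term.
Qed.

Lemma picard_partial_bound rho k w : cabs w <= rho ->
  nm (S k w) <= nm V * expR (c rho * rho).
Proof.
move=> wr; have r0 : 0 <= rho := le_trans (cabs_ge0 w) wr.
have c0 : 0 <= c rho by rewrite mulr_ge0 ?exprn_ge0 ?bnd_ge0.
have := picard_sub wr (leq0n k); rewrite /S /E !big_ord0 !subr0 => H.
by apply: le_trans H _; rewrite ler_wpM2l ?nm_ge0 // ler_expR ler_wpM2l.
Qed.

Lemma picard_partial_der k w : mder (S k.+1) w (A w *m S k w).
Proof.
have -> : S k.+1 = fun w => V + \sum_(j < k) T j.+1 w.
  by apply/funext => x; rewrite /S big_ord_recl T0.
apply: mder_eq (mderD (mder_const V w) (mder_sum _ (fun j : 'I_k => dT j w))) _.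
by rewrite add0r -mulmx_sumr.
Qed.

Lemma picard : exists Y : C -> 'M[C]_(m, n),
  [/\ forall w, mder Y w (A w *m Y w), Y 0 = V,
     forall rho w, cabs w <= rho ->
       nm (Y w) <= nm V * expR (c rho * rho) &
     forall w eps, 0 < eps -> exists k0, forall k, (k0 <= k)%N ->
       nm (Y w - S k w) <= eps].
Proof.
have L w : exists l, forall j, nm (l - S j w) <=
   (m * n)%:R * (2 * (nm V * (expR (c (cabs w) * cabs w) - E (c (cabs w) * cabs w) j))).
  by apply: mx_complete => j k jk; exact: picard_sub.
pose Y w := projT1 (cid (L w)).
have HY w : forall j, nm (Y w - S j w) <=
   (m * n)%:R * (2 * (nm V * (expR (c (cabs w) * cabs w) - E (c (cabs w) * cabs w) j))).
  exact: (projT2 (cid (L w))).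
have cvg w eps : 0 < eps -> exists k0, forall k, (k0 <= k)%N -> nm (Y w - S k w) <= eps.
  move=> e0; set x := c (cabs w) * cabs w.
  have x0 : 0 <= x by rewrite /x !mulr_ge0 ?exprn_ge0 ?bnd_ge0 ?cabs_ge0.
  pose K : R := 1 + (m * n)%:R * (2 * nm V).
  have K0 : 0 < K by rewrite ltr_wpDr ?mulr_ge0 ?nm_ge0.
  have [k0 Hk] := exp_partial_cvg x0 (divr_gt0 e0 K0); exists k0 => k /Hk.
  rewrite ler_pdivlMr // => Hx; apply: le_trans (HY w k) (le_trans _ Hx).
  have d0 : 0 <= expR x - E x k by rewrite subr_ge0 exp_partial_le.
  rewrite -/x /K; have -> : (m * n)%:R * (2 * (nm V * (expR x - E x k))) =
     (expR x - E x k) * ((m * n)%:R * (2 * nm V)) by ring.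
  by rewrite ler_wpM2l // lerDr ler01.
exists Y; split => //.
- move=> w; pose rho := cabs w + 1.
  have [K' HK'] := bndA' rho.
  pose B := nm V * expR (c rho * rho).
  (* K bounds the second derivative A' S + A (A S) of all partial sums on the disc of radius |w| +
     1. *)
  pose K : R := K' * B + bnd rho * (bnd rho * B).
  apply: (@mder_of_quadratic _ _ _ _ _ _ ((m * n)%:R ^+ 4 * K) 1) => // h h1.
  (* The second order Taylor estimate is uniform in the number of terms, so it survives the limit
     and gives the derivative of the sum directly. *)
  have P k : nm (S k.+2 (w + h) - S k.+2 w - h *: (A w *m S k.+1 w)) <=
       (m * n)%:R ^+ 4 * (K * cabs h ^+ 2).
    apply: (@taylor2 _ _ _ _ (fun w => A w *m S k.+1 w)
       (fun w => A' w *m S k.+1 w + A w *m (A w *m S k w))).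
    + by move=> t _; exact: picard_partial_der.
    + by move=> t _; apply: mderM => //; exact: picard_partial_der.
    + move=> t /andP[t0 t1].
      have r : cabs (w + t%:C * h) <= rho.
        apply: le_trans (cabsD _ _) _; rewrite lerD2l cabsM cabsR ger0_norm //.
        by rewrite -[1]mulr1 ler_pM ?cabs_ge0 // ltW.
      have b0 : 0 <= bnd rho := le_trans (nm_ge0 _) (bndA r).
      apply: le_trans (nmD _ _) _; apply: lerD.
        apply: le_trans (nmM _ _) _.
        by apply: ler_pM; rewrite ?nm_ge0 ?HK' //; exact: picard_partial_bound.
      apply: le_trans (nmM _ _) _; apply: ler_pM; rewrite ?nm_ge0 ?bndA //.
      apply: le_trans (nmM _ _) _; apply: ler_pM; rewrite ?nm_ge0 ?bndA //.
      exact: picard_partial_bound.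
  rewrite -mulrA; apply/ler_addgt0Pr => e e0.
  pose M := 1 + 1 + cabs h * nm (A w).
  have M0 : 0 < M by rewrite /M ltr_wpDr ?mulr_ge0 ?cabs_ge0 ?nm_ge0.
  have [k1 H1] := cvg (w + h) _ (divr_gt0 e0 M0).
  have [k2 H2] := cvg w _ (divr_gt0 e0 M0).
  pose k := maxn k1 k2.
  have kk1 : (k1 <= k.+2)%N by rewrite (leq_trans (leq_maxl k1 k2)) // -addn2 leq_addr.
  have kk2 : (k2 <= k.+1)%N by rewrite (leq_trans (leq_maxr k1 k2)).
  have kk3 : (k2 <= k.+2)%N by rewrite (leq_trans kk2).
  have -> : Y (w + h) - Y w - h *: (A w *m Y w) =
     (S k.+2 (w + h) - S k.+2 w - h *: (A w *m S k.+1 w)) +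
     ((Y (w + h) - S k.+2 (w + h)) - (Y w - S k.+2 w) - h *: (A w *m (Y w - S k.+1 w))).
    by rewrite mulmxBr; move: (A w *m _) (A w *m _) => ? ?; mxring.
  apply: le_trans (nmD _ _) _; apply: lerD; first exact: P.
  apply: le_trans (nmB _ _) _; apply: le_trans (lerD (nmB _ _) (lexx _)) _.
  rewrite nmZ; have := H1 _ kk1; have := H2 _ kk3 => I3 I1.
  have I2 : cabs h * nm (A w *m (Y w - S k.+1 w)) <= cabs h * nm (A w) * (e / M).
    rewrite -mulrA ler_wpM2l ?cabs_ge0 //; apply: le_trans (nmM _ _) _.
    by rewrite ler_wpM2l ?nm_ge0 // H2.
  have -> : e = e / M + e / M + cabs h * nm (A w) * (e / M).
    by rewrite /M; field; rewrite -/M gt_eqF.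
  by rewrite !lerD.
- apply/eqP; rewrite -subr_eq0; apply/eqP/nm_eq0.
  have := HY 0 1%N; rewrite cabs0 mulr0 expR0 /S /E !big_ord_recl !big_ord0 T0.
  by rewrite expr0 fact0 divr1 !addr0 subrr !mulr0.
- move=> rho w wr; have r0 : 0 <= rho := le_trans (cabs_ge0 w) wr.
  apply/ler_addgt0Pr => e e0; have [k Hk] := cvg w e e0.
  rewrite -[Y w](subrK (S k w)) addrC; apply: le_trans (nmD _ _) _.
  by apply: lerD; [exact: picard_partial_bound|exact: Hk].
Qed.

End Picard.

(** * Linear differential equations with exponential-sum coefficients *)

Section Bridge.
Variable R : realType.
Local Notation C := R[i].
Local Notation Re := (@complex.Re R).

Lemma gt0_complex (e : C) : 0 < e -> 0 < Re e /\ e = (Re e)%:C.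
Proof.
case: e => a b; rewrite ltcE /= => /andP[/eqP-> a0]; split => //.
Qed.

Lemma norm_le_nm m n (A : 'M[C]_(m, n)) : `|A| <= (nm A)%:C.
Proof.
rewrite /Num.norm /= mx_normE.
have n0 : 0 <= (nm A)%:C by rewrite ler0c nm_ge0.
have : (\big[Num.max/0%:nng]_i `|A i.1 i.2|%:nng <= NngNum n0)%R.
  apply/bigmax_leP; split=> [|[i j] _]; first by rewrite -num_le /=.
  by rewrite -num_le /= normC_cabs lecR nm_entry.
by rewrite -num_le.
Qed.

Lemma nm_le_norm m n (A : 'M[C]_(m, n)) : (nm A)%:C <= (m * n)%:R * `|A|.
Proof.
have H i j : `|A i j| <= `|A|.
  rewrite [X in _ <= X]/Num.norm /= mx_normE.
  rewrite -[leLHS]nngE num_le.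
  exact: (le_bigmax _ (fun ij => `|A ij.1 ij.2|%:nng) (i, j)).
have [k k0 Ek] : exists2 k : R, 0 <= k & `|A| = k%:C.
  have : 0 <= `|A| by []; case: (`|A|) => a b.
  by rewrite lecE /= => /andP[/eqP-> a0]; exists a.
rewrite Ek -(rmorph_nat (real_complex R)) -rmorphM lecR.
by apply: nm_le_entries => i j; rewrite -lecR -normC_cabs -Ek.
Qed.

Lemma cvg_nm m n (u : nat -> 'M[C]_(m, n)) (l : 'M[C]_(m, n)) :
  (forall eps : R, 0 < eps -> exists k0, forall k, (k0 <= k)%N -> nm (l - u k) <= eps) ->
  (u : nat -> ('M[C]_(m, n) : normedModType C)) @ \oo --> (l : ('M[C]_(m, n) : normedModType C)).
Proof.
move=> H; apply/cvgrPdist_le => e /gt0_complex[e0 ->].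
have [k0 Hk] := H _ e0; exists k0 => // k kk.
by apply: le_trans (norm_le_nm _) _; rewrite lecR; exact: Hk.
Qed.

Lemma mder_is_derive m n (F : C -> 'M[C]_(m, n)) (z : C) (L : 'M[C]_(m, n)) : mder F z L ->
  is_derive (z : C^o) (1 : C^o) (F : C^o -> ('M[C]_(m, n) : normedModType C)) L.
Proof.
move=> dF.
have H : (fun h : C^o => h^-1 *: (F (h *: 1 + z) - F z : ('M[C]_(m, n) : normedModType C))) @ (0 : C^o)^' --> (L : ('M[C]_(m, n) : normedModType C)).
  apply/cvgrPdist_le => e /gt0_complex[e0 ->]; have [d d0 Hd] := dF _ e0.
  rewrite near_withinE; apply/nbhs_ballP; exists d%:C => /=; first by rewrite ltcR.
  move=> h; rewrite /ball /= sub0r normrN normC_cabs ltcR => hd h0.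
  apply: le_trans (norm_le_nm _) _; rewrite lecR nm_distC.
  rewrite -[h *: 1]/(h * 1) mulr1 [h + z]addrC.
  have c0 : 0 < cabs h by rewrite cabs_gt0.
  rewrite -(ler_pM2l c0) -nmZ scalerBr scalerA mulfV // scale1r mulrC; exact: Hd.
apply: DeriveDef; first by apply/cvg_ex; exists L.
by apply: cvg_lim; [exact: norm_hausdorff|exact: H].
Qed.

Lemma derivable_mder m n (F : C -> 'M[C]_(m, n)) (z : C) :
  derivable (F : C^o -> ('M[C]_(m, n) : normedModType C)) z 1 ->
  mder F z ('D_(1 : C^o) (F : C^o -> ('M[C]_(m, n) : normedModType C)) z).
Proof.
move=> dF; set L := derive _ _ _.
have H : (fun h : C^o => h^-1 *: (F (h *: 1 + z) - F z : ('M[C]_(m, n) : normedModType C))) @ (0 : C^o)^' --> (L : ('M[C]_(m, n) : normedModType C)).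
  exact: dF.
move=> e e0; pose k : R := (m * n)%:R + 1.
have k0 : 0 < k by rewrite ltr_wpDl.
move/cvgrPdist_le : H => /(_ (e / k)%:C); rewrite ltcR divr_gt0 // => /(_ isT).
rewrite near_withinE => /nbhs_ballP[d /= /gt0_complex[d0 ->] Hd].
exists (Re d) => // h hd.
have [->|h0] := eqVneq h 0.
  by rewrite addr0 subrr scale0r subr0 nm0 cabs0 mulr0.
have := Hd h; rewrite /ball /= sub0r normrN normC_cabs ltcR => /(_ hd h0).
rewrite -[h *: 1]/(h * 1) mulr1 [h + z]addrC => N.
have : nm (L - h^-1 *: (F (z + h) - F z)) <= e.
  rewrite -lecR; apply: le_trans (nm_le_norm _) _.
  apply: le_trans (ler_wpM2l _ N) _; first exact: ler0n.
  rewrite -(rmorph_nat (real_complex R)) -rmorphM lecR mulrA ler_pdivrMr //.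
  by rewrite mulrC ler_wpM2l ?(ltW e0) // lerDl.
have c0 : 0 < cabs h by rewrite cabs_gt0.
by rewrite nm_distC -(ler_pM2l c0) -nmZ scalerBr scalerA mulfV // scale1r [e * _]mulrC.
Qed.

End Bridge.

Section LinearODE.
Variable R : realType.
Local Notation C := R[i].

Definition expsum p m (kap : 'I_p -> C) (A : 'I_p -> 'M[C]_m) (w : C) : 'M[C]_m :=
  \sum_i cexp (kap i * w) *: A i.

Definition expsum_bnd p m (kap : 'I_p -> C) (A : 'I_p -> 'M[C]_m) (rho : R) : R :=
  \sum_i expR (cabs (kap i) * rho) * nm (A i).

Lemma cabs_cexp_le (k w : C) rho : cabs w <= rho -> cabs (cexp (k * w)) <= expR (cabs k * rho).
Proof.
move=> wr; rewrite cabs_cexp ler_expR; apply: le_trans (ler_norm _) _.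
by apply: le_trans (Re_le_cabs _) _; rewrite cabsM ler_wpM2l ?cabs_ge0.
Qed.

Lemma expsum_le p m kap (A : 'I_p -> 'M[C]_m) rho w : cabs w <= rho ->
  nm (expsum kap A w) <= expsum_bnd kap A rho.
Proof.
move=> wr; apply: le_trans (nm_sum _ _ _) _; apply: ler_sum => i _.
by rewrite nmZ ler_wpM2r ?nm_ge0 // cabs_cexp_le.
Qed.

Lemma mder_expsum p m kap (A : 'I_p -> 'M[C]_m) w :
  mder (expsum kap A) w (expsum kap (fun i => kap i *: A i) w).
Proof.
apply: mder_eq (mder_sum _ (fun i => mderZl (A i) (cder_cexpZ (kap i) w))) _.
by apply: eq_bigr => i _; rewrite scalerA mulrC.
Qed.

Lemma ode_exists p m n kap (A : 'I_p -> 'M[C]_m) (V : 'M[C]_(m, n)) :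
  exists Y : C -> 'M[C]_(m, n),
  [/\ forall w, mder Y w (expsum kap A w *m Y w), Y 0 = V &
     forall rho w, cabs w <= rho ->
       nm (Y w) <= nm V * expR ((m * n)%:R ^+ 2 * expsum_bnd kap A rho * rho)].
Proof.
(* A primitive operator is chosen on all functions, with an arbitrary value outside [exp_poly], so
   that the Picard terms can be defined by plain recursion before their membership in the class is
   proved. *)
have [prim Hprim] : exists prim : (C -> 'M[C]_(m, n)) -> C -> 'M[C]_(m, n),
    forall F, exp_poly F ->
    [/\ exp_poly (prim F), (forall w, mder (prim F) w (F w)) & prim F 0 = 0].
  have P (F : C -> 'M[C]_(m, n)) : exists G, exp_poly F ->
      [/\ exp_poly G, (forall w, mder G w (F w)) & G 0 = 0].
    have [/exp_poly_prim[G HG]|nF] := pselect (exp_poly F); first by exists G.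
    by exists F => /nF.
  by exists (fun F => projT1 (cid (P F))) => F; exact: (projT2 (cid (P F))).
pose T := fix T k := if k is k'.+1 then prim (fun w => expsum kap A w *m T k' w)
                     else (fun=> V).
have step (F : C -> 'M[C]_(m, n)) : exp_poly F -> exp_poly (fun w => expsum kap A w *m F w).
  move=> eF; suff H (r : seq 'I_p) : exp_poly (fun w =>
      (\sum_(i <- r) cexp (kap i * w) *: A i) *m F w) by exact: H.
  elim: r => [|i r IH].
    by apply: exp_poly_ext (exp_poly0 _ _ _) _ => w; rewrite big_nil mul0mx.
  apply: exp_poly_ext (exp_polyD (exp_poly_mul (kap i) (A i) eF) IH) _ => w.
  by rewrite big_cons mulmxDl.
have eT k : exp_poly (T k).
  elim: k => [|k IH]; first exact: exp_poly_const.
  by have [] := Hprim _ (step _ IH).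
have H1 rho : exists K, forall w, cabs w <= rho ->
    nm (expsum kap (fun i => kap i *: A i) w) <= K.
  by exists (expsum_bnd kap (fun i => kap i *: A i) rho) => w; exact: expsum_le.
have H2 k : T k.+1 0 = 0 by have [] := Hprim _ (step _ (eT k)).
have H3 k w : mder (T k.+1) w (expsum kap A w *m T k w).
  by have [] := Hprim _ (step _ (eT k)).
have [Y [dY Y0 Yb _]] := picard (mder_expsum kap A) (@expsum_le p m kap A)
   H1 (V := V) (T := T) (fun=> erefl) H2 H3.
by exists Y.
Qed.

(** Transposition turns Z' = - Z A into a left equation with coefficients - A^T. *)
Lemma ode_exists_right p m kap (A : 'I_p -> 'M[C]_m) :
  exists Z : C -> 'M[C]_m,
  [/\ forall w, mder Z w (- (Z w *m expsum kap A w)), Z 0 = 1%:M &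
     forall rho w, cabs w <= rho ->
       nm (Z w) <= m%:R * expR ((m * m)%:R ^+ 2 * expsum_bnd kap A rho * rho)].
Proof.
have [Y [dY Y0 Yb]] := ode_exists kap (fun i => - (A i)^T) (1%:M : 'M[C]_m).
exists (fun w => (Y w)^T); split; last 1 first.
- move=> rho w wr; rewrite nm_tr; apply: le_trans (Yb rho w wr) _.
  have -> : expsum_bnd kap (fun i => - (A i)^T) rho = expsum_bnd kap A rho.
    by apply: eq_bigr => i _; rewrite nmN nm_tr.
  by rewrite nm_scalar cabs1 mulr1.
- move=> w; apply: mder_eq (mder_tr (dY w)) _; rewrite trmx_mul -mulmxN.
  congr (_ *m _); rewrite /expsum raddf_sum -sumrN; apply: eq_bigr => i _ /=.
  by rewrite linearZ /= linearN /= trmxK scalerN.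
- by rewrite Y0 trmx1.
Qed.

Lemma fundamental_pair p m kap (A : 'I_p -> 'M[C]_m) :
  exists YZ : (C -> 'M[C]_m) * (C -> 'M[C]_m),
  [/\ forall w, mder YZ.1 w (expsum kap A w *m YZ.1 w),
      forall w, mder YZ.2 w (- (YZ.2 w *m expsum kap A w)),
      YZ.1 0 = 1%:M, YZ.2 0 = 1%:M &
     forall rho w, cabs w <= rho -> let b := m%:R *
       expR ((m * m)%:R ^+ 2 * expsum_bnd kap A rho * rho) in
       nm (YZ.1 w) <= b /\ nm (YZ.2 w) <= b].
Proof.
have [Y [dY Y0 Yb]] := ode_exists kap A (1%:M : 'M[C]_m).
have [Z [dZ Z0 Zb]] := ode_exists_right kap A.
exists (Y, Z); split; [exact: dY|exact: dZ|exact: Y0|exact: Z0|].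
move=> rho w wr b; split; last exact: Zb.
by have := Yb _ _ wr; rewrite nm_scalar cabs1 mulr1.
Qed.

Definition fund p m kap (A : 'I_p -> 'M[C]_m) := (projT1 (cid (fundamental_pair kap A))).1.
Definition fundV p m kap (A : 'I_p -> 'M[C]_m) := (projT1 (cid (fundamental_pair kap A))).2.

Section Fundamental.
Variables (p m : nat) (kap : 'I_p -> C) (A : 'I_p -> 'M[C]_m).

Lemma mder_fund w : mder (fund kap A) w (expsum kap A w *m fund kap A w).
Proof. by rewrite /fund; case: cid => /= YZ []. Qed.

Lemma mder_fundV w : mder (fundV kap A) w (- (fundV kap A w *m expsum kap A w)).
Proof. by rewrite /fundV; case: cid => /= YZ []. Qed.

Lemma fund0 : fund kap A 0 = 1%:M.
Proof. by rewrite /fund; case: cid => /= YZ []. Qed.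

Lemma fundV0 : fundV kap A 0 = 1%:M.
Proof. by rewrite /fundV; case: cid => /= YZ []. Qed.

Lemma nm_fund rho w : cabs w <= rho ->
  nm (fund kap A w) <= m%:R * expR ((m * m)%:R ^+ 2 * expsum_bnd kap A rho * rho).
Proof. by rewrite /fund; case: cid => /= YZ [_ _ _ _ H] wr; have [] := H rho w wr. Qed.

Lemma nm_fundV rho w : cabs w <= rho ->
  nm (fundV kap A w) <= m%:R * expR ((m * m)%:R ^+ 2 * expsum_bnd kap A rho * rho).
Proof. by rewrite /fundV; case: cid => /= YZ [_ _ _ _ H] wr; have [] := H rho w wr. Qed.

(** The product of the two propagators has derivative zero, so it keeps its value 1 at the
    origin. *)
Lemma fundVK w : fundV kap A w *m fund kap A w = 1%:M.
Proof.
pose F w := fundV kap A w *m fund kap A w.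
have := @const_on_segment _ _ _ F 0 w; rewrite add0r /F fundV0 fund0 mulmx1; apply=> t _.
apply: mder_eq (mderM (mder_fundV _) (mder_fund _)) _.
by rewrite mulNmx mulmxA addNr.
Qed.

Lemma fundKV w : fund kap A w *m fundV kap A w = 1%:M.
Proof. exact/mulmx1C/fundVK. Qed.

Lemma ode_unique n (F : C -> 'M[C]_(m, n)) w :
  (forall z, mder F z (expsum kap A z *m F z)) -> F w = fund kap A w *m F 0.
Proof.
move=> dF; pose G w := fundV kap A w *m F w.
have : G w = G 0.
  have := @const_on_segment _ _ _ G 0 w; rewrite add0r; apply=> t _.
  apply: mder_eq (mderM (mder_fundV _) (dF _)) _.
  by rewrite mulNmx mulmxA addNr.
by rewrite /G fundV0 mul1mx => <-; rewrite mulmxA fundKV mul1mx.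
Qed.

End Fundamental.

(** Variation of constants: with Z_A = [fundV kap A] and Y_B = [fund kap B], the derivative of Z_A
    Y_B is Z_A (B - A) Y_B, which is integrated along the segment from 0 to w. *)
Lemma fund_perturb p m kap (A B : 'I_p -> 'M[C]_m) w b eps :
  (forall t : R, 0 <= t <= 1 -> nm (fundV kap A (t%:C * w)) <= b /\
       nm (fund kap B (t%:C * w)) <= b) ->
  (forall t : R, 0 <= t <= 1 -> nm (expsum kap B (t%:C * w) - expsum kap A (t%:C * w)) <= eps) ->
  nm (fundV kap A w *m fund kap B w - 1%:M) <= (m * m)%:R ^+ 2 * (b * eps * b * cabs w).
Proof.
move=> Hb He; pose F w := fundV kap A w *m fund kap B w.
have := @mean_value _ _ _ F (fun w => fundV kap A w *m
   (expsum kap B w - expsum kap A w) *m fund kap B w) 0 w (b * eps * b).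
rewrite add0r /F fundV0 fund0 mulmx1; apply=> t t01; rewrite add0r.
  apply: mder_eq (mderM (mder_fundV _ _ _) (mder_fund _ _ _)) _.
  rewrite mulNmx mulmxBr mulmxBl !mulmxA; apply: addrC.
have [b1 b2] := Hb t t01.
apply: le_trans (nmM _ _) _; apply: ler_pM; rewrite ?nm_ge0 //.
by apply: le_trans (nmM _ _) _; apply: ler_pM; rewrite ?nm_ge0 // He.
Qed.

End LinearODE.

(** * The matrix exponential as a propagator *)

Section MatrixExponential.
Variable R : realType.
Local Notation C := R[i].
Variables (N : nat).
Implicit Types (H : 'M[C]_N).

Definition cst1 H : 'I_1 -> 'M[C]_N := fun=> H.

Lemma expsum_cst H w : expsum (fun=> 0) (cst1 H) w = H.
Proof. by rewrite /expsum big_ord1 mul0r cexp0 scale1r. Qed.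

Lemma mpowZ w H k : mpow (w *: H) k = w ^+ k *: mpow H k.
Proof.
elim: k => [|k IH]; first by rewrite expr0 scale1r.
by rewrite /mpow !iterS -!/(mpow _ _) IH -scalemxAl -scalemxAr scalerA exprS.
Qed.

(** The exponential series is the Picard series of the constant system Y' = H Y, an exponential sum
    with the single exponent 0. Uniqueness for the differential equation then replaces manipulations
    of the series. *)
Lemma mexp_fund H w : mexp (w *: H) = fund (fun=> 0) (cst1 H) w.
Proof.
pose T k (w : C) : 'M[C]_N := (k`!%:R^-1 * w ^+ k) *: mpow H k.
have dT k z : mder (T k.+1) z (expsum (fun=> 0) (cst1 H) z *m T k z).
  rewrite expsum_cst /T; apply: mder_eq (mderZl _ (cderZ _ (cderX z k.+1))) _.
  rewrite -scalemxAr -/(mpow H k.+1); congr (_ *: _); rewrite factS natrM /=.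
  have f0 : (k`!%:R : C) != 0 by rewrite pnatr_eq0 -lt0n fact_gt0.
  have k0 : (k.+1%:R : C) != 0 by rewrite pnatr_eq0.
  move: k`!%:R k.+1%:R (z ^+ k) f0 k0 => f j q f0 j0.
  by field; apply/andP.
have H0 z : T 0 z = 1%:M by rewrite /T fact0 invr1 expr0 mul1r; exact: scale1r.
have H1 (z : C) : mder (expsum (fun=> 0) (cst1 H)) z 0.
  by apply: mder_ext (mder_const H z) => x; exact: expsum_cst.
have H2 (rho : R) : exists K : R, forall z : C, cabs z <= rho -> nm (0 : 'M[C]_N) <= K.
  by exists 0 => z _; rewrite nm0.
have H3 k : T k.+1 0 = 0 by rewrite /T expr0n mulr0; exact: scale0r.
have [Y [dY Y0 _ cY]] := picard H1 (@expsum_le R 1 N (fun=> 0) (cst1 H)) H2 H0 H3 dT.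
rewrite -[RHS]mulmx1 -Y0 -(ode_unique w dY).
have L : (fun k : nat => (\sum_(j < k) (j`!%:R)^-1 *: mpow (w *: H) j :
    ('M[C]_N : normedModType C))) @ \oo --> (Y w : ('M[C]_N : normedModType C)); last first.
  by rewrite /mexp; have := cvg_lim (@norm_hausdorff _ _) L; apply.
apply: cvg_nm => eps e0; have [k0 Hk] := cY w eps e0; exists k0 => k /Hk.
suff -> : \sum_(j < k) T j w = \sum_(j < k) (j`!%:R)^-1 *: mpow (w *: H) j by [].
by apply: eq_bigr => j _; rewrite /T mpowZ scalerA.
Qed.

Lemma mexp0 H : mexp (0 *: H) = 1%:M.
Proof. by rewrite mexp_fund fund0. Qed.

Lemma mder_mexp H w : mder (fun w => mexp (w *: H)) w (H *m mexp (w *: H)).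
Proof.
apply: mder_ext (fun x => mexp_fund H x) _.
by have := mder_fund (fun=> 0) (cst1 H) w; rewrite expsum_cst mexp_fund.
Qed.

Lemma mexp_unique n H (F : C -> 'M[C]_(N, n)) w :
  (forall z, mder F z (H *m F z)) -> F w = mexp (w *: H) *m F 0.
Proof.
move=> dF; rewrite mexp_fund.
by apply: (@ode_unique R 1 N (fun=> 0) (cst1 H) n F) => z; rewrite expsum_cst; exact: dF.
Qed.

Lemma mexpD H (a b : C) : mexp ((a + b) *: H) = mexp (a *: H) *m mexp (b *: H).
Proof.
have := @mexp_unique _ H (fun w => mexp ((b + w) *: H)) a; rewrite /= addr0.
rewrite [a + b]addrC => -> // z. exact: (mder_shift (F := fun w => mexp (w *: H)) (mder_mexp H (b + z))).
Qed.

Lemma mexpNK H (a : C) : mexp (- a *: H) *m mexp (a *: H) = 1%:M.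
Proof. by rewrite -mexpD addNr mexp0. Qed.

Lemma mexpKN H (a : C) : mexp (a *: H) *m mexp (- a *: H) = 1%:M.
Proof. by rewrite -mexpD addrN mexp0. Qed.

(* As functions of w both sides solve F' = H F. *)
Lemma mexp_conj H (G : 'M[C]_N) (k w : C) : H *m G - G *m H = k *: G ->
  mexp (w *: H) *m G = cexp (k * w) *: (G *m mexp (w *: H)).
Proof.
move=> HG.
pose F w := cexp (k * w) *: (G *m mexp (w *: H)).
have := @mexp_unique _ H F w; rewrite /F mulr0 cexp0 scale1r mexp0 mulmx1 => -> // z.
apply: mder_eq (mderZ (cder_cexpZ k z) (mder_mull G (mder_mexp H z))) _.
rewrite -scalemxAr; have -> : H *m (G *m mexp (z *: H)) = k *: (G *m mexp (z *: H)) +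
   G *m (H *m mexp (z *: H)).
  by rewrite !mulmxA scalemxAl -mulmxDl -HG subrK.
by rewrite scalerDr scalerA mulrC.
Qed.

Lemma mexp_comm H (G : 'M[C]_N) (w : C) : H *m G = G *m H ->
  mexp (w *: H) *m G = G *m mexp (w *: H).
Proof.
move=> HG; rewrite (@mexp_conj H G 0) ?mul0r ?cexp0 ?scale1r // HG subrr.
by rewrite scale0r.
Qed.

Lemma mexp_near1 H eps : 0 < eps -> exists2 d : R, 0 < d &
  forall w : C, cabs w < d -> nm (mexp (w *: H) - 1%:M) <= eps.
Proof.
move=> e0; have [d d0 Hd] := mder_cont (mder_mexp H 0) e0; exists d => // w wd.
by have := Hd w wd; rewrite add0r mexp0 => /ltW.
Qed.

End MatrixExponential.

(** * The principal logarithm *)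

Section ComplexLogarithm.
Variable R : realType.
Local Notation C := R[i].
Local Notation Re := (@complex.Re R).
Local Notation Im := (@complex.Im R).

Lemma slit_neq0 (z : C) : slit_plane z -> z != 0.
Proof. by move=> sz; apply/eqP => z0; apply: sz; rewrite z0. Qed.

Lemma slit_Re_gt0 (z : C) : 0 < Re z -> slit_plane z.
Proof. by move=> z0 [_]; rewrite leNgt z0. Qed.

Lemma slit_Re_ge0 (z : C) : 0 <= Re z -> z != 0 -> slit_plane z.
Proof.
move=> z0 zn [i0 zl]; case/negP: zn; rewrite eq_complex i0 eqxx andbT.
by rewrite eq_le zl.
Qed.

Lemma slit_cabs_gt0 (z : C) : slit_plane z -> 0 < cabs z + Re z.
Proof.
move=> sz; rewrite lt_def; apply/andP; split; last first.
  by have := Re_le_cabs z; rewrite ler_norml => /andP[]; lra.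
apply/eqP => H; apply: sz.
have E : Re z = - cabs z by lra.
have := sqr_cabs z; rewrite E sqrrN => /eqP; rewrite addrC -subr_eq subrr eq_sym sqrf_eq0.
by move=> /eqP ->; rewrite oppr_le0 cabs_ge0.
Qed.

Lemma carg_slit (z : C) : slit_plane z -> carg z = 2 * atan (Im z / (cabs z + Re z)).
Proof.
rewrite /carg; case: ifP => // /andP[/eqP i0 r0] sz.
by case: sz.
Qed.

Lemma carg_bound (z : C) : slit_plane z -> `|carg z| < pi.
Proof.
move=> sz; rewrite carg_slit //; set a := _ / _.
have := atan_gtNpi2 a; have := atan_ltpi2 a; rewrite ltr_norml.
by move=> H1 H2; apply/andP; split; lra.
Qed.

Lemma cos_sin_2atan (t : R) :
  cos (2 * atan t) = (1 - t ^+ 2) / (1 + t ^+ 2) /\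
  sin (2 * atan t) = 2 * t / (1 + t ^+ 2).
Proof.
have t1 : 0 < 1 + t ^+ 2 by rewrite ltr_wpDr ?sqr_ge0.
have c2 : cos (atan t) ^+ 2 = (1 + t ^+ 2)^-1.
  by rewrite cos_atan exprVn sqr_sqrtr // ltW.
have st : sin (atan t) = t * cos (atan t).
  rewrite -[X in X * _](atanK t) /tan mulfVK // cos_atan invr_eq0 sqrtr_eq0.
  by rewrite -ltNge.
have E : 2 * atan t = atan t *+ 2 by rewrite mulr_natl.
split; rewrite E.
  by rewrite cos_mulr2n c2 -mulr_natl; field; rewrite gt_eqF.
rewrite sin_mulr2n st -mulr_natl; have -> : cos (atan t) * (t * cos (atan t)) = t * cos (atan t) ^+ 2 by ring.
by rewrite c2; field; rewrite gt_eqF.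
Qed.

Lemma Re_clog (z : C) : Re (clog z) = ln (cabs z).
Proof. by rewrite /clog ReD /=; ring. Qed.

Lemma Im_clog (z : C) : Im (clog z) = carg z.
Proof. by rewrite /clog ImD /=; ring. Qed.

(** The definition of [carg] is the half-angle formula: t = Im z / (|z| + Re z) is the tangent of
    half the argument, and the rational parametrization of the circle by t recovers z / |z|. *)
Lemma clogK (z : C) : slit_plane z -> cexp (clog z) = z.
Proof.
move=> sz; have r0 : 0 < cabs z by rewrite cabs_gt0 slit_neq0.
have p0 := slit_cabs_gt0 sz; have E := sqr_cabs z.
rewrite /cexp Re_clog Im_clog lnK ?posrE // carg_slit //.
have [-> ->] := cos_sin_2atan (Im z / (cabs z + Re z)).
set r := cabs z in r0 p0 E *; set x := Re z in p0 E *; set y := Im z in p0 E *.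
have D : 1 + (y / (r + x)) ^+ 2 = 2 * r / (r + x).
  apply: (mulIf (_ : (r + x) ^+ 2 != 0)); first by rewrite expf_neq0 // gt_eqF.
  have -> : (1 + (y / (r + x)) ^+ 2) * (r + x) ^+ 2 = (r + x) ^+ 2 + y ^+ 2.
    by field; rewrite gt_eqF.
  have -> : y ^+ 2 = r ^+ 2 - x ^+ 2 by rewrite E; ring.
  by field; rewrite gt_eqF.
have N : 1 - (y / (r + x)) ^+ 2 = 2 * x / (r + x).
  have -> : 1 - (y / (r + x)) ^+ 2 = 2 - (1 + (y / (r + x)) ^+ 2) by ring.
  by rewrite D; field; rewrite gt_eqF.
rewrite D N; apply/eqP; rewrite eq_complex /= -/x -/y !mul0r ?subr0 ?addr0.
by apply/andP; split; apply/eqP; field; rewrite !gt_eqF.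
Qed.

Lemma cexpK (w : C) : `|Im w| < pi -> slit_plane (cexp w) /\ clog (cexp w) = w.
Proof.
move=> wpi; set b := Im w in wpi *.
have cb : 0 < cos (b / 2).
  by apply: cos_gt0_pihalf; move: wpi; rewrite ltr_norml => /andP[]; lra.
have b2 : b = (b / 2) *+ 2 by rewrite -mulr_natl mulrC divfK.
have c1 : 1 + cos b = 2 * cos (b / 2) ^+ 2.
  by rewrite {1}b2 cos_mulr2n -mulr_natl; ring.
have s1 : sin b = 2 * (cos (b / 2) * sin (b / 2)).
  by rewrite {1}b2 sin_mulr2n mulr_natl.
have c0 : 0 < 1 + cos b by rewrite c1 mulr_gt0 // exprn_gt0.
have e0 := expR_gt0 (Re w).
have ReE : Re (cexp w) = expR (Re w) * cos b by rewrite /cexp ReRM.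
have ImE : Im (cexp w) = expR (Re w) * sin b by rewrite /cexp ImRM.
have sl : slit_plane (cexp w).
  rewrite /slit_plane ReE ImE => -[/eqP]; rewrite mulf_eq0 gt_eqF //= => /eqP s0.
  rewrite pmulr_rle0 // => cl; have := cos2Dsin2 b; rewrite s0; nra.
split=> //; apply/eqP; rewrite eq_complex Re_clog Im_clog cabs_cexp expRK eqxx /=.
rewrite carg_slit // ReE ImE cabs_cexp.
have -> : expR (Re w) * sin b / (expR (Re w) + expR (Re w) * cos b) = tan (b / 2).
  rewrite -[X in X + _]mulr1 -mulrDr c1 s1 /tan; field.
  by rewrite !gt_eqF.
rewrite tanK; first by apply/eqP; rewrite -/b; field.
by rewrite in_itv /=; move: wpi; rewrite ltr_norml => /andP[? ?]; apply/andP; split; lra.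
Qed.

Lemma atan_le (t : R) : `|atan t| <= `|t|.
Proof.
have P (x : R) : 0 <= x -> atan x <= x.
  move=> x0; have := @rder_le R (@atan R) id (fun t => (1 + t ^+ 2)^-1) (fun=> 1) 0 x x0.
  rewrite atan0 !subr0; apply.
  - by move=> s _; apply: is_derive_rder; exact: is_derive1_atan.
  - by move=> s _; rewrite invf_le1 ?lerDl ?sqr_ge0 // ltr_wpDr ?sqr_ge0.
have Q (x : R) : 0 <= x -> `|atan x| <= `|x|.
  move=> x0; rewrite !ger0_norm //; first exact: P.
  by rewrite -(@atan0 R); exact: le_atan.
have [t0|/ltW t0] := leP 0 t; first exact: Q.
by rewrite -normrN -atanN -[X in _ <= X]normrN; apply: Q; rewrite oppr_ge0.
Qed.

Lemma clog1 : clog (1 : C) = 0.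
Proof.
have H : `|Im (0 : C)| < pi by rewrite normr0 pi_gt0.
by have [_] := cexpK H; rewrite cexp0.
Qed.

(** The factor 4 is 2 + 2: the logarithm of the modulus and the argument of 1 + h are each at most 2
    |h|. *)
Lemma clog1p_le (h : C) : cabs h <= 2^-1 ->
  slit_plane (1 + h) /\ cabs (clog (1 + h)) <= 4 * cabs h.
Proof.
move=> h2; set c := cabs h in h2 *; have c0 : 0 <= c := cabs_ge0 h.
have Rh := Re_le_cabs h; have Ih := Im_le_cabs h.
have Re1 : 1 - c <= Re (1 + h).
  by rewrite ReD /=; move: Rh; rewrite ler_norml => /andP[]; rewrite -/c; lra.
have sl : slit_plane (1 + h) by apply: slit_Re_gt0; lra.
split=> //; apply: le_trans (cabs_le_ReIm _) _; rewrite Re_clog Im_clog.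
set y := cabs (1 + h).
have y1 : y <= 1 + c by apply: le_trans (cabsD _ _) _; rewrite cabs1.
have y2 : 1 - c <= y by apply: le_trans Re1 (le_trans (ler_norm _) (Re_le_cabs _)).
have y0 : 0 < y by lra.
have l1 : ln y <= c.
  have := @le_ln1Dx R (y - 1); rewrite [1 + _]addrC subrK => H; apply: le_trans (H _) _; lra.
have l2 : - ln y <= 2 * c.
  rewrite -lnV ?posrE //; have := @le_ln1Dx R (y^-1 - 1); rewrite [1 + _]addrC subrK => H.
  have yi : 0 < y^-1 by rewrite invr_gt0.
  apply: le_trans (H _) _; first lra.
  have : y^-1 <= 2 by rewrite -div1r ler_pdivrMr //; lra.
  move=> yy; have -> : y^-1 - 1 = (1 - y) * y^-1 by field; rewrite gt_eqF.
  have [y11|y11] := leP 1 y; nra.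
have al : `|carg (1 + h)| <= 2 * c.
  rewrite carg_slit // normrM ger0_norm //.
  apply: (@le_trans _ _ (2 * `|Im (1 + h) / (cabs (1 + h) + Re (1 + h))|)).
    by rewrite ler_wpM2l // atan_le.
  rewrite ler_wpM2l // normrM normfV -/y.
  have yR : 0 < y + Re (1 + h) by lra.
  rewrite [X in _ / X]gtr0_norm //.
  rewrite ler_pdivrMr //.
  rewrite ImD /= add0r; apply: le_trans Ih _; rewrite -/c; nra.
have : `|ln y| <= 2 * c by rewrite ler_norml; apply/andP; split; lra.
lra.
Qed.

(** The smallness condition keeps the sum of the two arguments strictly between - pi and pi, where
    the principal logarithm is additive. It serves both the derivative of [clog] and the logarithm
    of q. *)
Lemma clogM1p (z h : C) : slit_plane z -> cabs h <= 2^-1 ->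
  `|carg z| + 4 * cabs h < pi -> slit_plane (z * (1 + h)) /\
  clog (z * (1 + h)) = clog z + clog (1 + h).
Proof.
move=> sz h2 hz; have [sh lh] := clog1p_le h2.
rewrite -{1 2}(clogK sz) -{1 2}(clogK sh) -cexpD; apply: cexpK.
rewrite ImD !Im_clog; apply: le_lt_trans (ler_normD _ _) (le_lt_trans _ hz).
by rewrite lerD2l -Im_clog; apply: le_trans (Im_le_cabs _) lh.
Qed.

Lemma cder_clog1 : cder (@clog R) 1 1.
Proof.
move=> e e0; have e4 : 0 < e / 4 by rewrite divr_gt0.
have [d d0 H] := cder_cexp0 e4.
exists (Num.min 2^-1 (d / 4)); first by rewrite lt_min divr_gt0 // invr_gt0 ltr0n.
move=> h; rewrite lt_min => /andP[/ltW h2 hd].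
have [sh lh] := clog1p_le h2; rewrite clog1 subr0 mulr1.
have := H (clog (1 + h)); rewrite add0r cexp0 mulr1 clogK // => Hl.
rewrite cabs_distC; have -> : h - clog (1 + h) = 1 + h - 1 - clog (1 + h) by ring.
apply: le_trans (Hl _) _; first by apply: le_lt_trans lh _; lra.
apply: le_trans (ler_wpM2l (ltW e4) lh) _.
by rewrite le_eqVlt; apply/orP; left; apply/eqP; field.
Qed.

(** Near z the logarithm of x is log z + log (x / z), which moves the point to 1; there the
    derivative comes from inverting exp at 0. *)
Lemma cder_clog (z : C) : slit_plane z -> cder (@clog R) z z^-1.
Proof.
move=> sz; have z0 := slit_neq0 sz.
have c0 : 0 < cabs z by rewrite cabs_gt0.
have H : cder (fun x => clog z + clog (z^-1 * x)) z z^-1.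
  have D1 : cder (fun x => z^-1 * x) z z^-1.
    by apply: cder_eq (cderZ _ (cder_id _)) _; rewrite mulr1.
  have D2 : cder (@clog R) (z^-1 * z) 1 by rewrite mulVf //; exact: cder_clog1.
  apply: cder_eq (cderD (cder_const (clog z) z) (cder_comp D1 D2)) _.
  by rewrite add0r mulr1.
pose d : R := Num.min (cabs z * 2^-1) (cabs z * ((pi - `|carg z|) / 4)).
have d0 : 0 < d.
  by rewrite lt_min !mulr_gt0 ?invr_gt0 ?ltr0n // subr_gt0 carg_bound.
apply: cder_mx1; apply: (mder_near d0 _ (cder_scalar 1 H)) => h.
rewrite lt_min => /andP[h1 h2].
have ch : cabs (h / z) = cabs h / cabs z by rewrite cabsM cabsV.
have E1 : z^-1 * (z + h) = 1 + h / z by rewrite mulrDr mulVf // mulrC.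
have E2 : z * (1 + h / z) = z + h by rewrite mulrDr mulr1 mulrCA divff // mulr1.
have H1 : cabs (h / z) <= 2^-1 by rewrite ch ler_pdivrMr // mulrC ltW.
have H2 : `|carg z| + 4 * cabs (h / z) < pi.
  rewrite ch -ltrBrDl; move: h2; rewrite [cabs z * _]mulrC -ltr_pdivrMr //; lra.
by have [_ E3] := clogM1p sz H1 H2; rewrite E1 -E3 E2.
Qed.

End ComplexLogarithm.

(** * Splitting off a maximal eigenvalue *)

Section SpectralSplitting.
Variable R : realType.
Local Notation C := R[i].
Local Notation Re := (@complex.Re R).
Local Notation Im := (@complex.Im R).

Lemma ReM (z w : C) : Re (z * w) = Re z * Re w - Im z * Im w.
Proof. by case: z; case: w. Qed.

Lemma ImM (z w : C) : Im (z * w) = Re z * Im w + Im z * Re w.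
Proof. by case: z; case: w. Qed.

Lemma horner_mx_eigen n (A : 'M[C]_n.+1) (q : {poly C}) (a : C) (v : 'cV[C]_n.+1) :
  A *m v = a *: v -> horner_mx A q *m v = q.[a] *: v.
Proof.
move=> Av; elim/poly_ind: q => [|q c IH].
  by rewrite rmorph0 mul0mx horner0 scale0r.
rewrite rmorphD rmorphM /= horner_mx_X horner_mx_C mulmxDl mul_scalar_mx -mulmxA Av.
by rewrite -scalemxAr IH !hornerE scalerA -scalerDl mulrC.
Qed.

Lemma horner_mx_eigen_row n (A : 'M[C]_n.+1) (q : {poly C}) (a : C) (v : 'rV[C]_n.+1) :
  v *m A = a *: v -> v *m horner_mx A q = q.[a] *: v.
Proof.
move=> Av; elim/poly_ind: q => [|q c IH].
  by rewrite rmorph0 mulmx0 horner0 scale0r.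
rewrite rmorphD rmorphM /= horner_mx_X horner_mx_C mulmxDr mul_mx_scalar mulmxA IH.
by rewrite -scalemxAl Av !hornerE scalerA -scalerDl.
Qed.

Lemma fin_min_gt0 n (f : 'I_n -> R) : (forall i, 0 < f i) ->
  exists2 c, 0 < c & forall i, c <= f i.
Proof.
elim: n f => [|n IH] f f0; first by exists 1 => // -[].
have [c c0 cf] := IH (fun i => f (lift ord0 i)) (fun i => f0 _).
exists (Num.min c (f ord0)); first by rewrite lt_min c0 f0.
move=> i; case: (unliftP ord0 i) => [j ->|->]; rewrite ge_min ?lexx ?orbT //.
by rewrite cf.
Qed.

(** Schur form makes A lower triangular with its eigenvalues on the diagonal. Conjugation by
    diag(d^i) multiplies the entry (i, j), i > j, by d^(i - j); for small d the off-diagonal part is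
    dominated by a lower bound c of the real parts, and c / 2 survives. Q is the combined change of
    basis. *)
Lemma lyapunov n (A : 'M[C]_n) : (0 < n)%N ->
  (forall a, eigenvalue A a -> 0 < Re a) ->
  exists Q Q' : 'M[C]_n, Q' *m Q = 1%:M /\
  exists2 c, 0 < c & forall v : 'cV[C]_n, c * ip (Q *m v) (Q *m v) <= ip (Q *m v) (Q *m (A *m v)).
Proof.
move=> n0 Apos; have [U Uu] := Schur A n0.
have Uun := unitarymx_unit Uu.
rewrite /similar_to /= conjumx // => Ttrig; set T := U *m A *m invmx U in Ttrig.
have UA : U *m A = T *m U by rewrite /T mulmxKV.
clearbody T.
have Tpos i : 0 < Re (T i i).
  apply: Apos; have : eigenvalue T (T i i).
    rewrite eigenvalue_root_char char_poly_trig // /root horner_prod.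
    by rewrite (bigD1 i) //= !hornerE subrr mul0r.
  move=> /eigenvalueP[v Tv v0]; apply/eigenvalueP; exists (v *m U).
    by rewrite -mulmxA UA mulmxA Tv scalemxAl.
  apply: contra_neq v0 => vU; rewrite -[v](mulmxK Uun) vU mul0mx //.
have [c c0 cT] := fin_min_gt0 Tpos.
pose K := nm T; have K0 : 0 <= K := nm_ge0 _.
pose k : R := (n * 1)%:R ^+ 2 * K + 1.
have k0 : 0 < k by rewrite ltr_wpDl // mulr_ge0 ?exprn_ge0.
(* Chosen so that the off-diagonal part, after the loss (n * 1)^2 between [nm] and [ip], costs at
   most c / 2. *)
pose d : R := Num.min 1 (c / (2 * k)).
have d0 : 0 < d by rewrite lt_min ltr01 divr_gt0 // mulr_gt0.
have d1 : d <= 1 by rewrite ge_min lexx.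
have dk : d * ((n * 1)%:R ^+ 2 * K) <= c / 2.
  apply: (@le_trans _ _ (c / (2 * k) * k)); last first.
    by rewrite le_eqVlt; apply/orP; left; apply/eqP; field; rewrite gt_eqF.
  apply: ler_pM; rewrite ?(ltW d0) ?mulr_ge0 ?exprn_ge0 //.
    by rewrite ge_min lexx orbT.
  by rewrite /k lerDl.
have dC0 : d%:C != 0 by rewrite (inj_eq (@complexI R) _ 0) gt_eqF.
pose D : 'M[C]_n := diag_mx (\row_i d%:C ^+ i).
pose D' : 'M[C]_n := diag_mx (\row_i (d%:C ^+ i)^-1).
have D'D : D' *m D = 1%:M.
  apply/matrixP => i j; rewrite mul_diag_mx !mxE.
  by case: eqP => [->|_]; rewrite ?mulr0n ?mulr0 // !mulr1n mulVf // expf_neq0.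
pose S := D *m T *m D'.
have Sij i j : S i j = d%:C ^+ i * T i j * (d%:C ^+ j)^-1.
  by rewrite /S mul_mx_diag mul_diag_mx !mxE.
exists (D *m U), (invmx U *m D'); split.
  by rewrite mulmxA -[_ *m D' *m D]mulmxA D'D mulmx1 mulVmx.
exists (c / 2); first by rewrite divr_gt0.
move=> v; set x := D *m U *m v.
have -> : D *m U *m (A *m v) = S *m x.
  have SDU : S *m (D *m U) = D *m U *m A.
    by rewrite /S -mulmxA (mulmxA D') D'D mul1mx -!mulmxA UA.
  by rewrite /x mulmxA -SDU !mulmxA.
clearbody x.
pose Dg : 'M[C]_n := diag_mx (\row_i T i i).
have -> : S = Dg + (S - Dg) by rewrite addrC subrK.
rewrite mulmxDl ipDr.
have H1 : c * ip x x <= ip x (Dg *m x).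
  rewrite /ip mulr_sumr; apply: ler_sum => i _; rewrite mulr_sumr; apply: ler_sum => j _.
  rewrite mul_diag_mx !mxE ReM ImM; have ca := cT i.
  set p := Re (x i j); set q := Im (x i j); set a := Re (T i i) in ca *; set b := Im (T i i).
  have -> : p * (a * p - b * q) + q * (a * q + b * p) = a * (p * p + q * q) by ring.
  by rewrite ler_wpM2r // addr_ge0 // -expr2 sqr_ge0.
have SD i j : cabs ((S - Dg) i j) <= d * cabs (T i j).
  rewrite mxE Sij; clearbody S; rewrite !mxE; have [ij|ji|ij] := ltngtP i j.
  - have -> : T i j = 0 by apply: (is_trig_mxP Ttrig).
    rewrite mulr0 mul0r (_ : (i == j) = false) ?mulr0n ?subrr ?cabs0 ?mulr0 //.
    by apply/eqP => E; rewrite E ltnn in ij.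
  - rewrite (_ : (i == j) = false) ?mulr0n ?subr0; last first.
      by apply/eqP => E; rewrite E ltnn in ji.
    have -> : d%:C ^+ i * T i j * (d%:C ^+ j)^-1 = d%:C ^+ (i - j) * T i j.
      by rewrite -{1}(subnK (ltnW ji)) exprD mulrAC mulrK // unitfE expf_neq0.
    rewrite cabsM ler_wpM2r ?cabs_ge0 // cabsX cabsR gtr0_norm //.
    by rewrite -(subnSK ji) exprS ler_piMr ?(ltW d0) // exprn_ile1 // ltW.
  - have E : i = j by apply/val_inj.
    rewrite E eqxx mulr1n mulrAC mulfV ?expf_neq0 // mul1r subrr cabs0.
    by rewrite mulr_ge0 ?cabs_ge0 // ltW.
have nSD : nm (S - Dg) <= d * K.
  rewrite /nm /K /nm mulr_sumr; apply: ler_sum => i _; rewrite mulr_sumr.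
  by apply: ler_sum => j _; exact: SD.
have H2 : `|ip x ((S - Dg) *m x)| <= c / 2 * ip x x.
  apply: le_trans (ip_le _ _) _.
  apply: (@le_trans _ _ (nm x * (d * K * nm x))).
    rewrite ler_wpM2l ?nm_ge0 //; apply: le_trans (nmM _ _) _.
    by rewrite ler_wpM2r ?nm_ge0.
  have -> : nm x * (d * K * nm x) = d * K * nm x ^+ 2 by ring.
  apply: (@le_trans _ _ (d * K * ((n * 1)%:R ^+ 2 * ip x x))).
    by apply: ler_wpM2l; [rewrite mulr_ge0 // ltW|exact: nm_sqr_le].
  by rewrite mulrA -[d * K * _]mulrA [K * _]mulrC ler_wpM2r ?ip_ge0.
move: H2; rewrite ler_norml => /andP[H2 _]; lra.
Qed.

(** Write chi = (X - lam) u. Simplicity of the root gives u(lam) <> 0, and by Cayley-Hamilton P =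
    u(Lam) / u(lam) is the spectral projection. Adding P to B replaces the eigenvalue 0 by 1, so
    [lyapunov] applies to B + P, which agrees with B on the kernel of P. *)
Lemma maximal_eigenvalue_splitting N (Lam : 'M[C]_N) (lam : R) (B : 'M[C]_N) :
  is_maximal_eigenvalue Lam lam -> B = lam%:C%:M - Lam ->
  exists P Q Q' : 'M[C]_N,
  [/\ B *m P = 0, P *m B = 0,
     (forall v : 'cV[C]_N, B *m v = 0 -> P *m v = v) & Q' *m Q = 1%:M] /\
  exists2 c, 0 < c & forall v : 'cV[C]_N, P *m v = 0 ->
     c * ip (Q *m v) (Q *m v) <= ip (Q *m v) (Q *m (B *m v)).
Proof.
case: N Lam B => [|N] Lam B [rt [mu oth]] EB.
  by move: rt; rewrite /root /char_poly det_mx00 hornerE oner_eq0.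
set chi := char_poly Lam in rt mu oth.
have chi0 : chi != 0 by rewrite monic_neq0 // char_poly_monic.
have [u Eu] := factor_theorem _ _ rt.
have u0 : u.[lam%:C] != 0.
  apply/negP => ru; have [w Ew] := factor_theorem _ _ ru.
  have : (2 <= mup lam%:C chi)%N.
    by rewrite mup_geq // Eu Ew -mulrA -expr2 dvdp_mulIr.
  by rewrite mu.
pose P := (u.[lam%:C])^-1 *: horner_mx Lam u.
have BE : B = - horner_mx Lam ('X - lam%:C%:P).
  by rewrite rmorphB /= horner_mx_X horner_mx_C opprB EB.
have BP : B *m P = 0.
  rewrite /P -scalemxAr BE mulNmx; have -> : horner_mx Lam ('X - lam%:C%:P) *m horner_mx Lam u
    = horner_mx Lam (('X - lam%:C%:P) * u) by rewrite rmorphM.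
  by rewrite mulrC -Eu Cayley_Hamilton oppr0 scaler0.
have PB : P *m B = 0.
  rewrite /P -scalemxAl BE mulmxN; have -> : horner_mx Lam u *m horner_mx Lam ('X - lam%:C%:P)
    = horner_mx Lam (u * ('X - lam%:C%:P)) by rewrite rmorphM.
  by rewrite -Eu Cayley_Hamilton oppr0 scaler0.
have Pker (v : 'cV[C]_N.+1) : B *m v = 0 -> P *m v = v.
  rewrite EB mulmxBl mul_scalar_mx => /eqP; rewrite subr_eq0 => /eqP/esym Lv.
  by rewrite /P -scalemxAl (horner_mx_eigen _ Lv) scalerA mulVf // scale1r.
have Pkerr (v : 'rV[C]_N.+1) : v *m B = 0 -> v *m P = v.
  rewrite EB mulmxBr mul_mx_scalar => /eqP; rewrite subr_eq0 => /eqP/esym Lv.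
  by rewrite /P -scalemxAr (horner_mx_eigen_row _ Lv) scalerA mulVf // scale1r.
have PP : P *m P = P.
  apply/trmx_inj/row_matrixP => i; rewrite -!tr_col; congr trmx.
  rewrite colE -mulmxA -colE Pker // colE mulmxA BP mul0mx //.
have [|Q [Q' [QQ [c c0 Hc]]]] := @lyapunov _ (B + P) (ltn0Sn N).
  (* An eigenvalue a of B + P is 1, or lam - a is an eigenvalue of Lam other than lam: for a <> 1
     the row vector v is killed by P and is an eigenvector of B, and a = 0 would make it fixed by
     P. *)
  move=> a /eigenvalueP[v va v0].
  have vP : a *: (v *m P) = v *m P.
    by rewrite scalemxAl -va -mulmxA mulmxDl BP add0r PP.
  have [->|a1] := eqVneq a 1; first by rewrite ltr01.
  have vP0 : v *m P = 0.
    apply/eqP; have /eqP : (a - 1) *: (v *m P) = 0 by rewrite scalerBl vP scale1r subrr.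
    by rewrite scaler_eq0 subr_eq0 (negbTE a1).
  have vB : v *m B = a *: v by rewrite -va mulmxDr vP0 addr0.
  have a0 : a != 0.
    apply: contra_neq v0 => a0; rewrite -(Pkerr v) ?vP0 //.
    by rewrite vB a0 scale0r.
  have ev : root chi (lam%:C - a).
    rewrite -eigenvalue_root_char; apply/eigenvalueP; exists v => //.
    have -> : Lam = lam%:C%:M - B by rewrite EB opprB addrC subrK.
    by rewrite mulmxBr mul_mx_scalar vB scalerBl.
  have := oth _ ev; rewrite ReD ReN /=.
  have -> : lam%:C - a != lam%:C by rewrite -subr_eq0 addrAC subrr add0r oppr_eq0.
  by move=> /(_ isT); lra.
exists P, Q, Q'; split=> //; exists c => // v Pv.
by have := Hc v; rewrite mulmxDl Pv addr0.
Qed.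

End SpectralSplitting.

(** * The diagonalizing gauge *)

Section MatrixBinomials.
Variable R : realType.
Local Notation C := R[i].

Lemma mpowS N (A : 'M[C]_N) k : mpow A k.+1 = A *m mpow A k.
Proof. by []. Qed.

Lemma mpowD N (A : 'M[C]_N) i j : mpow A (i + j) = mpow A i *m mpow A j.
Proof.
by elim: i => [|i IH]; rewrite ?mul1mx // addSn !mpowS IH mulmxA.
Qed.

Lemma mpow_comm N (A G : 'M[C]_N) k : A *m G = G *m A -> mpow A k *m G = G *m mpow A k.
Proof.
move=> AG; elim: k => [|k IH]; first by rewrite mul1mx mulmx1.
by rewrite mpowS -mulmxA IH mulmxA AG -mulmxA.
Qed.

Lemma mpowSr N (A : 'M[C]_N) k : mpow A k.+1 = mpow A k *m A.
Proof. by rewrite mpowS mpow_comm. Qed.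

Lemma mpow_scalar N (c : C) k : mpow (c%:M : 'M[C]_N) k = (c ^+ k)%:M.
Proof.
by elim: k => [|k IH]; rewrite ?expr0 // mpowS IH -scalar_mxM exprS.
Qed.

Fixpoint mbinom N (a : 'M[C]_N) (j : nat) : 'M[C]_N :=
  if j is k.+1 then k.+1%:R^-1 *: (mbinom a k *m (a - k%:R%:M)) else 1%:M.

Lemma mbinomS N (a : 'M[C]_N) k :
  k.+1%:R *: mbinom a k.+1 = mbinom a k *m (a - k%:R%:M).
Proof. by rewrite /= scalerA mulfV ?scale1r // pnatr_eq0. Qed.

Lemma mbinom_comm N (a G : 'M[C]_N) j : a *m G = G *m a -> mbinom a j *m G = G *m mbinom a j.
Proof.
move=> aG; elim: j => [|j IH]; first by rewrite mul1mx mulmx1.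
rewrite /= -scalemxAl -scalemxAr; congr (_ *: _).
rewrite -mulmxA mulmxBl aG mul_scalar_mx -mul_mx_scalar -mulmxBr mulmxA IH.
by rewrite mulmxA.
Qed.

Lemma mbinom_intertwine N (a b G : 'M[C]_N) j : a *m G = G *m b ->
  mbinom a j *m G = G *m mbinom b j.
Proof.
move=> aG; elim: j => [|j IH]; first by rewrite mul1mx mulmx1.
rewrite /= -scalemxAl -scalemxAr; congr (_ *: _).
rewrite -mulmxA mulmxBl aG mul_scalar_mx -mul_mx_scalar -mulmxBr mulmxA IH.
by rewrite mulmxA.
Qed.

Lemma gbinomS (c : C) k : k.+1%:R * gbinom c k.+1 = gbinom c k * (c - k%:R).
Proof.
rewrite /gbinom big_ord_recr /= factS natrM.
have f0 : (k`!%:R : C) != 0 by rewrite pnatr_eq0 -lt0n fact_gt0.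
have k0 : (k.+1%:R : C) != 0 by rewrite pnatr_eq0.
move: (\prod_(i < k) _) (k`!%:R) (k.+1%:R) (k%:R) f0 k0 => p f k1 k2 f0 k0.
by field; apply/andP.
Qed.

Lemma gbinom0 (c : C) : gbinom c 0 = 1.
Proof. by rewrite /gbinom big_ord0 fact0 divr1. Qed.

(* Both sides satisfy (j + 1) V_(j+1) = V_j (a + c - j). *)
Lemma mbinom_vandermonde N (a : 'M[C]_N) (c : C) j :
  mbinom (a + c%:M) j = \sum_(i < j.+1) gbinom c (j - i) *: mbinom a i.
Proof.
elim: j => [|j IH]; first by rewrite big_ord1 subn0 gbinom0 scale1r.
have k0 : (j.+1%:R : C) != 0 by rewrite pnatr_eq0.
apply: (scalerI k0); rewrite mbinomS IH mulmx_suml.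
transitivity (\sum_(i < j.+1) ((i.+1%:R * gbinom c (j - i)) *: mbinom a i.+1 +
   ((j.+1 - i)%N%:R * gbinom c (j.+1 - i)) *: mbinom a i)).
  apply: eq_bigr => i _.
  have ij : (i <= j)%N by rewrite -ltnS.
  have -> : a + c%:M - j%:R%:M = (a - i%:R%:M) + (c - (j - i)%N%:R)%:M.
    by rewrite natrB // !raddfB /=; mxring.
  rewrite mulmxDr -!scalemxAl mul_mx_scalar scalerA -mbinomS [X in X + _]scalerA.
  by rewrite [_ * i.+1%:R]mulrC -gbinomS subSn.
rewrite big_split /= scaler_sumr.
have -> : \sum_(i < j.+2) j.+1%:R *: (gbinom c (j.+1 - i) *: mbinom a i) =
  \sum_(i < j.+2) (i%:R * gbinom c (j.+1 - i)) *: mbinom a i +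
  \sum_(i < j.+2) ((j.+1 - i)%N%:R * gbinom c (j.+1 - i)) *: mbinom a i.
  rewrite -big_split; apply: eq_bigr => i _ /=; rewrite scalerA -scalerDl -mulrDl -natrD.
  by rewrite subnKC // -ltnS.
congr (_ + _).
  by rewrite [RHS]big_ord_recl mul0r scale0r add0r.
by rewrite [RHS]big_ord_recr /= subnn mul0r scale0r addr0.
Qed.

Lemma gbinom1_0 k : gbinom (1 : C) k.+2 = 0.
Proof.
rewrite /gbinom (bigD1 (inord 1 : 'I_k.+2)) //= inordK // subrr mul0r.
by rewrite mul0r.
Qed.

Lemma mbinom_pascal N (a : 'M[C]_N) j :
  mbinom (a + 1%:M) j.+1 = mbinom a j.+1 + mbinom a j.
Proof.
rewrite mbinom_vandermonde !big_ord_recr /= subnn gbinom0 scale1r subSn // subnn.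
have -> : gbinom (1 : C) 1 = 1 by rewrite /gbinom big_ord1 subr0 divr1.
rewrite scale1r big1 ?add0r; first by rewrite addrC.
move=> i _; have -> : (j.+1 - i = (j - i.+1).+2)%N.
  by rewrite !subSn ?subnSK // ltnW.
by rewrite gbinom1_0 scale0r.
Qed.

Definition mseries N s (t : C) (a : nat -> 'M[C]_N) := \sum_(j < s.+1) t ^+ j *: a j.

(** The part of degree above s in the product of two truncated series, with t^(s+1) divided out. *)
Definition mtail N s (t : C) (a b : nat -> 'M[C]_N) : 'M[C]_N :=
  \sum_(i < s.+1) \sum_(j < s.+1 | (s < i + j)%N) t ^+ (i + j - s.+1) *: (a i *m b j).

Lemma mseries_mul N s t (a b : nat -> 'M[C]_N) :
  mseries s t a *m mseries s t b =
  mseries s t (fun k => \sum_(i < k.+1) a (k - i)%N *m b i) + t ^+ s.+1 *: mtail s t a b.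
Proof.
rewrite /mseries mulmx_suml.
transitivity (\sum_(i < s.+1) \sum_(j < s.+1) t ^+ (i + j) *: (a i *m b j)).
  apply: eq_bigr => i _; rewrite mulmx_sumr; apply: eq_bigr => j _.
  by rewrite -scalemxAl -scalemxAr scalerA exprD.
have -> : \sum_(i < s.+1) \sum_(j < s.+1) t ^+ (i + j) *: (a i *m b j) =
  \sum_(i < s.+1) \sum_(j < s.+1 | (i + j <= s)%N) t ^+ (i + j) *: (a i *m b j) +
  \sum_(i < s.+1) \sum_(j < s.+1 | (s < i + j)%N) t ^+ (i + j) *: (a i *m b j).
  rewrite -big_split; apply: eq_bigr => i _ /=.
  rewrite (bigID (fun j : 'I_s.+1 => (i + j <= s)%N)) /=; congr (_ + _).
  by apply: eq_bigl => j; rewrite -ltnNge.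
congr (_ + _); last first.
  rewrite /mtail scaler_sumr; apply: eq_bigr => i _; rewrite scaler_sumr.
  by apply: eq_bigr => j sij; rewrite scalerA -exprD subnKC.
rewrite (exchange_big_dep xpredT) //=.
under [RHS]eq_bigr => k _ do rewrite scaler_sumr.
(* For fixed j the index i is replaced by k = i + j, so that exchanging the sums collects the
   coefficient of t^k. *)
have E1 (j : 'I_s.+1) : \sum_(i < s.+1 | (i + j <= s)%N) t ^+ (i + j) *: (a i *m b j) =
  \sum_(0 <= k < s.+1 | (j <= k)%N) t ^+ k *: (a (k - j)%N *m b j).
  have js : (j <= s)%N by rewrite -ltnS.
  rewrite [RHS](big_cat_nat (n := j)) ?leq0n //=; last exact: leqW.
  rewrite [X in _ = X + _]big_nat_cond [X in _ = X + _]big_pred0 ?add0r; last first.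
    by move=> k /=; lia.
  rewrite -[X in index_iota X _]add0n big_addn.
  rewrite -(big_mkord (fun i => (i + j <= s)%N) (fun i => t ^+ (i + j) *: (a i *m b j))).
  rewrite [LHS](big_cat_nat (n := (s.+1 - j)%N)) ?leq_subr //=.
  rewrite [X in _ + X = _]big_nat_cond [X in _ + X = _]big_pred0 ?addr0; last first.
    by move=> k /=; lia.
  rewrite big_nat_cond [RHS]big_nat_cond; apply: eq_big => [k|k _].
    by apply/idP/idP; lia.
  by rewrite addnK.
rewrite (eq_bigr _ (fun j _ => E1 j)).
have E2 (k : 'I_s.+1) : \sum_(i < k.+1) t ^+ k *: (a (k - i)%N *m b i) =
  \sum_(0 <= i < s.+1 | (i <= k)%N) t ^+ k *: (a (k - i)%N *m b i).
  rewrite -(big_mkord xpredT (fun i => t ^+ k *: (a (k - i)%N *m b i))).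
  rewrite [RHS](big_cat_nat (n := k.+1)) ?leq0n //=.
  rewrite [X in _ = _ + X]big_nat_cond [X in _ = _ + X]big_pred0 ?addr0; last first.
    by move=> i /=; lia.
  rewrite big_nat_cond [RHS]big_nat_cond; apply: eq_bigl => i.
  by apply/idP/idP; lia.
rewrite (eq_bigr _ (fun j _ => E2 j)).
rewrite -(big_mkord xpredT (fun j => \sum_(0 <= k < s.+1 | (j <= k)%N) t ^+ k *: (a (k - j)%N *m b j))).
rewrite -(big_mkord xpredT (fun k => \sum_(0 <= i < s.+1 | (i <= k)%N) t ^+ k *: (a (k - i)%N *m b i))).
by rewrite (exchange_big_dep xpredT).
Qed.

End MatrixBinomials.

(** * The exact gauge identity for truncated binomial series *)

Section GaugeIdentity.
Variable R : realType.
Local Notation C := R[i].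
Variables (N : nat) (e e0 h : 'M[C]_N) (c : C).
Hypothesis he : (c *: h) *m e = e *m (c *: h + c%:M).
Hypothesis he0 : (c *: h) *m e0 = e0 *m (c *: h + (c - 1)%:M).

(** Taylor coefficients in t of (1 + t F)^(c h); those of (1 + t F)^c are in [root_coef]. With c = 1
    / h^vee, F = - E and t = x^(- M h^vee) the latter is the expansion of p^(1 / h^vee) / x^M. *)
Definition gauge_coef (F : 'M[C]_N) j := mpow F j *m mbinom (c *: h) j.
Definition root_coef (F : 'M[C]_N) j := gbinom c j *: mpow F j.

Definition gauge_rem s (t : C) (F : 'M[C]_N) :=
  (e + e0) *m mtail s t (root_coef F) (gauge_coef F)
  - e0 *m (mpow F s.+1 *m mbinom (c *: h + (c - 1)%:M) s).

Variable F : 'M[C]_N.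
Hypothesis Fe : F *m e = e *m F.
Hypothesis Fe0 : F *m e0 = e0 *m F.
Hypothesis Fh : F *m h = h *m F.

Let a := c *: h.
Let Fa : F *m a = a *m F.
Proof. by rewrite /a -scalemxAr Fh scalemxAl. Qed.

Let Fab b : F *m (a + b%:M) = (a + b%:M) *m F.
Proof. by rewrite mulmxDr mulmxDl Fa scalar_mxC. Qed.

Lemma mseries_comm s t (u : nat -> 'M[C]_N) G :
  (forall j, u j *m G = G *m u j) -> mseries s t u *m G = G *m mseries s t u.
Proof.
move=> uG; rewrite /mseries mulmx_suml mulmx_sumr; apply: eq_bigr => j _.
by rewrite -scalemxAl -scalemxAr uG.
Qed.

Lemma mpow_mbinom_comm b i j : mpow F i *m mbinom (a + b%:M) j = mbinom (a + b%:M) j *m mpow F i.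
Proof. by apply: mpow_comm; apply/esym/mbinom_comm/esym. Qed.

Lemma root_gauge_comm s t :
  mseries s t (root_coef F) *m mseries s t (gauge_coef F) =
  mseries s t (gauge_coef F) *m mseries s t (root_coef F).
Proof.
apply: mseries_comm => i; apply/esym/mseries_comm => j.
rewrite /gauge_coef /root_coef -scalemxAr -scalemxAl; congr (_ *: _).
have := mpow_mbinom_comm 0 i j; rewrite raddf0 addr0 => H.
rewrite -mulmxA -H !mulmxA; congr (_ *m _).
by rewrite -!mpowD addnC.
Qed.

Lemma root_gauge_mul s t :
  mseries s t (root_coef F) *m mseries s t (gauge_coef F) =
  mseries s t (fun k => mpow F k *m mbinom (a + c%:M) k)
  + t ^+ s.+1 *: mtail s t (root_coef F) (gauge_coef F).
Proof.
rewrite mseries_mul; congr (_ + _); apply: eq_bigr => k _; congr (_ *: _).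
rewrite mbinom_vandermonde mulmx_sumr; apply: eq_bigr => i _.
rewrite /root_coef /gauge_coef -scalemxAl -scalemxAr mulmxA -mpowD subnK //.
by rewrite -ltnS.
Qed.

Lemma gauge_e s t : mseries s t (gauge_coef F) *m e =
  e *m mseries s t (fun k => mpow F k *m mbinom (a + c%:M) k).
Proof.
rewrite /mseries mulmx_suml mulmx_sumr; apply: eq_bigr => j _.
rewrite -scalemxAl -scalemxAr -mulmxA (mbinom_intertwine j he) !mulmxA.
by rewrite (mpow_comm j Fe).
Qed.

(** By the rule of Pascal the factor 1 + t F raises the exponent a + c - 1 to a + c, the exponent
    that e produces in [gauge_e]. The last term of the truncated series has no partner and remains
    as the term in t^(s+1). *)
Lemma gauge_e0 s t : mseries s t (gauge_coef F) *m ((1%:M + t *: F) *m e0) =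
  e0 *m (mseries s t (fun k => mpow F k *m mbinom (a + c%:M) k)
         + t ^+ s.+1 *: (mpow F s.+1 *m mbinom (a + (c - 1)%:M) s)).
Proof.
pose L' k := mpow F k *m mbinom (a + (c - 1)%:M) k.
have -> : (1%:M + t *: F) *m e0 = e0 *m (1%:M + t *: F).
  by rewrite mulmxDl mulmxDr mul1mx mulmx1 -scalemxAl -scalemxAr Fe0.
rewrite mulmxA; have -> : mseries s t (gauge_coef F) *m e0 = e0 *m mseries s t L'.
  rewrite /mseries mulmx_suml mulmx_sumr; apply: eq_bigr => j _.
  rewrite -scalemxAl -scalemxAr -mulmxA (mbinom_intertwine j he0) !mulmxA.
  by rewrite (mpow_comm j Fe0).
rewrite -mulmxA; congr (_ *m _); rewrite mulmxDr mulmx1.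
have L'F k : L' k *m F = mpow F k.+1 *m mbinom (a + (c - 1)%:M) k.
  rewrite /L' -mulmxA; have -> : mbinom (a + (c - 1)%:M) k *m F = F *m mbinom (a + (c - 1)%:M) k.
    by apply: mbinom_comm; rewrite Fab.
  by rewrite mulmxA -mpowSr.
have acc : a + c%:M = a + (c - 1)%:M + 1%:M.
  by rewrite -addrA -raddfD /= subrK.
have step k : L' k.+1 + L' k *m F = mpow F k.+1 *m mbinom (a + c%:M) k.+1.
  by rewrite L'F acc mbinom_pascal mulmxDr.
rewrite -scalemxAr {1}/mseries big_ord_recl /mseries mulmx_suml scaler_sumr.
have E : t *: ((t ^+ s *: L' s) *m F) = t ^+ s.+1 *: (mpow F s.+1 *m mbinom (a + (c - 1)%:M) s).
  by rewrite -scalemxAl L'F scalerA -exprS.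
rewrite big_ord_recr /= E.
have -> : \sum_(i < s) (t *: (t ^+ i *: L' i *m F)) =
   \sum_(i < s) t ^+ i.+1 *: (L' i *m F).
  by apply: eq_bigr => i _; rewrite -scalemxAl scalerA exprS.
rewrite addrA; congr (_ + _); rewrite -addrA -big_split big_ord_recl; congr (_ + _).
apply: eq_bigr => i _ /=; rewrite -scalerDr /bump /= add1n; congr (_ *: _).
exact: step.
Qed.

(** Formally G = (1 + t F)^(c h) satisfies G (e + (1 + t F) e0) = (1 + t F)^c (e + e0) G, because
    the shifts c and c - 1 caused by e and e0 differ by exactly the power of 1 + t F in front of e0.
    Truncation adds the multiple of t^(s+1). *)
Lemma gauge_identity s t (lam : C) :
  mseries s t (gauge_coef F) *m
    (lam *: mseries s t (root_coef F) - (e + (1%:M + t *: F) *m e0)) =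
  mseries s t (root_coef F) *m (lam%:M - (e + e0)) *m mseries s t (gauge_coef F)
  + t ^+ s.+1 *: gauge_rem s t F.
Proof.
set L := mseries s t (gauge_coef F); set Q := mseries s t (root_coef F).
have Qe : Q *m (e + e0) = (e + e0) *m Q.
  apply: mseries_comm => j; rewrite /root_coef -scalemxAl -scalemxAr; congr (_ *: _).
  by rewrite mpow_comm // mulmxDl mulmxDr Fe Fe0.
rewrite mulmxBr -scalemxAr mulmxDr gauge_e gauge_e0 mulmxBr mul_mx_scalar Qe mulmxBl.
rewrite -[(e + e0) *m Q *m L]mulmxA root_gauge_mul -root_gauge_comm -scalemxAl.
rewrite /gauge_rem -/L; set T := mtail _ _ _ _; set M := mseries _ _ _.
rewrite root_gauge_mul -/T -/M.
rewrite !mulmxDr !mulmxDl -!scalemxAr.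
move: (e *m M) (e0 *m M) (e *m T) (e0 *m T) (e0 *m (mpow F s.+1 *m _)).
by move=> ? ? ? ? ?; mxring.
Qed.

End GaugeIdentity.

(** * Decay orders uniform in the parameter *)

Section BigO.
Variable R : realType.
Local Notation C := R[i].
Local Notation Re := (@complex.Re R).
Variables (I : Type) (dom : I -> C -> Prop).
Hypothesis dom_ge0 : forall F v, dom F v -> 0 <= Re v.

(** Since v is logarithmic, a is the power of 1 / |z|. The constant K is uniform over the index F
    too, and the continuity in the parameter matrix rests on that. *)
Definition bigO m n (a : R) (G : I -> C -> 'M[C]_(m, n)) :=
  exists2 K : R, 0 <= K & forall F v, dom F v -> nm (G F v) <= K * expR (- (a * Re v)).

Lemma bigO_ext m n a (G H : I -> C -> 'M[C]_(m, n)) :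
  bigO a G -> (forall F v, dom F v -> H F v = G F v) -> bigO a H.
Proof. by move=> [K K0 HK] E; exists K => // F v d; rewrite E // HK. Qed.

Lemma bigO_le m n a b (G : I -> C -> 'M[C]_(m, n)) : a <= b -> bigO b G -> bigO a G.
Proof.
move=> ab [K K0 H]; exists K => // F v d; apply: le_trans (H F v d) _.
by rewrite ler_wpM2l // ler_expR lerN2 ler_wpM2r // (dom_ge0 d).
Qed.

Lemma bigOD m n a (G H : I -> C -> 'M[C]_(m, n)) :
  bigO a G -> bigO a H -> bigO a (fun F v => G F v + H F v).
Proof.
move=> [K K0 HK] [L L0 HL]; exists (K + L); rewrite ?addr_ge0 // => F v d.
by rewrite mulrDl; apply: le_trans (nmD _ _) (lerD (HK F v d) (HL F v d)).
Qed.

Lemma bigON m n a (G : I -> C -> 'M[C]_(m, n)) : bigO a G -> bigO a (fun F v => - G F v).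
Proof. by move=> [K K0 HK]; exists K => // F v d; rewrite nmN HK. Qed.

Lemma bigOB m n a (G H : I -> C -> 'M[C]_(m, n)) :
  bigO a G -> bigO a H -> bigO a (fun F v => G F v - H F v).
Proof. by move=> HG /bigON; exact: bigOD. Qed.

Lemma bigOM m n p a b (G : I -> C -> 'M[C]_(m, n)) (H : I -> C -> 'M[C]_(n, p)) :
  bigO a G -> bigO b H -> bigO (a + b) (fun F v => G F v *m H F v).
Proof.
move=> [K K0 HK] [L L0 HL]; exists (K * L); rewrite ?mulr_ge0 // => F v d.
rewrite mulrDl opprD expRD mulrACA; apply: le_trans (nmM _ _) _.
by apply: ler_pM; rewrite ?nm_ge0 ?HK ?HL.
Qed.

Lemma bigO_cst m n (A : 'M[C]_(m, n)) : bigO 0 (fun _ _ => A).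
Proof. by exists (nm A); rewrite ?nm_ge0 // => F v _; rewrite mul0r oppr0 expR0 mulr1. Qed.

Lemma bigOZ m n a b (k : R) (x : I -> C -> C) (G : I -> C -> 'M[C]_(m, n)) :
  0 <= k -> (forall F v, dom F v -> cabs (x F v) <= k * expR (- (a * Re v))) ->
  bigO b G -> bigO (a + b) (fun F v => x F v *: G F v).
Proof.
move=> k0 Hx [K K0 HK]; exists (k * K); rewrite ?mulr_ge0 // => F v d.
rewrite mulrDl opprD expRD mulrACA nmZ.
by apply: ler_pM; rewrite ?nm_ge0 ?cabs_ge0 ?HK ?Hx.
Qed.

Lemma bigOZc m n b (x : C) (G : I -> C -> 'M[C]_(m, n)) :
  bigO b G -> bigO b (fun F v => x *: G F v).
Proof.
move=> HG; rewrite -[b]add0r; apply: (@bigOZ _ _ 0 b (cabs x) (fun _ _ => x)) => //.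
  exact: cabs_ge0.
by move=> F v _; rewrite mul0r oppr0 expR0 mulr1.
Qed.

Lemma bigO_sum m n a (T : Type) (r : seq T) (P : pred T) (G : T -> I -> C -> 'M[C]_(m, n)) :
  (forall i, P i -> bigO a (G i)) -> bigO a (fun F v => \sum_(i <- r | P i) G i F v).
Proof.
move=> HG; elim: r => [|i r IH].
  by exists 0 => // F v _; rewrite big_nil nm0 mul0r.
case: (boolP (P i)) => Pi; last first.
  by apply: bigO_ext IH _ => F v _; rewrite big_cons (negbTE Pi).
by apply: bigO_ext (bigOD (HG i Pi) IH) _ => F v _; rewrite big_cons Pi.
Qed.

Lemma bigO_small m n a (G : I -> C -> 'M[C]_(m, n)) eps : 0 < a -> 0 < eps -> bigO a G ->
  exists V : R, forall F v, dom F v -> V <= Re v -> nm (G F v) <= eps.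
Proof.
move=> a0 e0 [K K0 HK]; exists (a^-1 * (K / eps)) => F v d Vv.
apply: le_trans (HK F v d) _.
have H : K / eps <= expR (a * Re v).
  apply: le_trans (expR_ge1Dx _); apply: (@le_trans _ _ (a * Re v)); last by rewrite lerDr.
  by rewrite -ler_pdivrMl.
rewrite expRN ler_pdivrMr ?expR_gt0 //.
by rewrite -ler_pdivrMl // mulrC.
Qed.

End BigO.

(** * The equation in the logarithmic variable and its full gauge *)

Section Gauge.
Variable R : realType.
Local Notation C := R[i].
Local Notation Re := (@complex.Re R).
Variables (N : nat) (e e0 h X D : 'M[C]_N) (c : C) (lam nu : R) (s : nat).
Hypothesis he : (c *: h) *m e = e *m (c *: h + c%:M).
Hypothesis he0 : (c *: h) *m e0 = e0 *m (c *: h + (c - 1)%:M).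
Hypothesis HX : (e + e0) *m X - X *m (e + e0) = D.
Hypothesis nu0 : 0 < nu.

Let B : 'M[C]_N := lam%:C%:M - (e + e0).

Definition tpow (v : C) : C := cexp (- nu%:C * v).
Definition Lg (F : 'M[C]_N) v := mseries s (tpow v) (gauge_coef h c F).
Definition Qg (F : 'M[C]_N) v := mseries s (tpow v) (root_coef c F).

(** The coefficient matrix of the equation for y, with z = exp v and u = [tpow v]; the factor 1 / (M
    + 1) is absorbed in e, e0, D and lam when the section is instantiated. *)
Definition Cv F v : 'M[C]_N :=
  cexp v *: (lam%:C *: Qg F v - (e + (1%:M + tpow v *: F) *m e0)) + D.

Definition GL F v : 'M[C]_N := (1%:M - cexp (- v) *: X) *m Lg F v.

Definition dLg (F : 'M[C]_N) v : 'M[C]_N :=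
  \sum_(j < s.+1) (- (nu * j%:R)%:C * tpow v ^+ j) *: gauge_coef h c F j.

Definition dGL F v : 'M[C]_N :=
  (cexp (- v) *: X) *m Lg F v + (1%:M - cexp (- v) *: X) *m dLg F v.

Definition Rem F v : 'M[C]_N :=
  cexp (- v) *: dGL F v
  + tpow v ^+ s.+1 *: ((1%:M - cexp (- v) *: X) *m gauge_rem e e0 h c s (tpow v) F)
  + cexp (- v) *: (Lg F v *m D - Qg F v *m D *m Lg F v)
  - cexp (- v) ^+ 2 *: (X *m Lg F v *m D).

Lemma tpowX v j : tpow v ^+ j = cexp (- (nu * j%:R)%:C * v).
Proof.
rewrite /tpow -cexpX; congr cexp.
rewrite rmorphM /= rmorph_nat; ring.
Qed.

Lemma mder_Lg F v : mder (Lg F) v (dLg F v).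
Proof.
rewrite /dLg; apply: (mder_ext (F := fun v => \sum_(j < s.+1) cexp (- (nu * j%:R)%:C * v) *: gauge_coef h c F j)).
  by move=> w; apply: eq_bigr => j _; rewrite tpowX.
apply: mder_eq (mder_sum _ (fun j : 'I_s.+1 => mderZl (gauge_coef h c F j) (cder_cexpZ (- (nu * j%:R)%:C) v))) _.
by apply: eq_bigr => j _; rewrite tpowX.
Qed.

Lemma mder_GL F v : mder (GL F) v (dGL F v).
Proof.
apply: mderM (mder_Lg F v).
have H : cder (fun w : C => cexp (- w)) v (- cexp (- v)).
  have := cder_cexpZ (-1 : C) v; rewrite !mulN1r.
  by have -> : (fun w : C => cexp (-1 * w)) = (fun w => cexp (- w)) by apply/funext => w; rewrite mulN1r.
apply: mder_eq (mderB (mder_const 1%:M v) (mderZl X H)) _.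
by rewrite sub0r scaleNr opprK.
Qed.

Variable F : 'M[C]_N.
Hypothesis Fe : F *m e = e *m F.
Hypothesis Fe0 : F *m e0 = e0 *m F.
Hypothesis Fh : F *m h = h *m F.
Hypothesis FX : F *m X = X *m F.

Lemma Qg_comm v G : F *m G = G *m F -> Qg F v *m G = G *m Qg F v.
Proof.
move=> FG; apply: mseries_comm => j; rewrite /root_coef -scalemxAl -scalemxAr.
by rewrite (mpow_comm j FG).
Qed.

(** Since B X = X B - D, moving 1 - X / z across Q B creates Q D L / z, which cancels L D / z up to
    the deviations of Q and L from 1. The order-one term D of the equation, not integrable in v, is
    thereby removed. *)
Lemma gauge_transform v :
  dGL F v + GL F v *m Cv F v = cexp v *: (Qg F v *m B *m GL F v + Rem F v).
Proof.
set x := cexp (- v); have xv : cexp v * x = 1 by rewrite /x cexpNr.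
have G := gauge_identity he he0 Fe Fe0 Fh s (tpow v) lam%:C.
rewrite -/(Lg F v) -/(Qg F v) -/B in G.
set L := Lg F v in G *; set Q := Qg F v in G *.
set Rm := gauge_rem _ _ _ _ _ _ _ in G.
have QX : Q *m X = X *m Q by exact: Qg_comm.
have BX : B *m X = X *m B - D.
  by rewrite /B mulmxBl mulmxBr scalar_mxC -HX; move: (lam%:C%:M *m X) ((e + e0) *m X) (X *m (e + e0)) => ? ? ?; mxring.
have E1 : GL F v *m Cv F v = cexp v *: (Q *m B *m L - x *: (X *m (Q *m B *m L)) +
   tpow v ^+ s.+1 *: ((1%:M - x *: X) *m Rm)) + (L *m D - x *: (X *m L *m D)).
  rewrite /GL /Cv -/x -/L -/Q mulmxDr -scalemxAr -[_ *m L *m (_ - _)]mulmxA G.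
  congr (_ *: _ + _).
    by rewrite mulmxDr -scalemxAr mulmxBl mul1mx -scalemxAl.
  by rewrite mulmxBl mul1mx mulmxBl -scalemxAl -scalemxAl.
have E2 : Q *m B *m GL F v = Q *m B *m L - x *: (X *m (Q *m B *m L)) + x *: (Q *m D *m L).
  rewrite /GL -/x -/L mulmxBl mul1mx mulmxBr; rewrite -scalemxAl -scalemxAr.
  have -> : Q *m B *m (X *m L) = X *m (Q *m B *m L) - Q *m D *m L.
    rewrite !mulmxA -[Q *m B *m X]mulmxA BX mulmxBr mulmxBl; congr (_ *m L - _).
    by rewrite mulmxA QX -mulmxA.
  by rewrite scalerBr opprB addrA addrAC.
rewrite E1 E2 /Rem -/x -/L -/Q -/Rm.
have xE : x = (cexp v)^-1 by rewrite cexpV.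
have v0 : cexp v != 0 := cexp_neq0 v.
clear E1 E2 BX QX G xv; move: (x) (cexp v) xE v0 => y z yE z0.
move: (dGL F v) (Q *m B *m L) (X *m (Q *m B *m L)) ((1%:M - y *: X) *m Rm) (L *m D)
  (X *m L *m D) (Q *m D *m L) (tpow v ^+ s.+1) => ? ? ? ? ? ? ? ?.
by apply/matrixP => i j; rewrite !mxE yE; field.
Qed.

End Gauge.

Section GaugeEstimates.
Variable R : realType.
Local Notation C := R[i].
Local Notation Re := (@complex.Re R).
Variables (N : nat) (e e0 h X D : 'M[C]_N) (c : C) (nu : R) (s : nat).
Hypothesis nu0 : 0 < nu.
Variables (rho : R) (dom : 'M[C]_N -> C -> Prop).
Hypothesis dom_ge0 : forall F v, dom F v -> 0 <= Re v.
Hypothesis dom_rho : forall F v, dom F v -> nm F <= rho.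
Hypothesis rho0 : 0 <= rho.

Local Notation O := (bigO dom).

Lemma bigO_mpow j : O 0 (fun F _ => mpow F j).
Proof.
elim: j => [|j IH]; first exact: bigO_cst.
rewrite -[0]addr0; apply: bigOM IH; exists rho => // F v d.
by rewrite mul0r oppr0 expR0 mulr1 (dom_rho d).
Qed.

Lemma cabs_tpow v j : cabs (tpow nu v ^+ j) = expR (- (j%:R * nu * Re v)).
Proof.
by rewrite tpowX cabs_cexp -rmorphN ReRM /=; congr expR; ring.
Qed.

Lemma bigO_tpow m n j b (G : 'M[C]_N -> C -> 'M[C]_(m, n)) : O b G ->
  O (j%:R * nu + b) (fun F v => tpow nu v ^+ j *: G F v).
Proof. by apply: (@bigOZ _ _ _ _ _ _ _ 1) => // F v _; rewrite cabs_tpow mul1r. Qed.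

Lemma bigO_cexpN m n b (G : 'M[C]_N -> C -> 'M[C]_(m, n)) : O b G ->
  O (1 + b) (fun F v => cexp (- v) *: G F v).
Proof.
apply: (@bigOZ _ _ _ _ _ _ _ 1) => // F v _.
by rewrite cabs_cexp ReN !mul1r.
Qed.

Lemma bigO_gauge_coef j : O 0 (fun F _ => gauge_coef h c F j).
Proof. by rewrite -[0]addr0; apply: bigOM (bigO_mpow j) (bigO_cst _ _). Qed.

Lemma bigO_root_coef j : O 0 (fun F _ => root_coef c F j).
Proof. exact: bigOZc (bigO_mpow j). Qed.

Lemma bigO_mseries_sub1 (u : 'M[C]_N -> nat -> 'M[C]_N) :
  (forall j, O 0 (fun F _ => u F j)) -> (forall F, u F 0 = 1%:M) ->
  O nu (fun F v => mseries s (tpow nu v) (u F) - 1%:M).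
Proof.
move=> Hu u0; apply: (bigO_ext (G := fun F v => \sum_(j < s) tpow nu v ^+ j.+1 *: u F j.+1)).
  apply: bigO_sum => j _; apply: (bigO_le dom_ge0 _ (bigO_tpow j.+1 (Hu j.+1))).
  by rewrite addr0 ler_peMl ?ler1n // ltW.
by move=> F v _; rewrite /mseries big_ord_recl u0 expr0 scale1r addrC addKr.
Qed.

Lemma bigO_Lg1 : O nu (fun F v => Lg h c nu s F v - 1%:M).
Proof.
apply: bigO_mseries_sub1 => [j|F]; first exact: bigO_gauge_coef.
by rewrite /gauge_coef mul1mx.
Qed.

Lemma bigO_Qg1 : O nu (fun F v => Qg c nu s F v - 1%:M).
Proof.
apply: bigO_mseries_sub1 => [j|F]; first exact: bigO_root_coef.
by rewrite /root_coef gbinom0 scale1r.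
Qed.

Lemma bigO_of_sub1 a (G : 'M[C]_N -> C -> 'M[C]_N) : 0 <= a ->
  O a (fun F v => G F v - 1%:M) -> O 0 G.
Proof.
move=> a0 H; apply: (bigO_ext (G := fun F v => (G F v - 1%:M) + 1%:M)).
  by apply: bigOD; [exact: (bigO_le dom_ge0 a0 H)|exact: bigO_cst].
by move=> F v _; rewrite subrK.
Qed.

Lemma bigO_Lg : O 0 (Lg h c nu s).
Proof. exact: bigO_of_sub1 (ltW nu0) bigO_Lg1. Qed.

Lemma bigO_Qg : O 0 (Qg c nu s).
Proof. exact: bigO_of_sub1 (ltW nu0) bigO_Qg1. Qed.

Lemma bigO_dLg : O nu (dLg h c nu s).
Proof.
apply: (bigO_ext (G := fun F v => \sum_(j < s) - (nu * j.+1%:R)%:C *: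
     (tpow nu v ^+ j.+1 *: gauge_coef h c F j.+1))).
  apply: bigO_sum => j _; apply: bigOZc.
  apply: (bigO_le dom_ge0 _ (bigO_tpow j.+1 (bigO_gauge_coef j.+1))).
  by rewrite addr0 ler_peMl ?ler1n // ltW.
move=> F v _; rewrite /dLg big_ord_recl mulr0 oppr0 mul0r scale0r add0r.
by apply: eq_bigr => j _; rewrite scalerA.
Qed.

Lemma bigO_gauge_factor : O 0 (fun (_ : 'M[C]_N) v => 1%:M - cexp (- v) *: X).
Proof.
apply: bigOB; first exact: bigO_cst.
by apply: (bigO_le dom_ge0 _ (bigO_cexpN (bigO_cst _ X))); rewrite addr0.
Qed.

Lemma bigO_GL1 : O (Num.min 1 nu) (fun F v => GL h X c nu s F v - 1%:M).
Proof.
apply: (bigO_ext (G := fun F v => (Lg h c nu s F v - 1%:M) - cexp (- v) *: (X *m Lg h c nu s F v))).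
  apply: bigOB.
    by apply: (bigO_le dom_ge0 _ bigO_Lg1); rewrite ge_min lexx orbT.
  have H : O (1 + (0 + 0)) (fun F v => cexp (- v) *: (X *m Lg h c nu s F v)).
    by apply: bigO_cexpN; apply: bigOM bigO_Lg; exact: bigO_cst.
  by apply: (bigO_le dom_ge0 _ H); rewrite !addr0 ge_min lexx.
by move=> F v _; rewrite /GL mulmxBl mul1mx -scalemxAl addrAC.
Qed.

Lemma bigO_dGL : O (Num.min 1 nu) (dGL h X c nu s).
Proof.
apply: bigOD.
  have H : O (1 + 0 + 0) (fun F v => (cexp (- v) *: X) *m Lg h c nu s F v).
    by apply: bigOM bigO_Lg; apply: bigO_cexpN; exact: bigO_cst.
  by apply: (bigO_le dom_ge0 _ H); rewrite !addr0 ge_min lexx.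
by apply: (bigO_le dom_ge0 _ (bigOM bigO_gauge_factor bigO_dLg)); rewrite add0r ge_min lexx orbT.
Qed.

Lemma bigO_gauge_rem : O 0 (fun F v => gauge_rem e e0 h c s (tpow nu v) F).
Proof.
apply: bigOB.
  rewrite -[0]addr0; apply: bigOM; first exact: bigO_cst.
  apply: bigO_sum => i _; apply: bigO_sum => j _.
  apply: (bigO_le dom_ge0 _ (bigO_tpow _ (bigOM (bigO_root_coef i) (bigO_gauge_coef j)))).
  by rewrite !addr0 mulr_ge0 // ltW.
rewrite -[0]addr0; apply: bigOM; first exact: bigO_cst.
by rewrite -[0]addr0; apply: bigOM (bigO_mpow _) (bigO_cst _ _).
Qed.

(** The decay rate in v of z [Rem]: min(1, nu) comes from the derivative of the gauge, (s+1) nu - 1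
    from the truncation; the two remaining terms of [Rem] decay at least as fast as the first. *)
Definition gain : R := Num.min (Num.min 1 nu) (s.+1%:R * nu - 1).

Lemma bigO_Rem : O (1 + gain) (Rem e e0 h X D c nu s).
Proof.
have g1 : gain <= Num.min 1 nu by rewrite ge_min lexx.
have g2 : gain <= 1 by rewrite (le_trans g1) // ge_min lexx.
have g3 : gain <= nu by rewrite (le_trans g1) // ge_min lexx orbT.
have g4 : 1 + gain <= s.+1%:R * nu by rewrite -lerBrDl ge_min lexx orbT.
apply: bigOB; first apply: bigOD; first apply: bigOD.
- by apply: (bigO_le dom_ge0 _ (bigO_cexpN bigO_dGL)); rewrite lerD2l.
- apply: (bigO_le dom_ge0 _ (bigO_tpow s.+1 (bigOM bigO_gauge_factor bigO_gauge_rem))).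
  by rewrite !addr0.
- have H : O nu (fun F v => Lg h c nu s F v *m D - Qg c nu s F v *m D *m Lg h c nu s F v).
    apply: (bigO_ext (G := fun F v => (Lg h c nu s F v - 1%:M) *m D
      - (Qg c nu s F v - 1%:M) *m (D *m Lg h c nu s F v) - D *m (Lg h c nu s F v - 1%:M))).
      apply: bigOB; first apply: bigOB.
      + by apply: (bigO_le dom_ge0 _ (bigOM bigO_Lg1 (bigO_cst _ D))); rewrite addr0.
      + apply: (bigO_le dom_ge0 _ (bigOM bigO_Qg1 (bigOM (bigO_cst _ D) bigO_Lg))).
        by rewrite !addr0.
      + by apply: (bigO_le dom_ge0 _ (bigOM (bigO_cst _ D) bigO_Lg1)); rewrite add0r.
    move=> F v _; rewrite !mulmxBl !mulmxBr !mul1mx mulmx1 mulmxA.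
    by move: (_ *m D) (D *m _) (_ *m _ *m _) => ? ? ?; mxring.
  by apply: (bigO_le dom_ge0 _ (bigO_cexpN H)); rewrite lerD2l.
- have H : O (1 + (1 + (0 + 0 + 0))) (fun F v => cexp (- v) *: (cexp (- v) *: (X *m Lg h c nu s F v *m D))).
    do 2!apply: bigO_cexpN; apply: bigOM (bigO_cst _ _).
    by apply: bigOM bigO_Lg; exact: bigO_cst.
  apply: (bigO_ext (bigO_le dom_ge0 _ H)).
    by rewrite !addr0 lerD2l.
  by move=> F v _; rewrite scalerA expr2.
Qed.

End GaugeEstimates.

(** * Energy estimates *)

Section Energy.
Variable R : realType.
Local Notation C := R[i].
Local Notation Re := (@complex.Re R).
Local Notation Im := (@complex.Im R).

Lemma ip_col_mx m1 m2 n (A1 B1 : 'M[C]_(m1, n)) (A2 B2 : 'M[C]_(m2, n)) :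
  ip (col_mx A1 A2) (col_mx B1 B2) = ip A1 B1 + ip A2 B2.
Proof.
rewrite /ip big_split_ord /=; congr (_ + _); apply: eq_bigr => i _; apply: eq_bigr => j _.
  by rewrite !col_mxEu.
by rewrite !col_mxEd.
Qed.

Lemma ip_self_line m n (F : C -> 'M[C]_(m, n)) a b t L :
  mder F (a + t%:C * b) L ->
  rder (fun t => ip (F (a + t%:C * b)) (F (a + t%:C * b))) t
       (2 * ip (F (a + t%:C * b)) (b *: L)).
Proof.
move=> dF eps e0; set V := F (a + t%:C * b).
have e4 : 0 < eps / 4 by rewrite divr_gt0.
have [d1 d10 H1] := ip_line V dF e4.
have [d2 d20 H2] := mder_lip dF.
pose K : R := 1 + ((1 + nm L) * cabs b) ^+ 2.
have K0 : 0 < K by rewrite /K ltr_wpDr // sqr_ge0.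
have b0 : 0 < 1 + cabs b by rewrite ltr_wpDr ?cabs_ge0.
exists (Num.min (Num.min d1 (d2 / (1 + cabs b))) (eps / (2 * K))).
  by rewrite !lt_min d10 !divr_gt0 // mulr_gt0.
move=> x; rewrite !lt_min => /andP[/andP[xd1 xd2] xe].
have xb : cabs (x%:C * b) < d2.
  rewrite cabsM cabsR; move: xd2; rewrite ltr_pdivlMr //; apply: le_lt_trans.
  by rewrite mulrDr mulr1 lerDr.
have I1 := H1 x xd1; have I2 := H2 _ xb; move: I1 I2.
have -> : a + (t + x)%:C * b = a + t%:C * b + x%:C * b by rewrite rmorphD /=; ring.
set V' := F (a + t%:C * b + x%:C * b); rewrite -/V => I1 I2.
have -> : ip V' V' - ip V V - x * (2 * ip V (b *: L)) =
  2 * (ip V V' - ip V V - x * ip V (b *: L)) + ip (V' - V) (V' - V).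
  by rewrite !ipBl !ipBr (ipC V' V); ring.
apply: le_trans (ler_normD _ _) _; rewrite normrM ger0_norm //.
have J : `|ip (V' - V) (V' - V)| <= eps / 2 * `|x|.
  apply: le_trans (ip_le _ _) _; rewrite -expr2.
  apply: (@le_trans _ _ (((1 + nm L) * cabs (x%:C * b)) ^+ 2)).
    by rewrite ler_sqr ?nnegrE ?nm_ge0 // ?mulr_ge0 ?addr_ge0 ?nm_ge0 ?cabs_ge0.
  rewrite cabsM cabsR; have -> : ((1 + nm L) * (`|x| * cabs b)) ^+ 2 =
    ((1 + nm L) * cabs b) ^+ 2 * `|x| * `|x| by ring.
  rewrite ler_wpM2r //; apply: (@le_trans _ _ (K * `|x|)).
    by rewrite ler_wpM2r // lerDr.
  by move: xe; rewrite ltr_pdivlMr ?mulr_gt0 // => /ltW; lra.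
lra.
Qed.

Variables (N : nat) (e e0 h X D P Q0 Q1 : 'M[C]_N) (c : C) (lam nu rho c0 : R) (s : nat).

Local Notation B := (lam%:C%:M - (e + e0)).

(** The parameter is kept a matrix commuting with the data, so that the same estimates serve the
    scalar - E and the block matrix used for differentiation in E. *)
Definition adm (F : 'M[C]_N) : Prop :=
  [/\ F *m e = e *m F, F *m e0 = e0 *m F, F *m h = h *m F, F *m X = X *m F & F *m P = P *m F].

Definition system_data : Prop :=
  [/\ (c *: h) *m e = e *m (c *: h + c%:M), (c *: h) *m e0 = e0 *m (c *: h + (c - 1)%:M),
     (e + e0) *m X - X *m (e + e0) = D, 0 < nu & 1 < s.+1%:R * nu] /\
  [/\ B *m P = 0, P *m B = 0, (forall v : 'cV[C]_N, B *m v = 0 -> P *m v = v),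
     Q1 *m Q0 = 1%:M & 0 < c0 /\ (forall v : 'cV[C]_N, P *m v = 0 ->
       c0 * ip (Q0 *m v) (Q0 *m v) <= ip (Q0 *m v) (Q0 *m (B *m v)))].

Definition dom (F : 'M[C]_N) (v : C) : Prop := [/\ adm F, nm F <= rho & 0 <= Re v].

Hypothesis SD : system_data.
Hypothesis rho0 : 0 <= rho.

Local Notation Qg := (Qg c nu s).
Local Notation GL := (GL h X c nu s).
Local Notation Rem := (Rem e e0 h X D c nu s).
Local Notation Cv := (Cv e e0 D c lam nu s).
Local Notation gain := (gain nu s).

Lemma dom_ge0 F v : dom F v -> 0 <= Re v. Proof. by case. Qed.
Lemma dom_rho F v : dom F v -> nm F <= rho. Proof. by case. Qed.

Lemma gain_gt0 : 0 < gain.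
Proof. by case: SD => -[_ _ _ n0 sn] _; rewrite !lt_min ltr01 n0 subr_gt0. Qed.

(** An injective map that separates the part of a vector off the kernel of B, in the Lyapunov basis,
    from its kernel part. The energy is the square length of the image. *)
Definition Wm : 'M[C]_(N + N, N) := col_mx (Q0 *m (1%:M - P)) P.

Lemma Wm_inv : row_mx Q1 1%:M *m Wm = 1%:M.
Proof.
case: SD => _ [_ _ _ QQ _].
by rewrite /Wm mul_row_col mulmxA QQ !mul1mx subrK.
Qed.

Lemma nm_le_Wm n : exists2 k : R, 0 <= k & forall v : 'M[C]_(N, n), nm v <= k * nm (Wm *m v).
Proof.
exists (nm (row_mx Q1 1%:M : 'M[C]_(N, N + N))); first exact: nm_ge0.
move=> v; have {1}-> : v = row_mx Q1 1%:M *m (Wm *m v) by rewrite mulmxA Wm_inv mul1mx.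
exact: nmM.
Qed.

Lemma B_idem : P *m P = P.
Proof.
case: SD => _ [BP _ Pk _ _]; apply/trmx_inj/row_matrixP => i; rewrite -!tr_col; congr trmx.
by rewrite colE -mulmxA -colE Pk // colE mulmxA BP mul0mx.
Qed.

(* For b near 1 and large Re v, the perturbation b Q - 1 of the identity is absorbed by
   the strict positivity of the form on the range of B. *)
Lemma lyap_direction : exists kap V : R, [/\ 0 < kap, kap <= 2^-1 &
  forall F v b (r : 'cV[C]_N), dom F v -> V <= Re v -> cabs (b - 1) <= kap ->
    0 <= ip (Wm *m r) (Wm *m (b *: (Qg F v *m B *m r)))].
Proof.
case: SD => -[_ _ _ nu0 _] [BP PB _ QQ [c00 Hl]].
have [KQ KQ0 HQ] := bigO_Qg c s nu0 dom_ge0 dom_rho rho0.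
pose K := nm Q0 * nm B * nm Q1 * (N * 1)%:R ^+ 2.
have K0 : 0 <= K by rewrite !mulr_ge0 ?nm_ge0 ?exprn_ge0.
(* K is the loss caused by a perturbation of B in the form on Q0 u, so a relative perturbation of
   size [del] costs at most c0. *)
pose del := c0 / (K + 1).
have K1 : 0 < K + 1 by rewrite ltr_wpDl.
have del0 : 0 < del by rewrite divr_gt0.
have del2 : 0 < del / 2 by rewrite divr_gt0.
have [V HV] := bigO_small nu0 del2 (bigO_Qg1 c s nu0 dom_ge0 dom_rho rho0).
have KQ1 : 0 < KQ + 1 by rewrite ltr_wpDl.
exists (Num.min 2^-1 (del / 2 / (KQ + 1))), V; split.
- by rewrite lt_min invr_gt0 ltr0n /= divr_gt0.
- by rewrite ge_min lexx.
move=> F v b r dF Vv bk.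
have [[Fe Fe0 Fh FX FP] _ _] := dF.
have QP : Qg F v *m P = P *m Qg F v by exact: Qg_comm.
pose u := r - P *m r.
have Pu : P *m u = 0 by rewrite /u mulmxBr mulmxA B_idem subrr.
have Br : B *m r = B *m u by rewrite /u mulmxBr mulmxA BP mul0mx subr0.
pose z := b *: (Qg F v *m B *m r).
have Pz : P *m z = 0.
  by rewrite /z -scalemxAr !mulmxA -QP -(mulmxA _ P) PB mulmx0 mul0mx scaler0.
have W1 : Wm *m r = col_mx (Q0 *m u) (P *m r).
  by rewrite /Wm mul_col_mx -mulmxA mulmxBl mul1mx.
have W2 : Wm *m z = col_mx (Q0 *m z) 0.
  by rewrite /Wm mul_col_mx Pz -mulmxA mulmxBl mul1mx Pz subr0.
rewrite -/z W1 W2 ip_col_mx ip0r addr0.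
pose De := (b - 1) *: Qg F v + (Qg F v - 1%:M).
have nDe : nm De <= del.
  apply: le_trans (nmD _ _) _; rewrite nmZ [del]splitr; apply: lerD; last exact: HV.
  have Qb : nm (Qg F v) <= KQ by have := HQ F v dF; rewrite mul0r oppr0 expR0 mulr1.
  apply: (@le_trans _ _ (del / 2 / (KQ + 1) * (KQ + 1))); last by rewrite divfK // gt_eqF.
  apply: ler_pM; rewrite ?cabs_ge0 ?nm_ge0 //.
    by apply: le_trans bk _; rewrite ge_min lexx orbT.
  by apply: le_trans Qb _; rewrite lerDl.
have -> : z = B *m u + De *m (B *m u).
  rewrite /z -mulmxA Br; move: (B *m u) => w.
  rewrite /De mulmxDl mulmxBl mul1mx -scalemxAl.
  by move: (Qg F v *m _) => ?; mxring.
rewrite mulmxDr ipDr.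
have H1 := Hl u Pu.
have nu1 : nm u <= nm Q1 * nm (Q0 *m u).
  by rewrite -{1}[u]mul1mx -QQ -mulmxA nmM.
have H2 : `|ip (Q0 *m u) (Q0 *m (De *m (B *m u)))| <= c0 * ip (Q0 *m u) (Q0 *m u).
  apply: le_trans (ip_le _ _) _.
  apply: (@le_trans _ _ (nm (Q0 *m u) * (nm Q0 * (del * (nm B * (nm Q1 * nm (Q0 *m u))))))).
    apply: ler_wpM2l; first exact: nm_ge0.
    apply: le_trans (nmM _ _) _; apply: ler_wpM2l; first exact: nm_ge0.
    apply: le_trans (nmM _ _) _; apply: ler_pM; rewrite ?nm_ge0 //.
    by apply: le_trans (nmM _ _) _; apply: ler_wpM2l; rewrite ?nm_ge0.
  have -> : nm (Q0 *m u) * (nm Q0 * (del * (nm B * (nm Q1 * nm (Q0 *m u))))) =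
    del * (nm Q0 * nm B * nm Q1) * nm (Q0 *m u) ^+ 2 by ring.
  apply: (@le_trans _ _ (del * (nm Q0 * nm B * nm Q1) * ((N * 1)%:R ^+ 2 * ip (Q0 *m u) (Q0 *m u)))).
    apply: ler_wpM2l; last exact: nm_sqr_le.
    by apply: mulr_ge0; [exact: ltW|rewrite !mulr_ge0 ?nm_ge0].
  have -> : del * (nm Q0 * nm B * nm Q1) * ((N * 1)%:R ^+ 2 * ip (Q0 *m u) (Q0 *m u)) =
    del * K * ip (Q0 *m u) (Q0 *m u) by rewrite /K; ring.
  apply: ler_wpM2r; first exact: ip_ge0.
  rewrite /del mulrAC ler_pdivrMr //; apply: ler_wpM2l; first exact: ltW.
  by rewrite lerDl.
move: H2; rewrite ler_norml => /andP[H3 _].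
have := lerD H1 H3; rewrite subrr; exact.
Qed.

End Energy.

(** * Energy along nearly horizontal lines *)

Section EnergyEstimate.
Variable R : realType.
Local Notation C := R[i].
Local Notation Re := (@complex.Re R).
Local Notation Im := (@complex.Im R).

Lemma cabs_near1 (b : C) : cabs (b - 1) <= 2^-1 -> cabs b <= 3 / 2.
Proof. by have := cabsD (b - 1) 1; rewrite subrK cabs1; lra. Qed.

Lemma log_step (g l t x : R) : 0 <= 1 + g -> l - t <= x ->
  - ((1 + g) * x) <= (1 + g) * t + (- l - g * l).
Proof. by move=> g0 lx; have := ler_wpM2l g0 lx; lra. Qed.

Lemma le_double_of_half (x k : R) : x <= k + 2^-1 * x -> x <= 2 * k.
Proof. by lra. Qed.

Lemma cross_term_bound (k1 k2 a w m : R) : 0 <= k1 -> 0 <= k2 -> 0 <= m -> a ^+ 2 <= k2 * m ->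
  a * (k1 * a + w) <= (k1 + 1) * ((k2 + 1) * (m + w ^+ 2)).
Proof.
move=> k10 k20 m0 am.
have s1 : a * w <= a ^+ 2 + w ^+ 2.
  by have := sqr_ge0 (a - w); have := sqr_ge0 a; have := sqr_ge0 w; rewrite sqrrB; lra.
have s2 : a * (k1 * a + w) <= (k1 + 1) * (a ^+ 2 + w ^+ 2).
  by have := mulr_ge0 k10 (sqr_ge0 w); have := sqr_ge0 a; nra.
apply: le_trans s2 _; apply: ler_wpM2l; first by rewrite addr_ge0.
by have := mulr_ge0 k20 (sqr_ge0 w); nra.
Qed.

Lemma derivative_lower (i1 i2 A B : R) : 0 <= i1 -> - A <= i2 -> A * 2 <= B -> - B <= 2 * (i1 + i2).
Proof. by lra. Qed.

(** For t <= |z| / 4 the triangle inequality suffices; otherwise the real part is at least t / 2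
    while |z| + t < 5 t, whence the constant 10. *)
Lemma cone_bound (z b : C) t : 0 <= Re z -> cabs (b - 1) <= 2^-1 -> 0 <= t ->
  0 <= Re (z + t%:C * b) /\ (cabs z + t) / 10 <= cabs (z + t%:C * b).
Proof.
move=> z0 b1 t0.
have Rb : 2^-1 <= Re b.
  have := le_trans (Re_le_cabs (b - 1)) b1; rewrite ReD ReN /= ler_norml => /andP[]; lra.
have cb := cabs_near1 b1.
have E : Re (z + t%:C * b) = Re z + t * Re b by rewrite ReD ReRM.
have tb : t / 2 <= t * Re b by rewrite ler_wpM2l.
split; first by rewrite E; lra.
have [tz|zt] := leP t (cabs z / 4).
  have H : cabs z - cabs (t%:C * b) <= cabs (z + t%:C * b).
    exact: cabs_sub_ge.
  have : cabs (t%:C * b) <= 3 / 2 * t.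
    by rewrite cabsM cabsR ger0_norm // mulrC ler_wpM2r.
  have := cabs_ge0 z; lra.
have : Re (z + t%:C * b) <= cabs (z + t%:C * b).
  by apply: le_trans (Re_le_cabs _); exact: ler_norm.
rewrite E; lra.
Qed.

Lemma is_derive_log_power (r a K t : R) : 0 < r + t ->
  is_derive t 1 (fun t : R => K * expR (- (a * ln (r + t))))
    (- (K * a * (r + t)^-1 * expR (- (a * ln (r + t))))).
Proof.
move=> rt.
have d1 : is_derive t 1 (cst r + id) (0 + 1 : R).
  exact: (is_deriveD (is_derive_cst r t (1 : R)) (is_derive_id t (1 : R))).
have d2 : is_derive t 1 (@ln R \o (cst r + id)) ((r + t)^-1 * (0 + 1)).
  exact: (is_derive1_comp (is_derive1_ln rt) d1).
have d3 : is_derive t 1 ((- a) \*: (@ln R \o (cst r + id))) (- a *: ((r + t)^-1 * (0 + 1))).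
  exact: is_deriveZ.
have d4 := is_derive1_comp (is_derive_expR (((- a) \*: (@ln R \o (cst r + id))) t)) d3.
have d5 := is_deriveZ K d4.
have E : (fun t : R => K * expR (- (a * ln (r + t)))) =
   K \*: (@expR R \o ((- a) \*: (@ln R \o (cst r + id)))).
  by apply/funext => x; rewrite /= -![_ *: _]/(_ * _) mulNr.
rewrite E; apply: is_derive_eq d5 _.
by rewrite /= -![_ *: _]/(_ * _) mulNr add0r mulr1; ring.
Qed.

Variables (N : nat) (e e0 h X D P Q0 Q1 : 'M[C]_N) (c : C) (lam nu rho c0 : R) (s : nat).

Local Notation B := (lam%:C%:M - (e + e0)).
Hypothesis SD : system_data e e0 h X D P Q0 Q1 c lam nu c0 s.
Hypothesis rho0 : 0 <= rho.

Local Notation Qg := (Qg c nu s).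
Local Notation GL := (GL h X c nu s).
Local Notation Rem := (Rem e e0 h X D c nu s).
Local Notation Cv := (Cv e e0 D c lam nu s).
Local Notation gain := (gain nu s).
Local Notation Wm := (Wm P Q0).
Local Notation adm := (adm e e0 h X P).
Local Notation dom := (dom e e0 h X P rho).

(** A function of z with the logarithm inside, because the estimates follow straight lines in z, not
    in v. *)
Definition energy F (y : C -> 'cV[C]_N) (v : 'cV[C]_N) (z : C) : R :=
  let g := GL F (clog z) *m y (clog z) - v in ip (Wm *m g) (Wm *m g).

Lemma energy_deriv F (y : C -> 'cV[C]_N) v z : adm F -> slit_plane z -> B *m v = 0 ->
  (forall w, mder y w (Cv F w *m y w)) ->
  mder (fun z => Wm *m (GL F (clog z) *m y (clog z) - v)) z
    (Wm *m (Qg F (clog z) *m B *m (GL F (clog z) *m y (clog z) - v)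
            + Rem F (clog z) *m y (clog z))).
Proof.
move=> [Fe Fe0 Fh FX FP] sz Bv dy; have [[he he0 HX nu0 _] _] := SD.
set w := clog z.
have d1 : mder (fun w => GL F w *m y w) w (cexp w *: (Qg F w *m B *m GL F w *m y w + Rem F w *m y w)).
  apply: mder_eq (mderM (mder_GL _ _ _ _ _ F w) (dy w)) _.
  rewrite mulmxA -mulmxDl (gauge_transform lam nu s he he0 HX Fe Fe0 Fh FX).
  by rewrite -scalemxAl mulmxDl.
have d2 := mder_comp (cder_clog sz) d1.
have d3 := mder_mull Wm (mderB d2 (mder_const v z)).
apply: mder_eq d3 _; rewrite subr0 scalerA clogK // mulVf ?slit_neq0 // scale1r.
congr (_ *m (_ + _)).
by rewrite [RHS]mulmxBr -[X in _ = _ - X]mulmxA Bv mulmx0 subr0 [RHS]mulmxA.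
Qed.

(** Along the line the derivative of the energy is a nonnegative Lyapunov term plus a remainder of
    size (|z0| + t)^(-1 - gain) times energy + |v|^2. The integral of that rate is at most a
    multiple of |z0|^(- gain), whatever the length tau. *)
Lemma energy_estimate : exists K kap V : R, [/\ 0 <= K, 0 < kap, kap <= 2^-1, 0 <= V &
  forall F (y : C -> 'cV[C]_N) z0 b tau (v : 'cV[C]_N),
  adm F -> nm F <= rho -> 0 <= Re z0 -> expR V <= cabs z0 -> cabs (b - 1) <= kap ->
  0 <= tau -> B *m v = 0 -> (forall w, mder y w (Cv F w *m y w)) ->
  energy F y v z0 + nm v ^+ 2 <=
  (energy F y v (z0 + tau%:C * b) + nm v ^+ 2) * expR (K * expR (- (gain * ln (cabs z0))))].
Proof.
have [[_ _ _ nu0 _] _] := SD.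
have dg := @dom_ge0 R N e e0 h X P rho; have dr := @dom_rho R N e e0 h X P rho.
have g0 := gain_gt0 SD.
have [kap [V1 [kap0 kap2 Hly]]] := lyap_direction SD rho0.
have m0 : 0 < Num.min 1 nu by rewrite lt_min ltr01.
have h0 : 0 < (2^-1 : R) by rewrite invr_gt0.
have [V2 HGL] := bigO_small m0 h0 (bigO_GL1 h X c s nu0 dg dr rho0).
have [KR KR0 HR] := bigO_Rem e e0 h X D c s nu0 dg dr rho0.
have [k1 k10 Hk1] := nm_le_Wm SD 1.
pose k2 : R := ((N + N) * 1)%:R ^+ 2.
have k20 : 0 <= k2 by rewrite exprn_ge0.
pose K10 : R := expR ((1 + gain) * ln 10).
(* The 6 collects 2 from differentiating a square, 3 / 2 for |b| and 2 from inverting the gauge;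
   [K10] pays for the factor 10 of [cone_bound], and the last two factors come from
   [cross_term_bound]. *)
pose K' : R := 6 * nm Wm * KR * K10 * (k1 + 1) * (k2 + 1).
have K'0 : 0 <= K' by rewrite !mulr_ge0 ?nm_ge0 ?expR_ge0 ?addr_ge0.
pose V : R := Num.max 0 (Num.max V1 V2) + ln 10.
have ln10 : 0 <= ln 10 :> R by rewrite ln_ge0 // ler1n.
exists (K' / gain), kap, V; split=> //; first by rewrite divr_ge0 // ltW.
  by rewrite /V addr_ge0 // le_max lexx.
move=> F y z0 b tau v aF nF z00 Vz bk tau0 Bv dy.
set r := cabs z0 in Vz *.
have r0 : 0 < r by apply: lt_le_trans Vz; exact: expR_gt0.
have b2 : cabs (b - 1) <= 2^-1 := le_trans bk kap2.
have cone t : 0 <= t -> 0 <= Re (z0 + t%:C * b) /\ (r + t) / 10 <= cabs (z0 + t%:C * b).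
  by move=> t0; exact: cone_bound.
have pos t : 0 <= t -> 0 < (r + t) / 10 by move=> t0; rewrite divr_gt0 // ltr_wpDr.
have slit t : 0 <= t -> slit_plane (z0 + t%:C * b).
  move=> t0; have [c1 c2] := cone t t0; apply: slit_Re_ge0 => //.
  by rewrite -cabs_gt0; apply: lt_le_trans c2; exact: pos.
have Rlog t : 0 <= t -> ln (r + t) - ln 10 <= Re (clog (z0 + t%:C * b)).
  move=> t0; rewrite Re_clog -ln_div ?posrE ?ltr_wpDr //.
  have [_ c2] := cone t t0.
  by rewrite ler_ln ?posrE ?pos //; apply: lt_le_trans c2; exact: pos.
have Rbig t : 0 <= t -> Num.max 0 (Num.max V1 V2) <= Re (clog (z0 + t%:C * b)).
  move=> t0; apply: le_trans (Rlog t t0); rewrite lerBrDr -/V.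
  rewrite -[V]expRK ler_ln ?posrE ?expR_gt0 ?ltr_wpDr //.
  by apply: le_trans Vz _; rewrite lerDl.
have dF t : 0 <= t -> dom F (clog (z0 + t%:C * b)).
  move=> t0; split=> //; apply: le_trans (Rbig t t0); by rewrite le_max lexx.
pose G z := Wm *m (GL F (clog z) *m y (clog z) - v).
pose L z := Wm *m (Qg F (clog z) *m B *m (GL F (clog z) *m y (clog z) - v)
            + Rem F (clog z) *m y (clog z)).
pose m t := energy F y v (z0 + t%:C * b).
pose dm t := 2 * ip (G (z0 + t%:C * b)) (b *: L (z0 + t%:C * b)).
have Dm t : 0 <= t <= tau -> rder m t (dm t).
  move=> /andP[t0 _]; apply: (ip_self_line (F := G)).
  by apply: energy_deriv => //; exact: slit.
(* The comparison function K' / gain * (r + t)^(- gain) is a primitive of - K' (r + t)^(-1 -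
   gain). *)
have := @energy_bound R m dm (fun t => K' / gain * expR (- (gain * ln (r + t))))
  (fun t => - (K' / gain * gain * (r + t)^-1 * expR (- (gain * ln (r + t))))) 0 tau
  (nm v ^+ 2) tau0 Dm.
have -> : m 0 = energy F y v z0 by rewrite /m mul0r addr0.
rewrite addr0 => EB; apply: le_trans (EB _ _) _.
- move=> t /andP[t0 _]; apply: is_derive_log_power; by rewrite ltr_wpDr.
- move=> t /andP[t0 tt]; set z := z0 + t%:C * b.
  set g := GL F (clog z) *m y (clog z) - v.
  set a := nm (Wm *m g); set w := nm v.
  have ge1 : a ^+ 2 <= k2 * m t by exact: nm_sqr_le.
  have m_ge0 : 0 <= m t by exact: ip_ge0.
  have a0 : 0 <= a := nm_ge0 _; have w0 : 0 <= w := nm_ge0 _.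
  have ny : nm (y (clog z)) <= 2 * (k1 * a + w).
    have H1 : nm (GL F (clog z) - 1%:M) <= 2^-1.
      apply: HGL; first exact: dF.
      by apply: le_trans (Rbig t t0); rewrite !le_max lexx !orbT.
    have H2 : nm (GL F (clog z) *m y (clog z)) <= k1 * a + w.
      rewrite -[_ *m y _](subrK v); apply: le_trans (nmD _ _) _.
      by rewrite lerD2r; exact: Hk1.
    have H3 : nm (y (clog z)) <= nm (GL F (clog z) *m y (clog z)) + 2^-1 * nm (y (clog z)).
      have {1}-> : y (clog z) = GL F (clog z) *m y (clog z) - (GL F (clog z) - 1%:M) *m y (clog z).
        by rewrite mulmxBl mul1mx opprB addrC subrK.
      apply: le_trans (nmB _ _) _; rewrite lerD2l; apply: le_trans (nmM _ _) _.
      by rewrite ler_wpM2r ?nm_ge0.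
    exact: le_double_of_half (le_trans H3 (lerD H2 (lexx _))).
  have nR : nm (Rem F (clog z)) <= KR * K10 * ((r + t)^-1 * expR (- (gain * ln (r + t)))).
    apply: le_trans (HR F _ (dF t t0)) _; rewrite -[KR * K10 * _]mulrA; apply: ler_wpM2l => //.
    have rt0 : 0 < r + t by rewrite ltr_wpDr.
    have -> : (r + t)^-1 = expR (- ln (r + t)) by rewrite expRN lnK.
    rewrite /K10 -!expRD ler_expR.
    by apply: log_step (Rlog t t0); rewrite addr_ge0 // ltW.
  have split_ip : dm t = 2 * (ip (Wm *m g) (Wm *m (b *: (Qg F (clog z) *m B *m g)))
      + ip (Wm *m g) (b *: (Wm *m (Rem F (clog z) *m y (clog z))))).
    by rewrite /dm /L -/z -/g mulmxDr scalerDr ipDr /G -/g -scalemxAr.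
  have Ly : 0 <= ip (Wm *m g) (Wm *m (b *: (Qg F (clog z) *m B *m g))).
    apply: Hly => //; first exact: dF.
    by apply: le_trans (Rbig t t0); rewrite !le_max lexx !orbT.
  have cb := cabs_near1 b2.
  set q := (r + t)^-1 * expR (- (gain * ln (r + t))) in nR.
  have q0 : 0 <= q by rewrite mulr_ge0 ?expR_ge0 // invr_ge0 addr_ge0 // ltW.
  have J : `|ip (Wm *m g) (b *: (Wm *m (Rem F (clog z) *m y (clog z))))| <=
     a * (3 / 2 * (nm Wm * (KR * K10 * q * (2 * (k1 * a + w))))).
    apply: le_trans (ip_le _ _) _; apply: ler_wpM2l => //; rewrite nmZ.
    apply: ler_pM; rewrite ?cabs_ge0 ?nm_ge0 //.
    apply: le_trans (nmM _ _) _; apply: ler_wpM2l; rewrite ?nm_ge0 //.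
    by apply: le_trans (nmM _ _) _; apply: ler_pM; rewrite ?nm_ge0.
  have -> : - (K' / gain * gain * (r + t)^-1 * expR (- (gain * ln (r + t)))) = - (K' * q).
    by rewrite /q divfK ?gt_eqF // mulrA.
  rewrite mulNr split_ip.
  have J2 := cross_term_bound w k10 k20 m_ge0 ge1.
  have J3 : a * (3 / 2 * (nm Wm * (KR * K10 * q * (2 * (k1 * a + w))))) * 2 <= K' * q * (m t + w ^+ 2).
    have -> : a * (3 / 2 * (nm Wm * (KR * K10 * q * (2 * (k1 * a + w))))) * 2 =
      (6 * nm Wm * KR * K10 * q) * (a * (k1 * a + w)) by field.
    have -> : K' * q * (m t + w ^+ 2) = (6 * nm Wm * KR * K10 * q) * ((k1 + 1) * ((k2 + 1) * (m t + w ^+ 2))).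
      by rewrite /K'; ring.
    apply: ler_wpM2l => //; apply: mulr_ge0 => //.
    by rewrite !mulr_ge0 ?nm_ge0 ?expR_ge0.
  move: J; rewrite ler_norml => /andP[J _].
  exact: derivative_lower Ly J J3.
- apply: ler_wpM2l; first by rewrite addr_ge0 ?sqr_ge0 //; exact: ip_ge0.
  rewrite ler_expR gerBl; apply: mulr_ge0; last exact: expR_ge0.
  exact: divr_ge0 K'0 (ltW g0).
Qed.

End EnergyEstimate.

Section ScalarBounds.
Variable R : realType.

Lemma three_term_bound (p1 p2 p3 a1 a2 t : R) : p1 <= 2^-1 * (t / 3) -> p2 <= t / 3 ->
  p3 <= a1 -> a1 <= a2 -> a2 <= t / 2 -> p1 + p2 + p3 <= t.
Proof. lra. Qed.

Lemma energy_gap_bound (E0 E1 x u p g : R) : E0 + u <= x -> x <= (E1 + u) * (1 + p) ->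
  E1 * p <= E1 -> p * (u + 1) <= g / 2 -> E1 <= g / 4 -> 0 < p -> E0 <= g.
Proof. nra. Qed.

Lemma absorb_half (p g u x q : R) : p <= g + u + x -> x <= 2^-1 * p -> g <= q ->
  p <= 2 * (q + u).
Proof. lra. Qed.

Lemma two_term_bound (p x t u a th : R) : p <= a / 4 -> x <= t ->
  t <= th * (2 * (a / 4 + u)) -> th <= 2^-1 -> 0 < a -> th * (u + 1) <= a / 4 ->
  0 < th -> p + x <= a.
Proof. nra. Qed.

End ScalarBounds.

(** * Stability from infinity backwards *)

Section BackwardStability.
Variable R : realType.
Local Notation C := R[i].
Local Notation Re := (@complex.Re R).
Variables (N : nat) (e e0 h X D P Q0 Q1 : 'M[C]_N) (c : C) (lam nu rho c0 : R) (s : nat).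
Local Notation B := (lam%:C%:M - (e + e0)).
Hypothesis SD : system_data e e0 h X D P Q0 Q1 c lam nu c0 s.
Hypothesis rho0 : 0 <= rho.
Local Notation GL := (GL h X c nu s).
Local Notation Cv := (Cv e e0 D c lam nu s).
Local Notation gain := (gain nu s).
Local Notation Wm := (Wm P Q0).
Local Notation adm := (adm e e0 h X P).
Local Notation dom := (dom e e0 h X P rho).
Local Notation energy := (energy h X P Q0 c nu s).

Lemma expR_small (K a eps : R) : 0 <= K -> 0 < a -> 0 < eps ->
  exists V : R, forall x, V <= x -> K * expR (- (a * x)) <= eps.
Proof.
move=> K0 a0 e0'; exists (a^-1 * (K / eps)) => x Vx.
have H : K / eps <= expR (a * x).
  apply: le_trans (expR_ge1Dx _); apply: (@le_trans _ _ (a * x)); last by rewrite lerDr.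
  by rewrite -ler_pdivrMl.
by rewrite expRN ler_pdivrMr ?expR_gt0 // -ler_pdivrMl // mulrC.
Qed.

Lemma dom_clog F z V : adm F -> nm F <= rho -> 0 <= V -> 0 <= Re z -> expR V <= cabs z ->
  [/\ dom F (clog z), V <= Re (clog z) & slit_plane z].
Proof.
move=> aF nF V0 z0 Vz.
have c0' : 0 < cabs z by apply: lt_le_trans Vz; exact: expR_gt0.
have VR : V <= Re (clog z) by rewrite Re_clog -[V]expRK ler_ln ?posrE ?expR_gt0.
split=> //; first by split=> //; exact: le_trans V0 VR.
by apply: slit_Re_ge0 => //; rewrite -cabs_gt0.
Qed.

(** Beyond the system and rho, V and del depend only on v and eta, not on F, the solution, the
    starting point or the length of the line. This uniformity yields the Cauchy property, the limit
    in the half plane and the continuity in F. *)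
Lemma backward_stability : exists kap : R, [/\ 0 < kap, kap <= 2^-1 &
  forall (v : 'cV[C]_N) eta, B *m v = 0 -> 0 < eta -> exists V del : R, [/\ 0 <= V, 0 < del &
  forall F (y : C -> 'cV[C]_N) z0 b tau,
  adm F -> nm F <= rho -> 0 <= Re z0 -> expR V <= cabs z0 -> cabs (b - 1) <= kap ->
  0 <= tau -> (forall w, mder y w (Cv F w *m y w)) ->
  nm (y (clog (z0 + tau%:C * b)) - v) <= del -> nm (y (clog z0) - v) <= eta]].
Proof.
have [[_ _ _ nu0 _] _] := SD.
have dg := @dom_ge0 R N e e0 h X P rho; have dr := @dom_rho R N e e0 h X P rho.
have [K [kap [V0 [K0 kap0 kap2 V00 EE]]]] := energy_estimate SD rho0.
exists kap; split=> // v eta Bv eta0.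
have m0 : 0 < Num.min 1 nu by rewrite lt_min ltr01.
have [k1 k10 Hk1] := nm_le_Wm SD 1.
pose k2 : R := ((N + N) * 1)%:R ^+ 2.
have k20 : 0 <= k2 by rewrite exprn_ge0.
set w := nm v; have w0 : 0 <= w := nm_ge0 _.
(* Tolerances: an energy at most sg forces |GL y - v| <= eta / 4; ta bounds the gauged defect at the
   far end, so that its energy is at most sg / 4; 1 + ep bounds the growth factor of the energy; th
   bounds |GL - 1| at both ends. *)
pose sg : R := (eta / 4) ^+ 2 / (k1 ^+ 2 * k2 + 1).
have kk0 : 0 <= k1 ^+ 2 * k2 by rewrite mulr_ge0 ?sqr_ge0.
have sg0 : 0 < sg by rewrite divr_gt0 ?exprn_gt0 ?divr_gt0 // ltr_wpDl.
have w10 : 0 < w ^+ 2 + 1 by rewrite ltr_wpDl ?sqr_ge0.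
have ww0 : 0 < w + 1 by rewrite ltr_wpDl.
pose ep : R := Num.min 1 (sg / (2 * (w ^+ 2 + 1))).
have ep0 : 0 < ep by rewrite lt_min ltr01 divr_gt0 // mulr_gt0.
have nW0 : 0 < nm Wm ^+ 2 + 1 by rewrite ltr_wpDl ?sqr_ge0.
pose ta : R := Num.min 1 (sg / (4 * (nm Wm ^+ 2 + 1))).
have ta0 : 0 < ta by rewrite lt_min ltr01 divr_gt0 // mulr_gt0.
pose th : R := Num.min 2^-1 (Num.min (eta / (4 * (w + 1))) (ta / (2 * (w + 1)))).
have th0 : 0 < th by rewrite !lt_min invr_gt0 ltr0n !divr_gt0 // mulr_gt0.
have ln0 : 0 < ln (1 + ep) by rewrite ln_gt0 // ltrDl.
have th1 : th <= 2^-1 by rewrite ge_min lexx.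
have th2 : th * (w + 1) <= eta / 4.
  apply: (@le_trans _ _ (eta / (4 * (w + 1)) * (w + 1))).
    by rewrite ler_wpM2r ?(ltW ww0) // !ge_min lexx orbT.
  by rewrite le_eqVlt; apply/orP; left; apply/eqP; field; rewrite gt_eqF.
have th3 : th * (w + 1) <= ta / 2.
  apply: (@le_trans _ _ (ta / (2 * (w + 1)) * (w + 1))).
    by rewrite ler_wpM2r ?(ltW ww0) // !ge_min lexx !orbT.
  by rewrite le_eqVlt; apply/orP; left; apply/eqP; field; rewrite gt_eqF.
have ta1 : ta <= 1 by rewrite ge_min lexx.
have ta2 : ta * (nm Wm ^+ 2 + 1) <= sg / 4.
  apply: (@le_trans _ _ (sg / (4 * (nm Wm ^+ 2 + 1)) * (nm Wm ^+ 2 + 1))).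
    by rewrite ler_wpM2r ?(ltW nW0) // ge_min lexx orbT.
  by rewrite le_eqVlt; apply/orP; left; apply/eqP; field; rewrite gt_eqF.
have ep1 : ep <= 1 by rewrite ge_min lexx.
have ep2 : ep * (w ^+ 2 + 1) <= sg / 2.
  apply: (@le_trans _ _ (sg / (2 * (w ^+ 2 + 1)) * (w ^+ 2 + 1))).
    by rewrite ler_wpM2r ?(ltW w10) // ge_min lexx orbT.
  by rewrite le_eqVlt; apply/orP; left; apply/eqP; field; rewrite gt_eqF.
have sgE : (eta / 4) ^+ 2 = (k1 ^+ 2 * k2 + 1) * sg.
  by rewrite /sg; field; rewrite gt_eqF // ltr_wpDl.
clearbody th ta ep sg.
have [V1 HV1] := expR_small K0 (gain_gt0 SD) ln0.
have [V2 HGL] := bigO_small m0 th0 (bigO_GL1 h X c s nu0 dg dr rho0).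
pose Vm := Num.max V0 (Num.max V1 V2).
have Vm0 : 0 <= Vm by rewrite le_max V00.
have VmV0 : V0 <= Vm by rewrite le_max lexx.
have VmV1 : V1 <= Vm by rewrite !le_max lexx orbT.
have VmV2 : V2 <= Vm by rewrite !le_max lexx !orbT.
clearbody Vm.
have ln10 : 0 <= ln 10 :> R by rewrite ln_ge0 // ler1n.
exists (Vm + ln 10), (ta / 3); split; first by rewrite addr_ge0.
  by rewrite divr_gt0.
move=> F y z0 b tau aF nF z00 Vz bk tau0 dy y1.
have Vz0 : expR Vm <= cabs z0 by apply: le_trans Vz; rewrite ler_expR lerDl.
have [z10 z1b] := cone_bound z00 (le_trans bk kap2) tau0.
set z1 := z0 + tau%:C * b in z10 z1b y1 *.
have Vz1 : expR Vm <= cabs z1.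
  apply: le_trans z1b; rewrite ler_pdivlMr //.
  move: Vz; rewrite expRD lnK ?posrE // => H; apply: le_trans H _.
  by rewrite lerDl.
have [d0 r0 _] := dom_clog aF nF Vm0 z00 Vz0.
have [d1 r1 _] := dom_clog aF nF Vm0 z10 Vz1.
have G0 : nm (GL F (clog z0) - 1%:M) <= th.
  by apply: HGL => //; exact: le_trans r0.
have G1 : nm (GL F (clog z1) - 1%:M) <= th.
  by apply: HGL => //; exact: le_trans r1.
have E1 : energy F y v z1 <= sg / 4.
  set g := GL F (clog z1) *m y (clog z1) - v.
  have ng : nm g <= ta.
    have -> : g = (GL F (clog z1) - 1%:M) *m (y (clog z1) - v) + (y (clog z1) - v)
        + (GL F (clog z1) - 1%:M) *m v.
      rewrite /g !mulmxBl !mulmxBr !mul1mx.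
      by move: (GL F (clog z1) *m y (clog z1)) (GL F (clog z1) *m v) (y (clog z1)) => ? ? ?; mxring.
    apply: le_trans (nmD _ _) _; apply: le_trans (lerD (nmD _ _) (lexx _)) _.
    have A1 : nm ((GL F (clog z1) - 1%:M) *m (y (clog z1) - v)) <= 2^-1 * (ta / 3).
      apply: le_trans (nmM _ _) _; apply: ler_pM; rewrite ?nm_ge0 //.
      exact: le_trans G1 th1.
    have A2 : nm ((GL F (clog z1) - 1%:M) *m v) <= th * w.
      by apply: le_trans (nmM _ _) _; apply: ler_wpM2r.
    have A3 : th * w <= th * (w + 1) by rewrite ler_wpM2l ?(ltW th0) // lerDl.
    exact: three_term_bound A1 y1 A2 A3 th3.
  apply: (@le_trans _ _ (nm (Wm *m g) ^+ 2)).
    by rewrite expr2; apply: le_trans (ler_norm _) _; exact: ip_le.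
  apply: (@le_trans _ _ ((nm Wm * ta) ^+ 2)).
    rewrite ler_sqr ?nnegrE ?nm_ge0 ?mulr_ge0 ?nm_ge0 ?(ltW ta0) //.
    by apply: le_trans (nmM _ _) _; apply: ler_wpM2l; rewrite ?nm_ge0.
  apply: le_trans ta2; rewrite exprMn mulrC.
  have q1 : ta ^+ 2 <= ta by rewrite expr2 ler_piMl // ltW.
  apply: ler_pM; rewrite ?sqr_ge0 // lerDl //.
have q : expR (K * expR (- (gain * ln (cabs z0)))) <= 1 + ep.
  rewrite -[1 + ep]lnK ?posrE ?addr_gt0 // ler_expR; apply: HV1.
  by rewrite -Re_clog; exact: le_trans r0.
have E0 : energy F y v z0 <= sg.
  have Vz00 : expR V0 <= cabs z0 by apply: le_trans Vz0; rewrite ler_expR.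
  have H := EE F y z0 b tau v aF nF z00 Vz00 bk tau0 Bv dy; rewrite -/z1 -/w in H.
  have E10 : 0 <= energy F y v z1 by exact: ip_ge0.
  have H2 : (energy F y v z1 + w ^+ 2) * expR (K * expR (- (gain * ln (cabs z0)))) <=
     (energy F y v z1 + w ^+ 2) * (1 + ep).
    by rewrite ler_wpM2l // addr_ge0 ?sqr_ge0.
  have H3 : energy F y v z1 * ep <= energy F y v z1 by rewrite ler_piMr.
  exact: energy_gap_bound H H2 H3 ep2 E1 ep0.
set g := GL F (clog z0) *m y (clog z0) - v in E0.
have ng : nm g <= eta / 4.
  rewrite -ler_sqr ?nnegrE ?nm_ge0 ?divr_ge0 ?(ltW eta0) //.
  apply: (@le_trans _ _ ((k1 * nm (Wm *m g)) ^+ 2)).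
    by rewrite ler_sqr ?nnegrE ?nm_ge0 ?mulr_ge0 ?nm_ge0 // Hk1.
  rewrite exprMn; apply: (@le_trans _ _ (k1 ^+ 2 * (k2 * energy F y v z0))).
    by apply: ler_wpM2l; [exact: sqr_ge0|exact: nm_sqr_le].
  rewrite sgE mulrA; apply: ler_pM => //; first exact: ip_ge0.
  by rewrite lerDl.
set Y := y (clog z0) in g ng *.
have YE : Y = g + v - (GL F (clog z0) - 1%:M) *m Y.
  by rewrite /g subrK mulmxBl mul1mx opprB addrC subrK.
have tY : nm ((GL F (clog z0) - 1%:M) *m Y) <= th * nm Y.
  exact: le_trans (nmM _ _) (ler_wpM2r (nm_ge0 _) G0).
have nY : nm Y <= 2 * (eta / 4 + w).
  have H : nm Y <= nm g + w + th * nm Y.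
    rewrite {1}YE; apply: le_trans (nmB _ _) _; apply: lerD => //; exact: nmD.
  have H' : th * nm Y <= 2^-1 * nm Y by rewrite ler_wpM2r ?nm_ge0.
  exact: absorb_half H H' ng.
have YE2 : Y - v = g - (GL F (clog z0) - 1%:M) *m Y.
  by rewrite {1}YE addrAC addrK.
rewrite YE2; apply: le_trans (nmB _ _) _.
have H1 : th * nm Y <= th * (2 * (eta / 4 + w)) by rewrite ler_wpM2l // ltW.
exact: two_term_bound ng tY H1 th1 eta0 th2 th0.
Qed.

(** Stability around 0 with eta = 1 says that size at most del at the far end gives size at most 1
    at the near end; linearity turns this into the constant 1 / del. *)
Lemma backward_bounded : exists K V : R, [/\ 0 <= K, 0 <= V &
  forall F (y : C -> 'cV[C]_N) z0 z1,
  adm F -> nm F <= rho -> 0 <= z0 -> expR V <= z0 -> z0 <= z1 ->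
  (forall w, mder y w (Cv F w *m y w)) ->
  nm (y (clog z0%:C)) <= K * nm (y (clog z1%:C))].
Proof.
have [kap [kap0 _ BS]] := backward_stability.
have [V [del [V0 del0 H]]] := BS 0 1 (mulmx0 _ _) ltr01.
exists (del^-1), V; split=> //; first by rewrite invr_ge0 ltW.
move=> F y z0 z1 aF nF z00 Vz z01 dy.
have z1E : z1%:C = z0%:C + (z1 - z0)%:C * 1 by rewrite mulr1 -rmorphD /= addrC subrK.
have M (k : R) : 0 <= k -> k * nm (y (clog z1%:C)) <= del -> k * nm (y (clog z0%:C)) <= 1.
  move=> k0 Hk; have := H F (fun v => k%:C *: y v) z0%:C 1 (z1 - z0) aF nF.
  rewrite -z1E !subr0 !nmZ !cabsR (ger0_norm k0) (ger0_norm z00) subrr cabs0 subr_ge0.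
  apply; [exact: z00|exact: Vz|exact: ltW|exact: z01| |exact: Hk].
  by move=> w; apply: mder_eq (mder_scale k%:C (dy w)) _; rewrite scalemxAr.
(* If y vanishes at the far end, all its multiples stay below 1 at the near end, so y vanishes there
   too. *)
have [y10|y10] := eqVneq (nm (y (clog z1%:C))) 0.
  rewrite y10 mulr0.
  apply/ler_addgt0Pr => eps eps0; rewrite add0r.
  have := M eps^-1; rewrite y10 mulr0 => /(_ _ (ltW del0)).
  rewrite invr_ge0 => /(_ (ltW eps0)).
  by rewrite -ler_pdivlMl ?invr_gt0 // invrK mulr1.
have y1p : 0 < nm (y (clog z1%:C)) by rewrite lt_def y10 nm_ge0.
have := M (del / nm (y (clog z1%:C))); rewrite divfK // => /(_ _ (lexx _)).
rewrite divr_ge0 ?(ltW del0) ?nm_ge0 // => /(_ isT).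
rewrite -ler_pdivlMl; last by rewrite divr_gt0.
by rewrite invf_div mulr1 mulrC.
Qed.

End BackwardStability.

(** * Continuity of the propagators in the parameter matrix *)

Section PropagatorContinuity.
Variable R : realType.
Local Notation C := R[i].
Local Notation Re := (@complex.Re R).

Lemma mpow_bound N (rho : R) j : 0 <= rho -> exists2 K, 0 <= K &
  forall F : 'M[C]_N, nm F <= rho -> nm (mpow F j) <= K.
Proof.
move=> r0; elim: j => [|j [K K0 HK]]; first by exists (nm (1%:M : 'M[C]_N)); rewrite ?nm_ge0.
exists (rho * K); first exact: mulr_ge0.
move=> F nF; apply: le_trans (nmM _ _) _; apply: ler_pM; rewrite ?nm_ge0 //; exact: HK.
Qed.

Lemma mpow_lipschitz N (rho : R) j : 0 <= rho -> exists2 K, 0 <= K &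
  forall F G : 'M[C]_N, nm F <= rho -> nm G <= rho -> nm (mpow F j - mpow G j) <= K * nm (F - G).
Proof.
move=> r0; elim: j => [|j [K K0 HK]].
  by exists 0 => // F G _ _; rewrite subrr nm0 mul0r.
have [L L0 HL] := mpow_bound N j r0.
exists (rho * K + L); first by rewrite addr_ge0 // mulr_ge0.
move=> F G nF nG; rewrite !mpowS.
have -> : F *m mpow F j - G *m mpow G j = F *m (mpow F j - mpow G j) + (F - G) *m mpow G j.
  rewrite mulmxBr mulmxBl; move: (F *m _) (F *m _) (G *m _) => ? ? ?; mxring.
apply: le_trans (nmD _ _) _; rewrite mulrDl; apply: lerD.
  apply: le_trans (nmM _ _) _; rewrite -mulrA; apply: ler_pM; rewrite ?nm_ge0 //; exact: HK.
apply: le_trans (nmM _ _) _; rewrite mulrC; apply: ler_pM; rewrite ?nm_ge0 //; exact: HL.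
Qed.

Variables (N : nat) (e e0 D : 'M[C]_N) (c : C) (lam nu : R) (s : nat).

(** Exponents of [Cv] as an exponential sum: s + 1 of them for z lam Q, then 1, 1 - nu and 0, which
    carry - (e + e0), - F e0 and D. *)
Definition exponents (i : 'I_(s.+1 + 3)) : C :=
  match fintype.split i with
  | inl j => (1 - nu * j%:R)%:C
  | inr k => nth 0 [:: 1; (1 - nu)%:C; 0] k
  end.

Definition coefs (F : 'M[C]_N) (i : 'I_(s.+1 + 3)) : 'M[C]_N :=
  match fintype.split i with
  | inl j => lam%:C *: root_coef c F j
  | inr k => nth 0 [:: - (e + e0); - (F *m e0); D] k
  end.

Lemma expsum_Cv F v : expsum exponents (coefs F) v = Cv e e0 D c lam nu s F v.
Proof.
rewrite /expsum big_split_ord /= /exponents /coefs.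
under eq_bigr => j _ do rewrite -[lshift 3 j]/(unsplit (inl j)) unsplitK.
under [X in _ + X]eq_bigr => j _ do rewrite -[rshift s.+1 j]/(unsplit (inr j)) unsplitK.
have E j : cexp ((1 - nu * j%:R)%:C * v) = cexp v * tpow nu v ^+ j.
  rewrite tpowX -cexpD; congr cexp; rewrite rmorphB /=; ring.
have -> : \sum_(j < s.+1) cexp ((1 - nu * j%:R)%:C * v) *: (lam%:C *: root_coef c F j) =
   cexp v *: (lam%:C *: \sum_(j < s.+1) tpow nu v ^+ j *: root_coef c F j).
  rewrite !scaler_sumr; apply: eq_bigr => j _; rewrite E !scalerA; congr (_ *: _); ring.
have E1 : cexp ((1 - nu)%:C * v) = cexp v * tpow nu v.
  by have := E 1%N; rewrite mulr1 expr1.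
rewrite /Cv /Qg /mseries mulmxDl mul1mx -scalemxAl.
move: (\sum_(j < s.+1) tpow nu v ^+ j *: root_coef c F j) => S.
rewrite !big_ord_recl big_ord0 /= mul1r mul0r cexp0 scale1r addr0 E1.
move: (F *m e0) (tpow nu v) => Fe t; mxring.
Qed.

Lemma coefs_bound rho : 0 <= rho -> exists2 K, 0 <= K &
  forall F, nm F <= rho -> forall i, nm (coefs F i) <= K.
Proof.
move=> r0.
have /choice[Kf HK] (j : nat) : exists K, 0 <= K /\ forall F : 'M[C]_N, nm F <= rho -> nm (mpow F j) <= K.
  by have [K K0 H] := mpow_bound N j r0; exists K.
pose Kr j := cabs lam%:C * (cabs (gbinom c j) * Kf j).
have Kr0 j : 0 <= Kr j by have [h0 _] := HK j; rewrite !mulr_ge0 ?cabs_ge0.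
pose K3 := nm (e + e0) + rho * nm e0 + nm D.
have rn : 0 <= rho * nm e0 by rewrite mulr_ge0 ?nm_ge0.
exists (\sum_(j < s.+1) Kr j + K3).
  by rewrite !addr_ge0 ?nm_ge0 // sumr_ge0.
move=> F nF i; rewrite /coefs; case: (fintype.split i) => [j|k].
  rewrite (bigD1 j) //= -!addrA; apply: (@le_trans _ _ (Kr j)).
    rewrite !nmZ !ler_wpM2l ?cabs_ge0 //; by have [_ h] := HK j; exact: h.
  by rewrite lerDl !addr_ge0 ?nm_ge0 // sumr_ge0.
have S0 : 0 <= \sum_(j < s.+1) Kr j by rewrite sumr_ge0.
have n1 := nm_ge0 (e + e0); have n2 := nm_ge0 D.
case: k => -[|[|[|//]]] ? /=; rewrite ?nmN /K3.
- lra.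
- apply: le_trans (nmM _ _) _; apply: (@le_trans _ _ (rho * nm e0)).
    by rewrite ler_wpM2r ?nm_ge0.
  lra.
- lra.
Qed.

Lemma coefs_lipschitz rho : 0 <= rho -> exists2 K, 0 <= K &
  forall F G, nm F <= rho -> nm G <= rho -> forall i, nm (coefs F i - coefs G i) <= K * nm (F - G).
Proof.
move=> r0.
have /choice[Kf HK] (j : nat) : exists K, 0 <= K /\ forall F G : 'M[C]_N, nm F <= rho -> nm G <= rho ->
    nm (mpow F j - mpow G j) <= K * nm (F - G).
  by have [K K0 H] := mpow_lipschitz N j r0; exists K.
pose Kr j := cabs lam%:C * (cabs (gbinom c j) * Kf j).
have Kr0 j : 0 <= Kr j by have [h0 _] := HK j; rewrite !mulr_ge0 ?cabs_ge0.
have S0 : 0 <= \sum_(j < s.+1) Kr j by rewrite sumr_ge0.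
exists (\sum_(j < s.+1) Kr j + nm e0); first by rewrite addr_ge0 ?nm_ge0.
move=> F G nF nG i; have d0 := nm_ge0 (F - G).
rewrite /coefs; case: (fintype.split i) => [j|k].
  apply: (@le_trans _ _ (Kr j * nm (F - G))).
    rewrite /root_coef -!scalerBr !nmZ -!mulrA !ler_wpM2l ?cabs_ge0 //.
    by have [_ h] := HK j; exact: h.
  rewrite ler_wpM2r // (bigD1 j) //= -!addrA lerDl !addr_ge0 ?nm_ge0 // sumr_ge0 //.
case: k => -[|[|[|//]]] ? /=; rewrite ?subrr ?nm0 ?mulr_ge0 ?addr_ge0 ?nm_ge0 //.
have -> : - (F *m e0) - - (G *m e0) = - ((F - G) *m e0).
  by rewrite mulmxBl; move: (F *m e0) (G *m e0) => ? ?; mxring.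
rewrite nmN; apply: le_trans (nmM _ _) _; rewrite mulrC ler_wpM2r // lerDr //.
Qed.

Lemma coefs_expsum_bnd rho r : 0 <= rho -> 0 <= r -> exists2 K, 0 <= K &
  forall F, nm F <= rho -> expsum_bnd exponents (coefs F) r <= K.
Proof.
move=> r0 rr; have [K K0 HK] := coefs_bound r0.
exists (\sum_i expR (cabs (exponents i) * r) * K).
  by apply: sumr_ge0 => i _; rewrite mulr_ge0 ?expR_ge0.
by move=> F nF; apply: ler_sum => i _; rewrite ler_wpM2l ?expR_ge0 // HK.
Qed.

Local Notation Y F := (fund exponents (coefs F)).
Local Notation Z F := (fundV exponents (coefs F)).

Lemma propagator_bound rho w : 0 <= rho -> exists2 b, 0 <= b &
  forall F, nm F <= rho -> forall t : R, 0 <= t <= 1 ->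
    nm (Y F (t%:C * w)) <= b /\ nm (Z F (t%:C * w)) <= b.
Proof.
move=> r0; have w0 := cabs_ge0 w; have [K K0 HK] := coefs_expsum_bnd r0 w0.
exists (N%:R * expR ((N * N)%:R ^+ 2 * K * cabs w)); first by rewrite mulr_ge0 ?expR_ge0.
move=> F nF t /andP[t0 t1].
have tw : cabs (t%:C * w) <= cabs w by rewrite cabsM cabsR ger0_norm // ler_piMl.
have M : N%:R * expR ((N * N)%:R ^+ 2 * expsum_bnd exponents (coefs F) (cabs w) * cabs w) <=
   N%:R * expR ((N * N)%:R ^+ 2 * K * cabs w).
  rewrite ler_wpM2l // ler_expR ler_wpM2r // ler_wpM2l ?exprn_ge0 //; exact: HK.
by split; apply: le_trans M; [exact: nm_fund|exact: nm_fundV].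
Qed.

(** Y_G - Y_F = Y_F (Z_F Y_G - 1) and Z_G - Z_F = (Z_G Y_F - 1) Z_F, and both brackets are small by
    [fund_perturb]. *)
Lemma propagator_continuous F w eps : 0 < eps -> exists2 d : R, 0 < d &
  forall G, nm (G - F) <= d -> nm (Y G w - Y F w) <= eps /\ nm (Z G w - Z F w) <= eps.
Proof.
move=> eps0; pose rho := nm F + 1.
have r0 : 0 <= rho by rewrite addr_ge0 ?nm_ge0.
have [b b0 Hb] := propagator_bound w r0.
have [L L0 HL] := coefs_lipschitz r0.
have w0 := cabs_ge0 w.
pose S := \sum_i expR (cabs (exponents i) * cabs w) * L.
have S0 : 0 <= S by apply: sumr_ge0 => i _; rewrite mulr_ge0 ?expR_ge0.
pose K := (N * N)%:R ^+ 2 * (b * S * b * cabs w) * b.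
have K0 : 0 <= K by rewrite !mulr_ge0 ?exprn_ge0.
have diff G1 G2 (t : R) : nm G1 <= rho -> nm G2 <= rho -> 0 <= t <= 1 ->
   nm (expsum exponents (coefs G1) (t%:C * w) - expsum exponents (coefs G2) (t%:C * w)) <= S * nm (G1 - G2).
  move=> n1 n2 /andP[t0 t1]; rewrite /expsum -sumrB /S mulr_suml.
  apply: le_trans (nm_sum _ _ _) _; apply: ler_sum => i _.
  rewrite -scalerBr nmZ -mulrA; apply: ler_pM; rewrite ?cabs_ge0 ?nm_ge0 ?HL //.
  by apply: cabs_cexp_le; rewrite cabsM cabsR ger0_norm // ler_piMl.
have pert G1 G2 : nm G1 <= rho -> nm G2 <= rho ->
   nm (Z G1 w *m Y G2 w - 1%:M) <= (N * N)%:R ^+ 2 * (b * (S * nm (G2 - G1)) * b * cabs w).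
  move=> n1 n2; apply: fund_perturb => t t01; last exact: diff.
  by have [_ h1] := Hb _ n1 t t01; have [h2 _] := Hb _ n2 t t01.
have one : 0 <= (1 : R) <= 1 by rewrite lexx ler01.
exists (Num.min 1 (eps / (K + 1))); first by rewrite lt_min ltr01 divr_gt0 // ltr_wpDl.
move=> G; rewrite le_min => /andP[G1 Ge].
have nF : nm F <= rho by rewrite lerDl.
have nG : nm G <= rho.
  by rewrite -[G](subrK F) addrC; apply: le_trans (nmD _ _) _; rewrite lerD2l.
have KG : K * nm (G - F) <= eps.
  have K10 : 0 < K + 1 by rewrite ltr_wpDl.
  move: Ge; rewrite ler_pdivlMr // => H; apply: le_trans H.
  by rewrite mulrC ler_wpM2l ?nm_ge0 // lerDl.
have bE : (N * N)%:R ^+ 2 * (b * (S * nm (G - F)) * b * cabs w) * b = K * nm (G - F).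
  by rewrite /K; ring.
have [YF ZF] := Hb F nF 1 one; rewrite mul1r in YF ZF.
split; apply: le_trans KG; rewrite -bE.
  have -> : Y G w - Y F w = Y F w *m (Z F w *m Y G w - 1%:M).
    by rewrite mulmxBr mulmxA fundKV mul1mx mulmx1.
  apply: le_trans (nmM _ _) _; rewrite mulrC; apply: ler_pM; rewrite ?nm_ge0 //; exact: pert.
have -> : Z G w - Z F w = (Z G w *m Y F w - 1%:M) *m Z F w.
  by rewrite mulmxBl -mulmxA fundKV mulmx1 mul1mx.
apply: le_trans (nmM _ _) _; apply: ler_pM; rewrite ?nm_ge0 //.
by rewrite [nm (G - F)]nm_distC; exact: pert.
Qed.

End PropagatorContinuity.

(** * The subdominant solution *)

Section Limits.
Variable R : realType.
Local Notation C := R[i].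

(** No rate is available here, so the limit is the supremum of the eventual lower bounds. *)
Lemma real_cauchy (u : nat -> R) :
  (forall eps, 0 < eps -> exists k0, forall k, (k0 <= k)%N -> `|u k - u k0| <= eps) ->
  exists l, forall eps, 0 < eps -> exists k0, forall k, (k0 <= k)%N -> `|l - u k| <= eps.
Proof.
move=> H; pose S : set R := fun x => exists k0, forall k, (k0 <= k)%N -> x <= u k.
have bd eps k0 : (forall k, (k0 <= k)%N -> `|u k - u k0| <= eps) ->
    S (u k0 - eps) /\ ubound S (u k0 + eps).
  move=> Hk; split.
    by exists k0 => k kk; have := Hk k kk; rewrite ler_norml => /andP[]; lra.
  move=> x [k1 Hx]; have := Hx (maxn k0 k1) (leq_maxr _ _).
  have := Hk (maxn k0 k1) (leq_maxl _ _); rewrite ler_norml => /andP[]; lra.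
have hS : has_sup S.
  have [k0 Hk] := H 1 ltr01; have [a b] := bd _ _ Hk.
  by split; [exists (u k0 - 1)|exists (u k0 + 1)].
exists (sup S) => eps eps0; have e2 : 0 < eps / 2 by rewrite divr_gt0.
have [k0 Hk] := H _ e2; exists k0 => k kk; have [a b] := bd _ _ Hk.
have s1 : u k0 - eps / 2 <= sup S by apply: sup_upper_bound.
have s2 : sup S <= u k0 + eps / 2 by apply: ge_sup => //; case: hS.
by have := Hk k kk; rewrite !ler_norml => /andP[? ?]; apply/andP; split; lra.
Qed.

Lemma mx_cauchy m n (u : nat -> 'M[C]_(m, n)) :
  (forall eps, 0 < eps -> exists k0, forall k, (k0 <= k)%N -> nm (u k - u k0) <= eps) ->
  exists l, forall eps, 0 < eps -> exists k0, forall k, (k0 <= k)%N -> nm (l - u k) <= eps.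
Proof.
move=> H.
have Pr i j : exists l, forall eps, 0 < eps -> exists k0, forall k, (k0 <= k)%N ->
    `|l - complex.Re (u k i j)| <= eps.
  apply: real_cauchy => eps e0; have [k0 Hk] := H _ e0; exists k0 => k kk.
  rewrite -ReN -ReD; apply: le_trans (Re_le_cabs _) (le_trans _ (Hk k kk)).
  by have := nm_entry (u k - u k0) i j; rewrite !mxE.
have Pi i j : exists l, forall eps, 0 < eps -> exists k0, forall k, (k0 <= k)%N ->
    `|l - complex.Im (u k i j)| <= eps.
  apply: real_cauchy => eps e0; have [k0 Hk] := H _ e0; exists k0 => k kk.
  rewrite -ImN -ImD; apply: le_trans (Im_le_cabs _) (le_trans _ (Hk k kk)).
  by have := nm_entry (u k - u k0) i j; rewrite !mxE.
pose lr i j := projT1 (cid (Pr i j)); pose li i j := projT1 (cid (Pi i j)).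
have Hr i j : forall eps, 0 < eps -> exists k0, forall k, (k0 <= k)%N ->
    `|lr i j - complex.Re (u k i j)| <= eps := projT2 (cid (Pr i j)).
have Hi i j : forall eps, 0 < eps -> exists k0, forall k, (k0 <= k)%N ->
    `|li i j - complex.Im (u k i j)| <= eps := projT2 (cid (Pi i j)).
exists (\matrix_(i, j) (lr i j +i* li i j)) => eps e0.
pose d : R := eps / ((m * n)%:R * 2 + 1).
have q0 : 0 < (m * n)%:R * 2 + 1 :> R by rewrite ltr_wpDl // mulr_ge0.
have d0 : 0 < d by rewrite divr_gt0.
have /choice[K HK] (ij : 'I_m * 'I_n) : exists k0, forall k, (k0 <= k)%N ->
    `|lr ij.1 ij.2 - complex.Re (u k ij.1 ij.2)| <= d /\ `|li ij.1 ij.2 - complex.Im (u k ij.1 ij.2)| <= d.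
  have [k1 H1] := Hr ij.1 ij.2 d d0; have [k2 H2] := Hi ij.1 ij.2 d d0.
  exists (maxn k1 k2) => k; rewrite geq_max => /andP[? ?].
  by split; [exact: H1|exact: H2].
exists (\max_ij K ij) => k kk; apply: (@le_trans _ _ ((m * n)%:R * (2 * d))).
  apply: nm_le_entries => i j; rewrite !mxE; apply: le_trans (cabs_le_ReIm _) _.
  rewrite ReD ImD ReN ImN /= mulr_natl mulr2n.
  have [|h1 h2] := HK (i, j) k; first exact: leq_trans (leq_bigmax (i, j)) kk.
  exact: lerD.
have -> : (m * n)%:R * (2 * d) = (m * n)%:R * 2 * d by rewrite mulrA.
rewrite -[X in _ <= X](divfK (lt0r_neq0 q0)) -/d mulrC ler_wpM2l ?(ltW d0) // lerDl.
exact: ler01.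
Qed.

Lemma clogR (x : R) : clog (expR x)%:C = x%:C :> C.
Proof.
have H : `|complex.Im (x%:C : C)| < pi by rewrite /= normr0 pi_gt0.
by have [_] := cexpK H; rewrite cexpR.
Qed.

End Limits.

Section SubdominantSolution.
Variable R : realType.
Local Notation C := R[i].
Local Notation Re := (@complex.Re R).
Local Notation Im := (@complex.Im R).
Variables (N : nat) (e e0 h X D P Q0 Q1 : 'M[C]_N) (c : C) (lam nu c0 : R) (s : nat).
Local Notation B := (lam%:C%:M - (e + e0)).
Hypothesis SD : system_data e e0 h X D P Q0 Q1 c lam nu c0 s.
Local Notation Cv := (Cv e e0 D c lam nu s).
Local Notation adm := (adm e e0 h X P).
Local Notation Y F := (fund (@exponents R nu s) (@coefs R N e e0 D c lam s F)).
Local Notation Z F := (fundV (@exponents R nu s) (@coefs R N e e0 D c lam s F)).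

Lemma mder_propagator F (d : 'cV[C]_N) w :
  mder (fun w => Y F w *m d) w (Cv F w *m (Y F w *m d)).
Proof.
apply: mder_eq (mder_mulr d (mder_fund _ _ w)) _.
by rewrite expsum_Cv mulmxA.
Qed.

Variable psi : 'cV[C]_N.
Hypothesis Bpsi : B *m psi = 0.

Local Notation nR k := ((k%:R : R)%:C).
(** The value at v = 0 of the solution that equals [psi] at v = k. *)
Definition approx F (k : nat) : 'cV[C]_N := Z F (nR k) *m psi.

Lemma real_stability rho : 0 <= rho -> forall eta, 0 < eta -> exists k0 : nat,
  forall F j k, adm F -> nm F <= rho -> (k0 <= j)%N -> (j <= k)%N ->
  nm (Y F (nR j) *m approx F k - psi) <= eta.
Proof.
move=> r0 eta eta0.
have [kap [kap0 kap2 H]] := backward_stability SD r0.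
have [V [del [V0 del0 HV]]] := H psi eta Bpsi eta0.
have [k0 Hk0] : exists k0 : nat, V <= k0%:R.
  by exists (Num.trunc V).+1; rewrite ltW // truncnS_gt.
exists k0 => F j k aF nF jk0 jk.
have Vj : V <= j%:R by apply: le_trans Hk0 _; rewrite ler_nat.
have Ejk : expR (j%:R : R) <= expR k%:R by rewrite ler_expR ler_nat.
have := HV F (fun w => Y F w *m approx F k) (expR j%:R)%:C 1 (expR k%:R - expR j%:R) aF nF.
rewrite mulr1 -rmorphD /= [expR j%:R + _]addrC subrK !clogR cabsR gtr0_norm ?expR_gt0 // subrr cabs0.
apply=> //.
all: rewrite /= ?expR_ge0 ?ler_expR ?subr_ge0 ?(ltW kap0) //.
- by move=> w; exact: mder_propagator.
- by rewrite /approx mulmxA fundKV mul1mx subrr nm0 ltW.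
Qed.

Lemma real_bounded rho : 0 <= rho -> exists K : R, exists j0 : nat, 0 <= K /\
  forall F (d : 'cV[C]_N) j, adm F -> nm F <= rho -> (j0 <= j)%N ->
  nm (Y F (nR j0) *m d) <= K * nm (Y F (nR j) *m d).
Proof.
move=> r0; have [K [V [K0 V0 H]]] := backward_bounded SD r0.
have [j0 Hj0] : exists k0 : nat, V <= k0%:R.
  by exists (Num.trunc V).+1; rewrite ltW // truncnS_gt.
exists K, j0; split=> // F d j aF nF jj.
have := H F (fun w => Y F w *m d) (expR j0%:R) (expR j%:R) aF nF (expR_ge0 _).
rewrite !clogR !ler_expR ler_nat; apply=> // w; exact: mder_propagator.
Qed.

(** The solution with initial value [approx F k - approx F j] takes at v = j the value y_k(j) - psi,
    where y_k is the solution equal to psi at k; it is small by stability. Boundedness carries this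
    back to j0, where the estimates begin to hold, with a constant independent of j, and a fixed
    propagator leads from j0 to 0. *)
Lemma approx_cauchy rho : 0 <= rho -> forall eps, 0 < eps -> exists k0 : nat,
  forall F j k, adm F -> nm F <= rho -> (k0 <= j)%N -> (j <= k)%N ->
  nm (approx F k - approx F j) <= eps.
Proof.
move=> r0 eps eps0.
have [K [j0 [K0 HK]]] := real_bounded r0.
have [b b0 Hb] := propagator_bound e e0 D c lam nu s (nR j0) r0.
have q0 : 0 < b * K + 1 by rewrite ltr_wpDl // mulr_ge0.
have [k0 Hk] := real_stability r0 (divr_gt0 eps0 q0).
exists (maxn j0 k0) => F j k aF nF; rewrite geq_max => /andP[jj kj] jk.
have one : 0 <= (1 : R) <= 1 by rewrite lexx ler01.
have [_ Zb] := Hb F nF 1 one; rewrite mul1r in Zb.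
have S := Hk F j k aF nF kj jk.
have E : Y F (nR j) *m (approx F k - approx F j) = Y F (nR j) *m approx F k - psi.
  by rewrite mulmxBr /approx [X in _ - X]mulmxA fundKV mul1mx.
have B1 := HK F (approx F k - approx F j) j aF nF jj.
rewrite E in B1.
have -> : approx F k - approx F j = Z F (nR j0) *m (Y F (nR j0) *m (approx F k - approx F j)).
  by rewrite mulmxA fundVK mul1mx.
apply: le_trans (nmM _ _) _; apply: (@le_trans _ _ (b * (K * (eps / (b * K + 1))))).
  apply: ler_pM; rewrite ?nm_ge0 //; apply: le_trans B1 _; exact: ler_wpM2l.
rewrite mulrA mulrCA ler_piMr ?(ltW eps0) // ler_pdivrMr // mul1r lerDl.
exact: ler01.
Qed.

Lemma limit_exists : exists cinf : 'M[C]_N -> 'cV[C]_N,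
  forall rho eps, 0 <= rho -> 0 < eps -> exists k0 : nat,
  forall F k, adm F -> nm F <= rho -> (k0 <= k)%N -> nm (cinf F - approx F k) <= eps.
Proof.
have /choice[cinf Hc] F : exists l, adm F -> forall eps, 0 < eps ->
    exists k0, forall k, (k0 <= k)%N -> nm (l - approx F k) <= eps.
  have [aF|nF] := pselect (adm F); last by exists 0 => /nF.
  have [|l Hl] := @mx_cauchy _ _ _ (approx F); last by exists l.
  move=> eps eps0; have [k0 Hk] := approx_cauchy (nm_ge0 F) eps0.
  by exists k0 => k kk; apply: Hk.
exists cinf => rho eps r0 eps0; have e2 : 0 < eps / 2 by rewrite divr_gt0.
have [k0 Hk] := approx_cauchy r0 e2; exists k0 => F k aF nF kk.
have [k1 Hk1] := Hc F aF _ e2.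
set m := maxn k k1.
have -> : cinf F - approx F k = (cinf F - approx F m) + (approx F m - approx F k).
  by move: (cinf F) (approx F k) (approx F m) => ? ? ?; mxring.
rewrite [eps]splitr; apply: le_trans (nmD _ _) _; apply: lerD.
  by apply: Hk1; exact: leq_maxr.
by apply: Hk => //; exact: leq_maxl.
Qed.

Definition cinf := projT1 (cid limit_exists).

Lemma cinfP rho eps : 0 <= rho -> 0 < eps -> exists k0 : nat,
  forall F k, adm F -> nm F <= rho -> (k0 <= k)%N -> nm (cinf F - approx F k) <= eps.
Proof. exact: (projT2 (cid limit_exists)). Qed.

Definition yinf F w : 'cV[C]_N := Y F w *m cinf F.

Lemma yinfE F w : yinf F w = Y F w *m cinf F.
Proof. by []. Qed.

Lemma mder_yinf F w : mder (yinf F) w (Cv F w *m yinf F w).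
Proof. exact: mder_propagator. Qed.

Lemma yinf_nat F eps : adm F -> 0 < eps -> exists k0 : nat, forall k, (k0 <= k)%N ->
  nm (yinf F (nR k) - psi) <= eps.
Proof.
move=> aF eps0; have e2 : 0 < eps / 2 by rewrite divr_gt0.
have [k0 Hk] := real_stability (nm_ge0 F) e2; exists k0 => k kk.
have q0 : 0 < nm (Y F (nR k)) + 1 by rewrite ltr_wpDl ?nm_ge0.
have [k1 H1] := cinfP (nm_ge0 F) (divr_gt0 e2 q0).
pose m := maxn k k1.
have -> : yinf F (nR k) - psi = Y F (nR k) *m (cinf F - approx F m)
    + (Y F (nR k) *m approx F m - psi).
  by rewrite /yinf mulmxBr addrA subrK.
apply: le_trans (nmD _ _) _; rewrite [eps]splitr; apply: lerD; last first.
  by apply: Hk => //; exact: leq_maxl.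
apply: le_trans (nmM _ _) _.
apply: (@le_trans _ _ (nm (Y F (nR k)) * (eps / 2 / (nm (Y F (nR k)) + 1)))).
  by apply: ler_wpM2l; rewrite ?nm_ge0 // H1 // leq_maxr.
rewrite mulrCA ler_piMr ?(ltW e2) // ler_pdivrMr // mul1r lerDl.
exact: ler01.
Qed.

(* From z with Re z >= 0 the estimates are transported along a line of slope at most kap
   ending at a large real point, where the limit psi is known. *)
Lemma yinf_sector F eps : adm F -> 0 < eps -> exists T : R, forall z,
  0 <= Re z -> T <= cabs z -> nm (yinf F (clog z) - psi) <= eps.
Proof.
move=> aF eps0.
have [kap [kap0 kap2 H]] := backward_stability SD (nm_ge0 F).
have [V [del [V0 del0 HV]]] := H psi eps Bpsi eps0.
have [k0 Hk0] := yinf_nat aF del0.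
exists (expR V) => z z0 Vz.
set x := Re z in z0; set y := Im z.
(* An endpoint r beyond x + |y| / kap makes the slope |y| / (r - x) at most kap. *)
pose r0 : R := x + `|y| / kap + 1.
have [k1 Hk1] : exists k1 : nat, r0 <= k1%:R.
  by exists (Num.trunc r0).+1; rewrite ltW // truncnS_gt.
pose k := maxn k0 k1; pose r : R := expR k%:R.
have rr : r0 <= r.
  apply: (@le_trans _ _ (1 + k%:R)); last exact: expR_ge1Dx.
  apply: le_trans Hk1 _; apply: (@le_trans _ _ k%:R); first by rewrite ler_nat leq_maxr.
  by rewrite lerDr ler01.
have ykap : 0 <= `|y| / kap by rewrite divr_ge0 // ltW.
have tau0 : 0 < r - x by move: rr; rewrite /r0; lra.
pose b : C := 1 - 'i * (y / (r - x))%:C.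
have bE : z + (r - x)%:C * b = r%:C.
  apply/eqP; rewrite eq_complex ReD ImD ReRM ImRM /b ReD ImD ReN ImN ReM ImM /=.
  rewrite -/x -/y !mul0r !mul1r !subrr !sub0r ?subr0 ?addr0 ?add0r ?oppr0 ?addr0 ?mulr1.
  apply/andP; split; apply/eqP; first by ring.
  by field; rewrite gt_eqF.
have bk : cabs (b - 1) <= kap.
  have -> : b - 1 = - ('i * (y / (r - x))%:C) by rewrite /b; ring.
  rewrite cabsN cabsM cabs_i mul1r cabsR normrM normfV (gtr0_norm tau0) ler_pdivrMr //.
  by rewrite mulrC -ler_pdivrMr //; move: rr; rewrite /r0; lra.
have := HV F (yinf F) z b (r - x) aF (lexx _) z0 Vz bk (ltW tau0).
rewrite bE clogR; apply; first by move=> w; exact: mder_yinf.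
by apply: Hk0; exact: leq_maxl.
Qed.

(** Backward boundedness estimates the value at j0 by K times arbitrarily late values. Applied to
    the difference of two solutions with the same limit, this is uniqueness. *)
Lemma decaying_zero F (d : 'cV[C]_N) : adm F ->
  (forall eps, 0 < eps -> exists V : R, forall v : R, V <= v -> nm (Y F v%:C *m d) <= eps) -> d = 0.
Proof.
move=> aF Hd; have [K [j0 [K0 HK]]] := real_bounded (nm_ge0 F).
have E : Y F (nR j0) *m d = 0.
  apply: nm_eq0; apply/ler_addgt0Pr => eps eps0; rewrite add0r.
  have q0 : 0 < K + 1 by rewrite ltr_wpDl.
  have [V HV] := Hd _ (divr_gt0 eps0 q0).
  have [k1 Hk1] : exists k1 : nat, V <= k1%:R.
    by exists (Num.trunc V).+1; rewrite ltW // truncnS_gt.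
  pose k := maxn j0 k1.
  apply: le_trans (HK F d k aF (lexx _) (leq_maxl _ _)) _.
  apply: (@le_trans _ _ (K * (eps / (K + 1)))).
    apply: ler_wpM2l => //; apply: HV; apply: le_trans Hk1 _.
    by rewrite ler_nat leq_maxr.
  by rewrite mulrCA ler_piMr ?(ltW eps0) // ler_pdivrMr // mul1r lerDl ler01.
by rewrite -[d]mul1mx -(fundVK (@exponents R nu s) (@coefs R N e e0 D c lam s F) (nR j0)) -mulmxA E mulmx0.
Qed.

(** A limit, uniform on bounded sets of F, of the continuous maps F -> [approx F k]. *)
Lemma cinf_continuous F eps : adm F -> 0 < eps -> exists2 d : R, 0 < d &
  forall G, adm G -> nm (G - F) <= d -> nm (cinf G - cinf F) <= eps.
Proof.
move=> aF eps0; have e3 : 0 < eps / 3 by rewrite divr_gt0.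
have r0 : 0 <= nm F + 1 by rewrite addr_ge0 ?nm_ge0.
have [k Hk] := cinfP r0 e3.
have q0 : 0 < nm psi + 1 by rewrite ltr_wpDl ?nm_ge0.
have [d d0 Hd] := propagator_continuous e e0 D c lam nu s F (nR k) (divr_gt0 e3 q0).
exists (Num.min 1 d); first by rewrite lt_min ltr01.
move=> G aG; rewrite le_min => /andP[G1 Gd].
have nF : nm F <= nm F + 1 by rewrite lerDl.
have nG : nm G <= nm F + 1.
  by rewrite -[G](subrK F) addrC; apply: le_trans (nmD _ _) _; rewrite lerD2l.
have A1 := Hk G k aG nG (leqnn k); have A2 := Hk F k aF nF (leqnn k).
have A3 : nm (approx G k - approx F k) <= eps / 3.
  rewrite /approx -mulmxBl; apply: le_trans (nmM _ _) _; have [_ h2] := Hd G Gd.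
  apply: (@le_trans _ _ (eps / 3 / (nm psi + 1) * (nm psi + 1))); last by rewrite divfK // gt_eqF.
  by apply: ler_pM; rewrite ?nm_ge0 // lerDl.
have -> : cinf G - cinf F = (cinf G - approx G k) + (approx G k - approx F k) - (cinf F - approx F k).
  by move: (cinf G) (cinf F) (approx G k) (approx F k) => ? ? ? ?; mxring.
apply: le_trans (nmB _ _) _; apply: le_trans (lerD (nmD _ _) (lexx _)) _.
apply: le_trans (lerD (lerD A1 A3) A2) _.
by rewrite le_eqVlt; apply/orP; left; apply/eqP; field.
Qed.

Lemma yinf_continuous F w eps : adm F -> 0 < eps -> exists2 d : R, 0 < d &
  forall G, adm G -> nm (G - F) <= d -> nm (yinf G w - yinf F w) <= eps.
Proof.
move=> aF eps0; have e2 : 0 < eps / 2 by rewrite divr_gt0.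
have q0 : 0 < nm (cinf F) + 1 by rewrite ltr_wpDl ?nm_ge0.
have q1 : 0 < nm (Y F w) + 1 by rewrite ltr_wpDl ?nm_ge0.
have q2 : 0 < Num.min 1 (eps / 2 / (nm (Y F w) + 1 + nm (cinf F) + 1)).
  by rewrite lt_min ltr01 divr_gt0 // -addrA addr_gt0.
have [d1 d10 H1] := propagator_continuous e e0 D c lam nu s F w q2.
have [d2 d20 H2] := cinf_continuous aF q2.
exists (Num.min d1 d2); first by rewrite lt_min d10.
move=> G aG; rewrite le_min => /andP[/H1[A1 _] /(H2 G aG) A2].
set q := Num.min _ _ in q2 A1 A2.
have qa : q <= 1 by rewrite ge_min lexx.
have qb : q * (nm (Y F w) + 1 + nm (cinf F) + 1) <= eps / 2.
  by rewrite -ler_pdivlMr ?ge_min ?lexx ?orbT // -addrA addr_gt0.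
clearbody q.
have -> : yinf G w - yinf F w = (Y G w - Y F w) *m cinf F
   + Y F w *m (cinf G - cinf F) + (Y G w - Y F w) *m (cinf G - cinf F).
  rewrite /yinf; move: (Y G w) (Y F w) (cinf G) (cinf F) => YG YF cG cF.
  rewrite !mulmxBl !mulmxBr.
  by move: (YG *m cG) (YF *m cF) (YG *m cF) (YF *m cG) => ? ? ? ?; mxring.
apply: le_trans (nmD _ _) _; apply: le_trans (lerD (nmD _ _) (lexx _)) _.
have T1 : nm ((Y G w - Y F w) *m cinf F) <= q * nm (cinf F).
  by apply: le_trans (nmM _ _) _; rewrite ler_wpM2r ?nm_ge0.
have T2 : nm (Y F w *m (cinf G - cinf F)) <= q * nm (Y F w).
  by apply: le_trans (nmM _ _) _; rewrite mulrC ler_wpM2r ?nm_ge0.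
have T3 : nm ((Y G w - Y F w) *m (cinf G - cinf F)) <= q * 1.
  apply: le_trans (nmM _ _) _; apply: ler_pM; rewrite ?nm_ge0 //.
  exact: le_trans A2 qa.
apply: le_trans (lerD (lerD T1 T2) T3) _.
apply: (@le_trans _ _ (q * (nm (Y F w) + 1 + nm (cinf F) + 1))); last first.
  by apply: le_trans qb _; rewrite ler_pdivrMr // ler_peMr ?ltW // ltr1n.
rewrite -!mulrDr ler_wpM2l ?(ltW q2) // [_ + nm (Y F w)]addrC lerD2r.
by rewrite addrAC lerDl ler01.
Qed.

End SubdominantSolution.

(** * Dependence on the spectral parameter *)

Section Uniqueness.
Variable R : realType.
Local Notation C := R[i].
Local Notation Re := (@complex.Re R).
Variables (N : nat) (e e0 h X D P Q0 Q1 : 'M[C]_N) (c : C) (lam nu c0 : R) (s : nat).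
Local Notation B := (lam%:C%:M - (e + e0)).
Hypothesis SD : system_data e e0 h X D P Q0 Q1 c lam nu c0 s.
Local Notation Cv := (Cv e e0 D c lam nu s).
Local Notation adm := (adm e e0 h X P).
Local Notation Y F := (fund (@exponents R nu s) (@coefs R N e e0 D c lam s F)).
Variable psi : 'cV[C]_N.
Hypothesis Bpsi : B *m psi = 0.
Local Notation yinf := (yinf SD Bpsi).

Lemma yinf_real F eps : adm F -> 0 < eps -> exists V : R, forall v : R, V <= v ->
  nm (yinf F v%:C - psi) <= eps.
Proof.
move=> aF eps0; have [T HT] := yinf_sector SD Bpsi aF eps0.
exists T => v Tv; have := HT (expR v)%:C; rewrite clogR cabsR ger0_norm ?expR_ge0 //=.
apply=> //.
by apply: le_trans Tv (le_trans _ (expR_ge1Dx v)); rewrite lerDr ler01.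
Qed.

Lemma subdominant_unique F (f : C -> 'cV[C]_N) : adm F ->
  (forall w, mder f w (Cv F w *m f w)) ->
  (forall eps, 0 < eps -> exists V : R, forall v : R, V <= v -> nm (f v%:C - psi) <= eps) ->
  forall w, f w = yinf F w.
Proof.
move=> aF df lf w.
have fE x : f x = Y F x *m f 0.
  by apply: ode_unique => z; rewrite expsum_Cv; exact: df.
have d0 : f 0 - cinf SD Bpsi F = 0.
  apply: (decaying_zero SD aF) => eps eps0; have e2 : 0 < eps / 2 by rewrite divr_gt0.
  have [V1 H1] := lf _ e2; have [V2 H2] := yinf_real aF e2.
  exists (Num.max V1 V2) => v; rewrite ge_max => /andP[v1 v2].
  rewrite mulmxBr -fE -/(yinf F v%:C) [eps]splitr.
  have -> : f v%:C - yinf F v%:C = (f v%:C - psi) - (yinf F v%:C - psi).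
    by move: (f _) (yinf F _) => ? ?; mxring.
  by apply: le_trans (nmB _ _) _; apply: lerD; [exact: H1|exact: H2].
by rewrite fE yinfE; congr (_ *m _); apply/eqP; rewrite -subr_eq0 d0.
Qed.

End Uniqueness.

(** * Divided differences through a doubled system *)

Section DoubledSystem.
Variable R : realType.
Local Notation C := R[i].

(** T is rectangular: it carries solutions for the primed data to solutions for the unprimed ones,
    which is how the doubled system is compared with the original. *)
Lemma Cv_intertwine N N' (T : 'M[C]_(N, N')) (e e0 D F : 'M[C]_N) (e' e0' D' F' : 'M[C]_N')
    c lam nu s w :
  T *m e' = e *m T -> T *m e0' = e0 *m T -> T *m D' = D *m T -> T *m F' = F *m T ->
  T *m Cv e' e0' D' c lam nu s F' w = Cv e e0 D c lam nu s F w *m T.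
Proof.
move=> Te Te0 TD TF.
have Tp j : T *m mpow F' j = mpow F j *m T.
  elim: j => [|j IH]; first by rewrite mul1mx mulmx1.
  by rewrite !mpowS mulmxA TF -mulmxA IH mulmxA.
have TQ : T *m Qg c nu s F' w = Qg c nu s F w *m T.
  rewrite /Qg /mseries mulmx_sumr mulmx_suml; apply: eq_bigr => j _.
  by rewrite /root_coef -!scalemxAr -!scalemxAl Tp.
rewrite /Cv [LHS]mulmxDr [RHS]mulmxDl TD; congr (_ + _).
rewrite -[LHS]scalemxAr -[RHS]scalemxAl; congr (_ *: _); rewrite [LHS]mulmxBr [RHS]mulmxBl; congr (_ - _).
  by rewrite -scalemxAr -scalemxAl TQ.
rewrite [LHS]mulmxDr [RHS]mulmxDl Te; congr (_ + _).
rewrite [LHS]mulmxA -[RHS]mulmxA -Te0 [RHS]mulmxA; congr (_ *m _).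
by rewrite mulmxDr mulmxDl mulmx1 mul1mx -scalemxAr -scalemxAl TF.
Qed.

Definition dbl N (A : 'M[C]_N) : 'M[C]_(N + N) := block_mx A 0 0 A.

Lemma dblM N (A B : 'M[C]_N) : dbl A *m dbl B = dbl (A *m B).
Proof. by rewrite /dbl mulmx_block !mulmx0 !mul0mx !addr0 add0r. Qed.

Lemma dblD N (A B : 'M[C]_N) : dbl A + dbl B = dbl (A + B).
Proof. by rewrite /dbl add_block_mx !addr0. Qed.

Lemma dblN N (A : 'M[C]_N) : - dbl A = dbl (- A).
Proof. by rewrite /dbl opp_block_mx !oppr0. Qed.

Lemma dblZ N k (A : 'M[C]_N) : k *: dbl A = dbl (k *: A).
Proof. by rewrite /dbl scale_block_mx !scaler0. Qed.

Lemma dbl_scalar N k : k%:M = dbl (k%:M : 'M[C]_N).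
Proof. by rewrite /dbl scalar_mx_block. Qed.

Lemma dbl0 N : dbl (0 : 'M[C]_N) = 0.
Proof. by rewrite /dbl block_mx0. Qed.

Lemma dbl_col N (A : 'M[C]_N) (u v : 'cV[C]_N) : dbl A *m col_mx u v = col_mx (A *m u) (A *m v).
Proof. by rewrite /dbl mul_block_col !mul0mx addr0 add0r. Qed.

(** Scalar blocks make it commute with every [dbl A], hence admissible. For a = d and b <> 0 it is
    of Jordan type, and functions of it carry a derivative in the lower left block. *)
Definition jordan2 N (a b d : C) : 'M[C]_(N + N) := block_mx a%:M 0 b%:M d%:M.

Lemma jordan2_dbl N a b d (A : 'M[C]_N) : jordan2 N a b d *m dbl A = dbl A *m jordan2 N a b d.
Proof.
rewrite /jordan2 /dbl !mulmx_block !mulmx0 !mul0mx !addr0 !add0r.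
by rewrite !scalar_mxC.
Qed.

Variables (N : nat) (e e0 h X D P Q0 Q1 : 'M[C]_N) (c : C) (lam nu c0 : R) (s : nat).
Local Notation B := (lam%:C%:M - (e + e0)).
Hypothesis SD : system_data e e0 h X D P Q0 Q1 c lam nu c0 s.
Variable psi : 'cV[C]_N.
Hypothesis Bpsi : B *m psi = 0.

Lemma dbl_B : lam%:C%:M - (dbl e + dbl e0) = dbl B.
Proof. by rewrite dblD dblN dbl_scalar dblD. Qed.

Lemma dbl_system : system_data (dbl e) (dbl e0) (dbl h) (dbl X) (dbl D) (dbl P) (dbl Q0) (dbl Q1)
  c lam nu c0 s.
Proof.
case: SD => -[he he0 HX nu0 sn] [BP PB Pk QQ [c00 Hl]]; rewrite /system_data dbl_B.
split; split=> //.
- by rewrite dblZ dbl_scalar dblD !dblM he.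
- by rewrite dblZ dbl_scalar dblD !dblM he0.
- by rewrite dblD !dblM dblN dblD HX.
- by rewrite dblM BP dbl0.
- by rewrite dblM PB dbl0.
- move=> v; rewrite -[v]vsubmxK !dbl_col => /eqP; rewrite col_mx_eq0 => /andP[/eqP v1 /eqP v2].
  by rewrite !Pk.
- by rewrite dblM QQ -dbl_scalar.
- split=> // v; rewrite -[v]vsubmxK !dbl_col => /eqP; rewrite col_mx_eq0 => /andP[/eqP v1 /eqP v2].
  by rewrite !ip_col_mx mulrDr lerD // Hl.
Qed.

Lemma dbl_psi : (lam%:C%:M - (dbl e + dbl e0)) *m col_mx psi 0 = 0.
Proof. by rewrite dbl_B dbl_col Bpsi mulmx0 col_mx0. Qed.

Local Notation ysol E := (yinf SD Bpsi (- (E : C))%:M).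
Local Notation ydbl a d := (yinf dbl_system dbl_psi (jordan2 N (- a) (-1) (- d))).

Lemma adm_scalar (k : C) : adm e e0 h X P k%:M.
Proof. by split; rewrite scalar_mxC. Qed.

Lemma adm_jordan2 a b d : adm (dbl e) (dbl e0) (dbl h) (dbl X) (dbl P) (jordan2 N a b d).
Proof. by split; exact: jordan2_dbl. Qed.

(* The row [1, t] intertwines the doubled system at the parameter matrix [[a, 0], [1, d]] with
   the original one at a (t = 0) and at d (t = d - a): the second component of the doubled
   solution is the divided difference in the parameter. *)
Lemma ydbl_project (a d t E w : C) :
  (row_mx 1%:M t%:M : 'M[C]_(N, N + N)) *m jordan2 N (- a) (-1) (- d) =
    (- E)%:M *m row_mx 1%:M t%:M ->
  row_mx 1%:M t%:M *m ydbl a d w = ysol E w.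
Proof.
set T := row_mx _ _ => TF.
have Td (A : 'M[C]_N) : T *m dbl A = A *m T.
  by rewrite /T /dbl mul_row_block mul_mx_row !mulmx0 !mul1mx mulmx1 addr0 add0r scalar_mxC.
apply: (subdominant_unique SD Bpsi (adm_scalar _) (f := fun w => T *m ydbl a d w)).
  move=> z; apply: mder_eq (mder_mull T (mder_yinf _ _ _ _)) _.
  rewrite !mulmxA; congr (_ *m _).
  by rewrite (Cv_intertwine c lam nu s z (Td e) (Td e0) (Td D) TF).
move=> eps eps0; have q0 : 0 < nm T + 1 by rewrite ltr_wpDl ?nm_ge0.
have [V HV] := yinf_real dbl_system dbl_psi (adm_jordan2 (- a) (-1) (- d)) (divr_gt0 eps0 q0).
exists V => v Vv; have -> : T *m ydbl a d v%:C - psi = T *m (ydbl a d v%:C - col_mx psi 0).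
  by rewrite mulmxBr; congr (_ - _); rewrite /T mul_row_col mul1mx mulmx0 addr0.
apply: le_trans (nmM _ _) _; apply: (@le_trans _ _ (nm T * (eps / (nm T + 1)))).
  by apply: ler_wpM2l; [exact: nm_ge0|exact: HV].
by rewrite mulrCA ler_piMr ?(ltW eps0) // ler_pdivrMr // mul1r lerDl ler01.
Qed.

(** The rows (1, d - a) and (1, 0) both intertwine, and their difference is d - a times the row (0,
    1). *)
Lemma ysol_divided_difference (a d w : C) :
  ysol d w - ysol a w = (d - a) *: (row_mx 0 1%:M *m ydbl a d w).
Proof.
have H1 : (row_mx 1%:M (d - a)%:M : 'M[C]_(N, N + N)) *m jordan2 N (- a) (-1) (- d) =
    (- d)%:M *m row_mx 1%:M (d - a)%:M.
  rewrite /jordan2 mul_row_block mul_mx_row !mulmx0 !mul1mx !mulmx1 add0r -!scalar_mxM -raddfD /=.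
  by congr (row_mx _%:M _%:M); ring.
have H0 : (row_mx 1%:M 0%:M : 'M[C]_(N, N + N)) *m jordan2 N (- a) (-1) (- d) =
    (- a)%:M *m row_mx 1%:M 0%:M.
  have z0 : (0 : C)%:M = 0 :> 'M[C]_N by rewrite raddf0.
  rewrite /jordan2 mul_row_block mul_mx_row z0.
  by rewrite !mulmx0 !mul0mx !mul1mx !mulmx1 !addr0.
rewrite -(ydbl_project w H1) -(ydbl_project w H0) -mulmxBl scalemxAl; congr (_ *m _).
rewrite opp_row_mx add_row_mx subrr raddf0 subr0 scale_row_mx scaler0.
by rewrite scale_scalar_mx mulr1.
Qed.

Lemma mder_ysol (E w : C) :
  mder (fun E => ysol E w) E (row_mx 0 1%:M *m ydbl E E w).
Proof.
move=> eps eps0; set p2 := row_mx 0 1%:M.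
have q0 : 0 < nm p2 + 1 by rewrite ltr_wpDl ?nm_ge0.
have [d d0 Hd] := yinf_continuous dbl_system dbl_psi w (adm_jordan2 (- E) (-1) (- E)) (divr_gt0 eps0 q0).
have n0 : 0 < (N%:R + 1 : R) by rewrite ltr_wpDl.
exists (d / (N%:R + 1)); first exact: divr_gt0.
move=> k kd; rewrite ysol_divided_difference [E + k]addrC addrK -scalerBr -mulmxBr nmZ mulrC.
apply: ler_wpM2r; first exact: cabs_ge0.
apply: le_trans (nmM _ _) _; apply: (@le_trans _ _ (nm p2 * (eps / (nm p2 + 1)))).
  apply: ler_wpM2l; first exact: nm_ge0.
  apply: Hd; first exact: adm_jordan2.
  have -> : jordan2 N (- E) (-1) (- (k + E)) - jordan2 N (- E) (-1) (- E) =
     block_mx 0 0 0 (- k)%:M.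
    rewrite /jordan2 opp_block_mx add_block_mx !subrr; congr block_mx.
    by rewrite -raddfB /=; congr (_%:M); ring.
  apply: (@le_trans _ _ (N%:R * cabs k)).
    rewrite /block_mx /nm big_split_ord /= [X in X + _]big1 ?add0r; last first.
      by move=> i _; apply: big1 => j _; rewrite col_mxEu row_mx0 mxE cabs0.
    rewrite -[cabs k]cabsN -nm_scalar /nm; apply: ler_sum => i _.
    rewrite big_split_ord /= [X in X + _]big1 ?add0r; last first.
      by move=> j _; rewrite col_mxEd row_mxEl mxE cabs0.
    by apply: ler_sum => j _; rewrite col_mxEd row_mxEr.
  move: kd; rewrite ltr_pdivlMr // => /ltW; apply: le_trans.
  by rewrite mulrC ler_wpM2l ?cabs_ge0 // lerDl ler01.
by rewrite mulrCA ler_piMr ?(ltW eps0) // ler_pdivrMr // mul1r lerDl ler01.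
Qed.

End DoubledSystem.

(** * Lie-theoretic input *)

Section LieData.
Variables (K : numFieldType) (L : lmodType K) (br : L -> L -> L).
Hypothesis br_lie : is_lie_bracket br.

Lemma brDl x y z : br (x + y) z = br x z + br y z.
Proof. by have [H _] := br_lie; have := H 1 x y z; rewrite !scale1r. Qed.

Lemma brDr x y z : br z (x + y) = br z x + br z y.
Proof. by have [_ [H _]] := br_lie; have := H 1 x y z; rewrite !scale1r. Qed.

Lemma br0l z : br 0 z = 0.
Proof. by apply: (addrI (br 0 z)); rewrite -brDl !addr0. Qed.

Lemma br0r z : br z 0 = 0.
Proof. by apply: (addrI (br z 0)); rewrite -brDr !addr0. Qed.

Lemma brZl a x z : br (a *: x) z = a *: br x z.
Proof. by have [H _] := br_lie; have := H a x 0 z; rewrite br0l !addr0. Qed.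

Lemma brZr a x z : br z (a *: x) = a *: br z x.
Proof. by have [_ [H _]] := br_lie; have := H a x 0 z; rewrite br0r !addr0. Qed.

Lemma brC x y : br x y = - br y x.
Proof.
have [_ [_ [H _]]] := br_lie; have := H (x + y).
by rewrite brDl !brDr !H add0r addr0 => /eqP; rewrite addr_eq0 => /eqP.
Qed.

Lemma br_suml I (r : seq I) (F : I -> L) z :
  br (\sum_(i <- r) F i) z = \sum_(i <- r) br (F i) z.
Proof. by elim/big_rec2: _ => [|i u v _ <-]; [exact: br0l|exact: brDl]. Qed.

Lemma br_sumr I (r : seq I) (F : I -> L) z :
  br z (\sum_(i <- r) F i) = \sum_(i <- r) br z (F i).
Proof. by elim/big_rec2: _ => [|i u v _ <-]; [exact: br0r|exact: brDr]. Qed.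

Lemma br_derivation x y z : br z (br x y) = br (br z x) y + br x (br z y).
Proof.
have [_ [_ [_ H]]] := br_lie; have := H z x y.
rewrite [br y (br z x)]brC [br y z]brC -scaleN1r brZr scaleN1r -addrA => /eqP.
by rewrite addr_eq0 opprD !opprK addrC => /eqP.
Qed.

Variables (n : nat) (A : 'M[int]_n) (e f h : 'I_n -> L) (beta : 'I_n -> int) (a0 : L).
Hypothesis ADE : is_ADE_cartan A.
Hypothesis simple : is_simple_lie br.
Hypothesis chev : chevalley_generators br A e f h.
Hypothesis lowest : is_lowest_root br A h beta.
Hypothesis a0_neq0 : a0 <> 0.
Hypothesis a0_root : in_root_space br A h beta a0.

Lemma br_ef i j : br (e i) (f j) = if i == j then h i else 0.
Proof. by have [_ [H _]] := chev. Qed.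

Lemma br_he i j : br (h i) (e j) = (A i j)%:~R *: e j.
Proof. by have [_ [_ [H _]]] := chev. Qed.

Lemma br_hf i j : br (h i) (f j) = - ((A i j)%:~R *: f j).
Proof. by have [_ [_ [_ [H _]]]] := chev. Qed.

Lemma scaler_inj0 (k : K) (x : L) : k *: x = 0 -> x <> 0 -> k = 0.
Proof. by move/eqP; rewrite scaler_eq0 => /orP[/eqP //|/eqP]. Qed.

Lemma scaler2_eq0 (x : L) : (2 : int)%:~R *: x = 0 -> x = 0.
Proof.
move/eqP; rewrite scaler_eq0 intr_eq0 => /orP[//|/eqP //].
Qed.

Lemma h_eq0 i : e i = 0 -> h i = 0.
Proof. by move=> ei; have := br_ef i i; rewrite eqxx ei br0l. Qed.

(** A triple could vanish as far as the relations are concerned; since [h_i, e_i] = 2 e_i,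
    [h_i, f_i] = - 2 f_i and h_i = [e_i, f_i], its members vanish together. *)
Lemma f_eq0 i : e i = 0 <-> f i = 0.
Proof.
have [_ [A2 _]] := ADE; split=> [/h_eq0 hi|fi].
  have := br_hf i i; rewrite hi br0l A2 => /esym/eqP; rewrite oppr_eq0 => /eqP.
  exact: scaler2_eq0.
have hi : h i = 0 by have := br_ef i i; rewrite eqxx fi br0r.
by have := br_he i i; rewrite hi br0l A2 => /esym; exact: scaler2_eq0.
Qed.

Lemma some_e_neq0 : exists i, e i <> 0.
Proof.
apply/not_existsP => e0; have e00 i : e i = 0 by exact: contrapT (e0 i).
have [[x [y xy]] _] := simple; apply: xy.
have [_ [_ [_ [_ [_ [_ gen]]]]]] := chev.
have all0 : forall u : L, u = 0; last by rewrite (all0 x) br0l.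
apply: gen => /=.
- by split=> // a u v -> ->; rewrite scaler0 addr0.
- by move=> u v -> _; exact: br0l.
- by move=> u [i [->|[->|->]]]; [exact: e00|exact/f_eq0|exact: h_eq0].
Qed.

Lemma cartan_zero_block i j : e j = 0 -> e i <> 0 -> A j i = 0.
Proof.
move=> ej ei; have := br_he j i; rewrite (h_eq0 ej) br0l => /esym H.
by apply/eqP; rewrite -(intr_eq0 K); apply/eqP; exact: scaler_inj0 H ei.
Qed.

(** Cartan integers between vanishing and nonvanishing triples are 0, and h_i = 0 makes row i of the
    matrix orthogonal to beta. The restriction of beta to the vanishing triples is thus a null
    vector of the quadratic form of A, and positive definiteness kills it. *)
Lemma beta_eq0 j : e j = 0 -> beta j = 0.
Proof.
move=> ej; have [_ [_ [_ [_ pos]]]] := ADE.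
pose x : 'cV[rat]_n := \col_i (if e i == 0 then (beta i)%:~R else 0).
suff x0 : x = 0.
  by have /colP/(_ j) := x0; rewrite !mxE ej eqxx => /eqP; rewrite intr_eq0 => /eqP.
apply/eqP; apply: contrapT => /negP xn0; have := pos x xn0.
suff -> : (x^T *m map_mx intr A *m x) ord0 ord0 = 0 by rewrite ltxx.
rewrite -mulmxA mxE big1 // => i _; rewrite !mxE.
case: eqP => [ei|]; last by rewrite mul0r.
have -> : \sum_k map_mx intr A i k * x k ord0 = (\sum_k beta k * A i k)%:~R.
  rewrite rmorph_sum; apply: eq_bigr => k _; rewrite !mxE.
  case: eqP => [ek|ek]; first by rewrite rmorphM mulrC.
  by rewrite (cartan_zero_block ei ek) !mulr0.
have := a0_root i; rewrite (h_eq0 ei) br0l => /esym H.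
suff -> : \sum_k beta k * A i k = 0 by rewrite mulr0.
by apply/eqP; rewrite -(intr_eq0 K); apply/eqP; exact: scaler_inj0 H a0_neq0.
Qed.

Lemma beta_le i : e i <> 0 -> forall k, beta k <= - (k == i)%:Z.
Proof.
move=> ei; have [_ low] := lowest; apply: low; split.
  by exists i; rewrite eqxx oppr_eq0.
exists (f i); split; first by move/f_eq0.
move=> j; rewrite br_hf -scaleNr; congr (_ *: _); rewrite -rmorphN; congr (_%:~R).
rewrite (bigD1 i) //= eqxx big1 ?addr0 ?mulN1r // => k /negPf->.
by rewrite oppr0 mul0r.
Qed.

Lemma beta_le0 k : beta k <= 0.
Proof. by have [i /beta_le H] := some_e_neq0; apply: le_trans (H k) _; case: (k == i). Qed.

Lemma sum_beta_le : \sum_i beta i <= -1.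
Proof.
have [i ei] := some_e_neq0; rewrite (bigD1 i) //=.
have := beta_le ei i; rewrite eqxx => bi.
have : \sum_(j | j != i) beta j <= 0 by apply: sumr_le0 => j _; exact: beta_le0.
by move: (\sum_(_ | _) _) (beta i) bi => u v; lia.
Qed.

Lemma dual_coxeter_gt1 : (1 < dual_coxeter beta)%N.
Proof. by rewrite /dual_coxeter; have := sum_beta_le; move: (\sum_i _) => u; lia. Qed.

Lemma dual_coxeterE : (dual_coxeter beta)%:Z = 1 - \sum_i beta i.
Proof. by rewrite /dual_coxeter; have := sum_beta_le; move: (\sum_i _) => u; lia. Qed.

(** Otherwise [a0, f_i] would be a vector of root beta - alpha_i, below the lowest root. *)
Lemma br_a0_f i : br a0 (f i) = 0.
Proof.
have [ei|ei] := pselect (e i = 0); first by have /f_eq0-> := ei; exact: br0r.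
apply: contrapT => y0; have [_ low] := lowest; have bi := beta_le ei i.
rewrite eqxx in bi; suff /low/(_ i) : is_root br A h (fun k => beta k - (k == i)%:Z).
  by rewrite eqxx; move: (beta i) bi => ? _; lia.
split; first by exists i; rewrite eqxx; move: (beta i) bi; lia.
exists (br a0 (f i)); split=> // j.
rewrite br_derivation a0_root br_hf -scaleNr brZl brZr -scalerDl; congr (_ *: _).
rewrite -rmorphN -rmorphD; congr (_%:~R).
under [RHS]eq_bigr do rewrite mulrBl; rewrite big_split /=; congr (_ + _).
rewrite sumrN (bigD1 i) //= eqxx mul1r big1 ?addr0 // => k /negPf->.
by rewrite mul0r.
Qed.

Variables (hh : L).
Hypothesis hh_cartan : in_cartan h hh.
Hypothesis hh_e : forall i, br hh (e i) = e i.

(** The eigenvalue is the height of the lowest root: alpha_i(hh) = 1 for each nonzero e_i, and beta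
    has coefficient 0 at the others. *)
Lemma br_hh_a0 : br hh a0 = (1 - (dual_coxeter beta)%:R) *: a0.
Proof.
have [c hhE] := hh_cartan.
have -> : (1 - (dual_coxeter beta)%:R : K) = (\sum_i beta i)%:~R.
  by rewrite -[_%:R]/((dual_coxeter beta)%:Z%:~R) dual_coxeterE rmorphB opprB addrC subrK.
rewrite hhE br_suml; under eq_bigr do rewrite brZl a0_root scalerA.
rewrite -scaler_suml; congr (_ *: _).
under eq_bigr do rewrite rmorph_sum mulr_sumr.
rewrite exchange_big rmorph_sum /=; apply: eq_bigr => i _.
have [ei|ei] := pselect (e i = 0).
  by rewrite (beta_eq0 ei) big1 // => j _; rewrite mul0r mulr0.
have cA : \sum_j c j * (A j i)%:~R = 1.
  apply/eqP; rewrite -subr_eq0; apply/eqP/(@scaler_inj0 _ (e i)) => //.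
  rewrite scalerBl scale1r scaler_suml; apply/eqP; rewrite subr_eq0; apply/eqP.
  rewrite -[RHS]hh_e hhE br_suml; apply: eq_bigr => j _.
  by rewrite brZl br_he scalerA.
have -> : (beta i)%:~R = \sum_j (beta i)%:~R * (c j * (A j i)%:~R) by rewrite -mulr_sumr cA mulr1.
by apply: eq_bigr => j _; rewrite intrM mulrCA.
Qed.

Lemma cartan_in_image (zeta : K) (x : L) : in_cartan h x ->
  exists y, br (zeta *: a0 + \sum_i e i) y = x.
Proof.
move=> [c ->]; exists (\sum_i c i *: f i).
rewrite br_sumr; apply: eq_bigr => i _; rewrite brZr; congr (_ *: _).
rewrite brDl brZl br_a0_f scaler0 add0r br_suml (bigD1 i) //= br_ef eqxx big1 ?addr0 //.
by move=> j /negPf ji; rewrite br_ef ji.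
Qed.

Lemma cartan_abelian x y : in_cartan h x -> in_cartan h y -> br x y = 0.
Proof.
move=> [c ->] [d ->]; have [hh0 _] := chev.
rewrite br_suml big1 // => i _; rewrite br_sumr big1 // => j _.
by rewrite brZl brZr hh0 !scaler0.
Qed.

Variables (N : nat) (rho : L -> 'M[K]_N).
Hypothesis rho_rep : is_representation br rho.

Lemma rho0 : rho 0 = 0.
Proof. by have [_ H] := rho_rep; rewrite -{1}(br0l 0) H subrr. Qed.

Lemma rhoZ a x : rho (a *: x) = a *: rho x.
Proof. by have [H _] := rho_rep; have := H a x 0; rewrite rho0 !addr0. Qed.

Lemma rhoD x y : rho (x + y) = rho x + rho y.
Proof. by have [H _] := rho_rep; have := H 1 x y; rewrite !scale1r. Qed.

Lemma rho_sum I (r : seq I) (F : I -> L) : rho (\sum_(i <- r) F i) = \sum_(i <- r) rho (F i).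
Proof. by elim/big_rec2: _ => [|i u v _ <-]; [exact: rho0|exact: rhoD]. Qed.

Lemma rho_br x y : rho (br x y) = rho x *m rho y - rho y *m rho x.
Proof. by have [_ H] := rho_rep. Qed.

Lemma rho_grading (zeta : K) :
  let Eop := \sum_i rho (e i) in let E0op := zeta *: rho a0 in
  rho hh *m Eop - Eop *m rho hh = Eop /\
  rho hh *m E0op - E0op *m rho hh = (1 - (dual_coxeter beta)%:R) *: E0op.
Proof.
split; first by rewrite -rho_sum -rho_br br_sumr; congr rho; apply: eq_bigr => i _.
by rewrite -rhoZ -rho_br brZr br_hh_a0 -rhoZ scalerA mulrC -scalerA.
Qed.

Lemma rho_cartan_in_image (zeta : K) x : in_cartan h x -> exists Y,
  let Lam := zeta *: rho a0 + \sum_i rho (e i) in Lam *m Y - Y *m Lam = rho x.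
Proof.
move=> /(cartan_in_image zeta)[y yx]; exists (rho y) => /=.
by rewrite -rho_sum -rhoZ -rhoD -rho_br yx.
Qed.

End LieData.

(** * The WKB factor *)

Section ActionFunction.
Variable R : realType.
Local Notation C := R[i].
Local Notation Re := (@complex.Re R).
Local Notation Im := (@complex.Im R).
Variables (hv : nat) (M : R).
Hypothesis hv_gt0 : (0 < hv)%N.
Hypothesis M_gt0 : 0 < M.
Local Notation s := (s_idx hv M).
Local Notation T := ((M + 1) / (hv%:R * M)).

Lemma cexp_slit_inv (x : C) : slit_plane x -> cexp (- clog x) = x^-1.
Proof. by move=> sx; rewrite -cexpV clogK. Qed.

Lemma cder_cpow (a : R) (x : C) : slit_plane x ->
  cder (fun x => cpow x a%:C) x (a%:C * cpow x (a - 1)%:C).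
Proof.
move=> sx; apply: cder_eq (cder_comp (cder_clog sx) (cder_cexpZ a%:C (clog x))) _.
by rewrite /cpow rmorphB mulrBl mul1r cexpD cexp_slit_inv // mulrC mulrA.
Qed.

Lemma hvM_gt0 : 0 < hv%:R * M.
Proof. by rewrite mulr_gt0 // ltr0n. Qed.

(** The exponent a_j + 1 is positive for j below (M + 1) / (h^vee M), which makes the integrals from
    0 converge; it vanishes at j = s exactly in the resonant case, where the logarithm appears. *)
Lemma a_expE j : a_exp hv M j + 1 = hv%:R * M * (T - j%:R).
Proof.
rewrite /a_exp [RHS]mulrBr [X in _ = X - _]mulrC divfK ?(gt_eqF hvM_gt0) //; by ring.
Qed.

Lemma s_idx_le : s%:R <= T.
Proof.
have T0 : 0 <= T by rewrite divr_ge0 ?(ltW hvM_gt0) // addr_ge0 ?(ltW M_gt0).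
by have /andP[] := truncn_itv T0.
Qed.

Lemma s_idx_gt : T < s.+1%:R.
Proof.
have T0 : 0 <= T by rewrite divr_ge0 ?(ltW hvM_gt0) // addr_ge0 ?(ltW M_gt0).
by have /andP[] := truncn_itv T0.
Qed.

Lemma a_exp_neq0 j : j%:R < T -> (a_exp hv M j + 1)%:C != 0 :> C.
Proof.
move=> jT; rewrite (inj_eq (@complexI R) _ 0) a_expE.
by rewrite gt_eqF // mulr_gt0 ?hvM_gt0 // subr_gt0.
Qed.

Lemma cder_S_term (k : C) j x : slit_plane x -> j%:R < T ->
  cder (fun x => k * cpow x (a_exp hv M j + 1)%:C / (a_exp hv M j + 1)%:C) x
    (k * cpow x (a_exp hv M j)%:C).
Proof.
move=> sx jT; have b0 := a_exp_neq0 jT.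
apply: cder_eq (cderM (cderZ k (cder_cpow _ sx)) (cder_const _ x)) _.
rewrite addrK mulr0 addr0 /=; move: b0; move: (_%:C) (cpow _ _) => b p b0.
by rewrite mulrCA -mulrA mulrCA divff // mulr1.
Qed.

Lemma cder_S (x E : C) : slit_plane x ->
  cder (fun x => S_fun hv M x E) x (q_fun hv M x E).
Proof.
move=> sx; rewrite /S_fun /q_fun; case rc: (res_case hv M); last first.
  have sT : s%:R < T by rewrite lt_neqAle s_idx_le andbT; apply/negbT.
  apply: cder_sum => j; apply: cder_S_term => //.
  by apply: le_lt_trans sT; rewrite ler_nat -ltnS.
have sT : s%:R = T by apply/eqP.
rewrite big_ord_recr /=; apply: cderD.
  by apply: cder_sum => j; apply: cder_S_term => //; rewrite -sT ltr_nat.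
apply: cder_eq (cderZ _ (cder_clog sx)) _; congr (_ * _).
have -> : a_exp hv M s = -1.
  by apply/eqP; rewrite -subr_eq0 opprK a_expE sT subrr mulr0.
by rewrite /cpow rmorphN mulN1r cexp_slit_inv.
Qed.

Lemma cder_c_coef j (E : C) : exists l, cder (c_coef hv j) E l.
Proof.
exists (gbinom (hv%:R^-1) j * (-1 * (j%:R * (- E) ^+ j.-1))).
apply: cderZ; apply: (@cder_comp R (fun E => - E) (fun E => E ^+ j)); last exact: cderX.
move=> eps e0; exists 1 => // k _; have -> : - (E + k) - - E - k * -1 = 0 by ring.
by rewrite cabs0 mulr_ge0 ?cabs_ge0 ?ltW.
Qed.

Lemma cder_S_E (x E : C) : exists l, cder (S_fun hv M x) E l.
Proof.
pose l j := projT1 (cid (cder_c_coef j E)).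
have dl j : cder (c_coef hv j) E (l j) := projT2 (cid (cder_c_coef j E)).
pose b j : C := (a_exp hv M j + 1)%:C.
have dt j : cder (fun E => c_coef hv j E * cpow x (b j) / b j) E
    ((l j * cpow x (b j) + c_coef hv j E * 0) / b j + c_coef hv j E * cpow x (b j) * 0).
  by apply: cderM; [apply: cderM; [exact: dl|exact: cder_const]|exact: cder_const].
rewrite /S_fun; case: res_case; eexists; last by apply: cder_sum => j; exact: dt.
apply: cderD; first by apply: cder_sum => j; exact: dt.
by apply: cderM; [exact: dl|exact: cder_const].
Qed.

Definition xpow (x : C) : C := cexp (- (M * hv%:R)%:C * clog x).

Lemma q_factor x E :
  q_fun hv M x E = cpow x M%:C * \sum_(j < s.+1) xpow x ^+ j * c_coef hv j E.
Proof.
rewrite /q_fun mulr_sumr; apply: eq_bigr => j _.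
rewrite mulrA mulrC; congr (_ * _).
rewrite /xpow -cexpX /cpow -cexpD; congr cexp; rewrite /a_exp.
by rewrite rmorphM rmorphB rmorphM !rmorph_nat rmorphM rmorph_nat rmorph1; ring.
Qed.

Lemma cabs_xpow x : cabs (xpow x) = expR (- (M * hv%:R) * ln (cabs x)).
Proof.
rewrite /xpow cabs_cexp; congr expR.
by rewrite -rmorphN ReRM Re_clog.
Qed.

Lemma q_tail_small E eps : 0 < eps -> exists2 r : R, 0 < r & forall x : C, r < cabs x ->
  cabs (\sum_(j < s.+1) xpow x ^+ j * c_coef hv j E - 1) <= eps.
Proof.
move=> eps0; set K := \sum_(j < s) cabs (c_coef hv j.+1 E).
have K0 : 0 < K + 1 by rewrite ltr_wpDl // sumr_ge0 // => j _; exact: cabs_ge0.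
have Mh : 0 < M * hv%:R by rewrite mulr_gt0 // ltr0n.
set d := Num.min 1 (eps / (K + 1)).
have d0 : 0 < d by rewrite lt_min ltr01 divr_gt0.
exists (expR (- ln d / (M * hv%:R))); first exact: expR_gt0.
move=> x rx; have x0 : 0 < cabs x := lt_trans (expR_gt0 _) rx.
have td : cabs (xpow x) <= d.
  rewrite cabs_xpow -[leRHS]lnK ?posrE // ler_expR mulNr lerNl.
  by rewrite -ler_pdivrMl // mulrC -[leLHS]expRK ler_ln ?posrE ?expR_gt0 // ltW.
rewrite big_ord_recl expr0 mul1r /c_coef gbinom0 expr0 mulr1 addrC addKr.
apply: le_trans (cabs_sum _ _ _) _; apply: (@le_trans _ _ (d * K)).
  rewrite mulr_sumr; apply: ler_sum => j _; rewrite cabsM.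
  apply: ler_wpM2r; first exact: cabs_ge0.
  rewrite cabsX exprS; apply: (@le_trans _ _ (d * 1)); last by rewrite mulr1.
  apply: ler_pM => //; rewrite ?cabs_ge0 ?exprn_ge0 ?cabs_ge0 //.
  by rewrite exprn_ile1 ?cabs_ge0 // (le_trans td) // ge_min lexx.
apply: (@le_trans _ _ (eps / (K + 1) * K)).
  by apply: ler_wpM2r; [apply: sumr_ge0 => j _; exact: cabs_ge0|rewrite ge_min lexx orbT].
by rewrite -mulrA ler_piMr ?(ltW eps0) // mulrC ler_pdivrMr // mul1r lerDl ler01.
Qed.

Lemma slit_of_carg (x : C) : `|carg x| < pi -> x != 0 -> slit_plane x.
Proof.
move=> cx x0 [i0 r0]; move: cx; rewrite /carg i0 eqxx r0 /=; case: eqP => [r00|_].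
  by case/negP: x0; rewrite eq_complex r00 i0 eqxx.
by rewrite ger0_norm ?pi_ge0 // ltxx.
Qed.

(* In a sector of half-angle at most pi / (2 M) the principal logarithm of q has no jump,
   and it is asymptotic to M log x. *)
Lemma clog_q_asymp E eps : 0 < eps -> exists2 r : R, 0 < r & forall x : C, r < cabs x ->
  M * `|carg x| < pi / 2 -> slit_plane x ->
  exists2 w : C, cabs w <= eps & clog (q_fun hv M x E) = M%:C * clog x + w.
Proof.
move=> eps0; have p0 := pi_gt0 R.
set d := Num.min (eps / 4) (Num.min 2^-1 (pi / 16)).
have d0 : 0 < d by rewrite !lt_min !divr_gt0 // invr_gt0 ltr0n.
have [r r0 Hr] := q_tail_small E d0; exists r => // x rx xs sx.
have := Hr x rx; rewrite q_factor; move: (\sum_(_ < _) _) => Q Q1.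
move: Q1; rewrite !le_min => /and3P[h1 h2 h3].
have Mc : `|Im (M%:C * clog x)| < pi / 2.
  by rewrite ImRM Im_clog normrM gtr0_norm.
have Mp : `|Im (M%:C * clog x)| < pi by apply: lt_trans Mc _; lra.
have [sz lz] := cexpK Mp.
have QE : Q = 1 + (Q - 1) by rewrite addrC subrK.
have ca : `|carg (cexp (M%:C * clog x))| + 4 * cabs (Q - 1) < pi.
  by rewrite -Im_clog lz; move: Mc h3 p0; move: (cabs _) `|_| pi => a b c; lra.
have [_] := clogM1p sz h2 ca; rewrite -QE => EQ; exists (clog Q); last by rewrite /cpow EQ lz.
have [_] := clog1p_le h2; rewrite -QE; move: h1; move: (cabs _) (cabs _) => a b; lra.
Qed.

End ActionFunction.

(** * Conjugation of the equation by the WKB factor *)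

Section GaugeFactor.
Variable R : realType.
Local Notation C := R[i].
Variables (hv : nat) (M lam : R).
Hypothesis hv_gt0 : (0 < hv)%N.
Hypothesis M_gt0 : 0 < M.
Local Notation s := (s_idx hv M).
Local Notation S := (S_fun hv M).
Local Notation q := (q_fun hv M).
Local Notation mu := (M + 1).
Local Notation nu := (M * hv%:R / (M + 1)).
Local Notation c := (hv%:R^-1 : C).

Lemma mu_neq0 : mu != 0.
Proof. by rewrite gt_eqF // ltr_wpDl ?ltr01 // ltW. Qed.

Lemma nu_mu : - nu%:C * mu%:C = - (M * hv%:R)%:C :> C.
Proof. have E : nu * mu = M * hv%:R := divfK mu_neq0 _.
by rewrite mulNr -[in RHS]E [in RHS]rmorphM. Qed.

Lemma tpow_log x : tpow nu (mu%:C * clog x) = xpow hv M x.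
Proof. by rewrite /tpow /xpow mulrA nu_mu. Qed.

Lemma Qg_log N x E :
  cpow x M%:C *: Qg c nu s ((- E)%:M : 'M[C]_N) (mu%:C * clog x) = (q x E)%:M.
Proof.
rewrite q_factor -scale_scalar_mx /Qg /mseries tpow_log; congr (_ *: _).
rewrite raddf_sum; apply: eq_bigr => j _.
by rewrite /root_coef mpow_scalar /c_coef !scale_scalar_mx.
Qed.

Variables (N : nat) (Lop Eop E0op Hop : 'M[C]_N).
Hypothesis gradE : Hop *m Eop - Eop *m Hop = Eop.
Hypothesis gradE0 : Hop *m E0op - E0op *m Hop = (1 - hv%:R) *: E0op.
Hypothesis HL : Hop *m Lop = Lop *m Hop.
Local Notation e := ((mu^-1)%:C *: Eop).
Local Notation e0 := ((mu^-1)%:C *: E0op).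
Local Notation D := ((mu^-1)%:C *: (M%:C *: Hop - Lop)).
Local Notation K E x := (Cv e e0 D c (mu^-1 * lam) nu s (- (E : C))%:M (mu%:C * clog x)).
Local Notation U x := (mexp ((- M%:C * clog x) *: Hop)).

(** The power x^(- M h) stands in for q^(- h): it is independent of E and conjugates exactly by the
    grading. The quotient of the two tends to 1 and is handled in [Psi_rem_small]. *)
Definition wkb E x := cexp (- lam%:C * S x E) *: U x.
Definition wkbV E x := cexp (lam%:C * S x E) *: mexp ((M%:C * clog x) *: Hop).
Definition wkb_rate E x := (lam%:C * q x E)%:M + (M%:C * x^-1) *: Hop.
Definition ode_matrix E x := x^-1 *: Lop + Eop + p_fun hv M x E *: E0op.

Lemma wkbE E x : wkb E x = cexp (- lam%:C * S x E) *: U x.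
Proof. by []. Qed.

Lemma wkbVE E x : wkbV E x = cexp (lam%:C * S x E) *: mexp ((M%:C * clog x) *: Hop).
Proof. by []. Qed.

Lemma wkbVK E x : wkbV E x *m wkb E x = 1%:M.
Proof.
rewrite /wkb /wkbV -scalemxAl -scalemxAr scalerA !mulNr cexpNr scale1r.
exact: mexpKN.
Qed.

Lemma wkbKV E x : wkb E x *m wkbV E x = 1%:M.
Proof. exact/mulmx1C/wkbVK. Qed.

Lemma mder_wkbV E x : slit_plane x -> mder (wkbV E) x (wkbV E x *m wkb_rate E x).
Proof.
move=> sx; have dS := cder_S hv_gt0 M_gt0 E sx.
have d1 := cder_comp (cderZ lam%:C dS) (cder_cexp _).
have d2 := mder_comp (cderZ M%:C (cder_clog sx)) (mder_mexp Hop _).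
apply: mder_eq (mderZ d1 d2) _; rewrite /wkbV /wkb_rate.
rewrite -(mexp_comm _ (erefl (Hop *m Hop))) mulmxDr; congr (_ + _).
  by rewrite mul_mx_scalar scalerA.
by rewrite -scalemxAl -scalemxAr.
Qed.

Lemma mder_wkb E x : slit_plane x -> mder (wkb E) x (- (wkb_rate E x *m wkb E x)).
Proof.
move=> sx; have dS := cder_S hv_gt0 M_gt0 E sx.
have d1 := cder_comp (cderZ (- lam%:C) dS) (cder_cexp _).
have d2 := mder_comp (cderZ (- M%:C) (cder_clog sx)) (mder_mexp Hop _).
apply: mder_eq (mderZ d1 d2) _; rewrite /wkb /wkb_rate mulNr.
rewrite mulmxDl opprD; congr (_ + _).
  by rewrite mul_scalar_mx scalerA !mulNr scaleNr.
by rewrite -scalemxAl -scalemxAr !mulNr !scaleNr scalerN scalerA scalerA mulrC.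
Qed.

Lemma conj_Eop x : U x *m Eop = cpow x (- M)%:C *: (Eop *m U x).
Proof.
rewrite (@mexp_conj _ _ _ _ 1) ?scale1r // mul1r /cpow.
by rewrite rmorphN.
Qed.

Lemma conj_E0op x : U x *m E0op = cpow x (M * hv%:R - M)%:C *: (E0op *m U x).
Proof.
rewrite (mexp_conj _ gradE0); congr (cexp _ *: _).
by rewrite rmorphB rmorphM rmorph_nat; ring.
Qed.

Lemma cpowM (a b : R) (x : C) : cpow x a%:C * cpow x b%:C = cpow x (a + b)%:C.
Proof. by rewrite /cpow -cexpD -mulrDl rmorphD. Qed.

(** The factor mu / x is dv / dx for v = mu log x, and exp v = x^M x. *)
Lemma Cv_log E x : slit_plane x -> (x^-1 * mu%:C) *: K E x =
  (lam%:C * q x E)%:M - cpow x M%:C *: (Eop + (1 - xpow hv M x * E) *: E0op)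
  + x^-1 *: (M%:C *: Hop - Lop).
Proof.
move=> sx; rewrite /Cv tpow_log scalerDr; congr (_ + _); last first.
  by rewrite scalerA -mulrA -rmorphM divff ?rmorph1 ?mulr1 // mu_neq0.
have ev : cexp (mu%:C * clog x) = cpow x M%:C * x.
  by rewrite rmorphD rmorph1 mulrDl mul1r cexpD clogK.
rewrite ev scalerA.
have mm : mu%:C * (mu^-1)%:C = 1 :> C.
  by rewrite -rmorphM divff ?rmorph1 // mu_neq0.
have -> : x^-1 * mu%:C * (cpow x M%:C * x) = mu%:C * cpow x M%:C.
  by rewrite mulrACA mulrCA [x^-1 * _]mulrC mulrA mulrCA mulrA; move: (slit_neq0 sx) => x0; field.
rewrite -scalerA scalerBr scalerBr; congr (_ - _).
  rewrite !scalerA rmorphM.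
  have -> : mu%:C * cpow x M%:C * ((mu^-1)%:C * lam%:C) = mu%:C * (mu^-1)%:C * (lam%:C * cpow x M%:C).
    by move: (cpow _ _) mu%:C (mu^-1)%:C => ? ? ?; ring.
  by rewrite mm mul1r -scalerA Qg_log scale_scalar_mx.
rewrite -scalemxAr -scalerDr scalerA scalerA mulrAC mm mul1r; congr (_ *: (_ + _)).
by rewrite mulmxDl mul1mx -scalemxAl mul_scalar_mx scalerA -[X in X + _]scale1r -scalerDl mulrN.
Qed.

(** Conjugation by x^(- M h) multiplies e by x^(- M) and e_0 by x^(M h^vee - M). The prefactor x^M
    then restores e + p e_0, since p = x^(M h^vee) (1 - E x^(- M h^vee)). *)
Lemma wkb_conj E x : slit_plane x -> (wkb_rate E x - ode_matrix E x) *m wkb E x =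
  (x^-1 * mu%:C) *: (wkb E x *m K E x).
Proof.
move=> sx; rewrite scalemxAr Cv_log // wkbE -[LHS]scalemxAr -[RHS]scalemxAl; congr (_ *: _).
have pE : cpow x M%:C * (1 - xpow hv M x * E) * cpow x (M * hv%:R - M)%:C = p_fun hv M x E.
  have x1 : xpow hv M x = cpow x (- (M * hv%:R))%:C by rewrite /xpow rmorphN.
  rewrite mulrAC cpowM subrKC mulrBr mulr1 mulrA x1 cpowM subrr.
  by rewrite {2}/cpow mul0r cexp0 mul1r.
have MM : cpow x M%:C * cpow x (- M)%:C = 1 by rewrite cpowM subrr /cpow mul0r cexp0.
rewrite /wkb_rate /ode_matrix mulmxDr mulmxBr mul_mx_scalar -!scalemxAr mulmxDr -!scalemxAr.
rewrite mulmxBr -scalemxAr !(mexp_comm _ (erefl (Hop *m Hop)), mexp_comm _ HL).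
rewrite conj_Eop conj_E0op scalerDr !scalerA MM scale1r pE.
rewrite mulmxBl !mulmxDl mul_scalar_mx -!scalemxAl scalerBr scalerA [x^-1 * _]mulrC.
move: ((lam%:C * _) *: U x) (_ *: (Hop *m U x)) (_ *: (Lop *m U x)) (Eop *m U x) (_ *: (E0op *m U x)).
by move=> ? ? ? ? ?; mxring.
Qed.

End GaugeFactor.

(** * Transfer from the slit plane to the logarithmic variable *)

Section SlitPropagation.
Variable R : realType.
Local Notation C := R[i].
Variables (N : nat) (e e0 D : 'M[C]_N) (c : C) (lam nu : R) (s : nat).
Local Notation Cv := (Cv e e0 D c lam nu s).

Lemma slit_star (x : C) (t : R) : slit_plane x -> 0 <= t <= 1 ->
  slit_plane (1 + t%:C * (x - 1)).
Proof.
move=> sx /andP[t0 t1] [].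
rewrite ImD ReD ImRM ReRM ImD ReD ImN ReN /= => i0 r0; apply: sx; split.
  move: i0; rewrite subr0 add0r => /eqP; rewrite mulf_eq0 => /orP[/eqP t00|/eqP//].
  by move: r0; rewrite t00 mul0r addr0 ler10.
have [t00|tn0] := eqVneq t 0; first by move: r0; rewrite t00 mul0r addr0 ler10.
have tp : 0 < t by rewrite lt_def tn0.
rewrite -(pmulr_rle0 _ tp); move: r0 t1; move: (complex.Re x) => r; lra.
Qed.

(** Composition with the inverse propagator gives a function of derivative 0 on the slit plane,
    which is star-shaped about 1. Every solution there thus comes from an entire solution in v, for
    which uniqueness is known. *)
Lemma slit_propagation F (mu : C) (y1 : C -> 'cV[C]_N) :
  (forall x, slit_plane x -> mder y1 x ((x^-1 * mu) *: (Cv F (mu * clog x) *m y1 x))) ->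
  exists f : C -> 'cV[C]_N, (forall w, mder f w (Cv F w *m f w)) /\
    forall x, slit_plane x -> y1 x = f (mu * clog x).
Proof.
move=> dy.
set Y := fund (@exponents R nu s) (@coefs R N e e0 D c lam s F).
set Z := fundV (@exponents R nu s) (@coefs R N e e0 D c lam s F).
have YZ w : Y w *m Z w = 1%:M := fundKV _ _ w.
exists (fun w => Y w *m y1 1); split=> [w|x sx].
  by apply: mder_eq (mder_mulr _ (mder_fund _ _ w)) _; rewrite expsum_Cv mulmxA.
pose G x := Z (mu * clog x) *m y1 x.
have dG z : slit_plane z -> mder G z 0.
  move=> sz; have dZ := mder_comp (cderZ mu (cder_clog sz)) (mder_fundV (@exponents R nu s) (@coefs R N e e0 D c lam s F) (mu * clog z)).
  apply: mder_eq (mderM dZ (dy z sz)) _.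
  rewrite expsum_Cv -/Z -scalemxAr mulmxA -scalemxAl mulNmx scalerN [mu * _]mulrC.
  by rewrite addrC subrr.
have : G (1 + (x - 1)) = G 1.
  by apply: const_on_segment => t t01; apply: dG; exact: slit_star.
rewrite addrC subrK /G clog1 mulr0 [Z 0]fundV0 mul1mx => <-.
by rewrite mulmxA YZ mul1mx.
Qed.

End SlitPropagation.

Section SubdominantPackage.
Variable R : realType.
Local Notation C := R[i].
Variables (N : nat) (e e0 h X D P Q0 Q1 : 'M[C]_N) (c : C) (lam nu c0 : R) (s : nat).

Lemma subdominant_family (psi : 'cV[C]_N) :
  system_data e e0 h X D P Q0 Q1 c lam nu c0 s -> (lam%:C%:M - (e + e0)) *m psi = 0 ->
  exists y : C -> C -> 'cV[C]_N, [/\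
    forall E w, mder (y E) w (Cv e e0 D c lam nu s (- E)%:M w *m y E w),
    forall E eps, 0 < eps -> exists T : R, forall z : C, 0 <= complex.Re z -> T <= cabs z ->
      nm (y E (clog z) - psi) <= eps,
    forall E f, (forall w, mder f w (Cv e e0 D c lam nu s (- E)%:M w *m f w)) ->
      (forall eps, 0 < eps -> exists V : R, forall v : R, V <= v -> nm (f v%:C - psi) <= eps) ->
      forall w, f w = y E w
  & forall E w, exists l, mder (fun E => y E w) E l].
Proof.
move=> SD Bpsi; exists (fun E w => yinf SD Bpsi (- E)%:M w); split.
- by move=> E w; exact: mder_yinf.
- by move=> E eps; apply: yinf_sector; exact: adm_scalar.
- by move=> E f df lf w; apply: subdominant_unique => //; exact: adm_scalar.
- by move=> E w; eexists; exact: mder_ysol.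
Qed.

End SubdominantPackage.

(** * The connection as an instance of the abstract system *)

Section ConnectionSystem.
Variable R : realType.
Local Notation C := R[i].
Variables (hv : nat) (M lam : R).
Hypothesis hv_gt0 : (0 < hv)%N.
Hypothesis M_gt0 : 0 < M.
Local Notation s := (s_idx hv M).
Local Notation mu := (M + 1).
Local Notation nu := (M * hv%:R / (M + 1)).
Local Notation c := (hv%:R^-1 : C).
Variables (N : nat) (Lop Eop E0op Hop : 'M[C]_N).
Hypothesis gradE : Hop *m Eop - Eop *m Hop = Eop.
Hypothesis gradE0 : Hop *m E0op - E0op *m Hop = (1 - hv%:R) *: E0op.
Local Notation Lam := (E0op + Eop).
Local Notation e := ((mu^-1)%:C *: Eop).
Local Notation e0 := ((mu^-1)%:C *: E0op).
Local Notation D := ((mu^-1)%:C *: (M%:C *: Hop - Lop)).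

Lemma grading_shift (G : 'M[C]_N) (k b : C) : Hop *m G - G *m Hop = k *: G ->
  (c *: Hop) *m (b *: G) = (b *: G) *m (c *: Hop + (c * k)%:M).
Proof.
move=> HG; have -> : (c *: Hop) *m (b *: G) = (c * b) *: (Hop *m G).
  by rewrite -scalemxAl -scalemxAr scalerA.
have -> : Hop *m G = G *m Hop + k *: G by rewrite -HG addrC subrK.
rewrite mulmxDr mul_mx_scalar -scalemxAl -scalemxAr !scalerDr !scalerA.
by congr (_ + _); congr (_ *: _); ring.
Qed.

(** The second inequality is the upper half of the floor, (M + 1) / (h^vee M) = 1 / nu < s + 1; it
    is what makes the truncation remainder z u^(s+1) decay. *)
Lemma nu_gap : 0 < nu /\ 1 < s.+1%:R * nu.
Proof.
have h0 : 0 < (hv%:R : R) by rewrite ltr0n.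
have m0 : 0 < mu by rewrite ltr_wpDl ?ltr01 // ltW.
have nu0 : 0 < nu by rewrite divr_gt0 // mulr_gt0.
split=> //; rewrite -ltr_pdivrMr // mul1r invf_div mulrC [M * _]mulrC.
by rewrite mulrC; exact: s_idx_gt.
Qed.

Lemma connection_system (X1 X2 : 'M[C]_N) : is_maximal_eigenvalue Lam lam ->
  Lam *m X1 - X1 *m Lam = Lop -> Lam *m X2 - X2 *m Lam = Hop ->
  exists X P Q0 Q1 c0, system_data e e0 Hop X D P Q0 Q1 c (mu^-1 * lam) nu c0 s.
Proof.
move=> max H1 H2; have m0 : 0 < mu^-1 by rewrite invr_gt0 ltr_wpDl ?ltr01 // ltW.
have [P [Q [Q' [[BP PB Pk QQ] [c0 c00 Hc]]]]] := maximal_eigenvalue_splitting max erefl.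
have [nu0 nu1] := nu_gap.
(* D is a multiple of M h - ell, so X combines the preimages X2 of h and X1 of ell under ad Lam; c0
   is rescaled because B carries the factor 1 / (M + 1). *)
exists (M%:C *: X2 - X1), P, Q, Q', (mu^-1 * c0).
have BE : (mu^-1 * lam)%:C%:M - (e + e0) = (mu^-1)%:C *: (lam%:C%:M - Lam).
  by rewrite rmorphM -scale_scalar_mx -scalerDr -scalerBr [Eop + _]addrC.
rewrite /system_data BE; split; split; [ | | |exact: nu0|exact: nu1| | | |exact: QQ| ].
- by rewrite (grading_shift _ (k := 1)) ?mulr1 // scale1r.
- rewrite (grading_shift _ gradE0); congr (_ *m (_ + _%:M)).
  by rewrite mulrBr mulr1 mulVf // pnatr_eq0 -lt0n.
- rewrite -scalerDr [Eop + _]addrC -scalemxAl -scalemxAr -scalerBr; congr (_ *: _).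
  rewrite mulmxBr mulmxBl -scalemxAr -scalemxAl -H1 -H2 scalerBr.
  by move: (_ *: (_ *m _)) (_ *: (_ *m _)) (_ *m X1) (X1 *m _) => ? ? ? ?; mxring.
- by rewrite -scalemxAl BP scaler0.
- by rewrite -scalemxAr PB scaler0.
- move=> v; rewrite -scalemxAl => /eqP; rewrite scaler_eq0 => /orP[|/eqP /Pk //].
  by rewrite (inj_eq (@complexI R) _ 0) (gt_eqF m0).
- split; first exact: mulr_gt0.
  move=> v /Hc Hv; rewrite -scalemxAl -scalemxAr ipZr -mulrA.
  by apply: ler_wpM2l => //; exact: ltW.
Qed.

End ConnectionSystem.

(** * The solution and its asymptotics *)

Section Solution.
Variable R : realType.
Local Notation C := R[i].
Local Notation Re := (@complex.Re R).
Local Notation Im := (@complex.Im R).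
Variables (hv : nat) (M lam : R).
Hypothesis hv_gt0 : (0 < hv)%N.
Hypothesis M_gt0 : 0 < M.
Local Notation s := (s_idx hv M).
Local Notation mu := (M + 1).
Local Notation nu := (M * hv%:R / (M + 1)).
Local Notation c := (hv%:R^-1 : C).
Variables (N : nat) (Lop Eop E0op Hop : 'M[C]_N).
Hypothesis gradE : Hop *m Eop - Eop *m Hop = Eop.
Hypothesis gradE0 : Hop *m E0op - E0op *m Hop = (1 - hv%:R) *: E0op.
Hypothesis HL : Hop *m Lop = Lop *m Hop.
Local Notation e := ((mu^-1)%:C *: Eop).
Local Notation e0 := ((mu^-1)%:C *: E0op).
Local Notation D := ((mu^-1)%:C *: (M%:C *: Hop - Lop)).
Local Notation K E w := (Cv e e0 D c (mu^-1 * lam) nu s (- (E : C))%:M w).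
Local Notation wkb := (wkb hv M lam Hop).
Local Notation wkbV := (wkbV hv M lam Hop).
Local Notation A E x := (ode_matrix hv M Lop Eop E0op E x).
Variables (psi : 'cV[C]_N) (y : C -> C -> 'cV[C]_N).

(** Used with w, up to sign, the small difference of log q and M log x: it exchanges x^(- M h) and
    q^(- h) in the asymptotics. *)
Lemma mexp_perturb (H : 'M[C]_N) eps : 0 < eps -> exists2 d : R, 0 < d &
  forall (w : C) (v : 'cV[C]_N), cabs w <= d -> nm (v - psi) <= d ->
    nm (mexp (w *: H) *m v - psi) <= eps.
Proof.
move=> eps0; have k0 : 0 < nm psi + 1 by rewrite ltr_wpDl ?nm_ge0.
have e1 : 0 < eps / 2 / (nm psi + 1) by rewrite !divr_gt0.
have [d d0 Hd] := mexp_near1 H e1.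
exists (Num.min (d / 2) (Num.min 1 (eps / 2))); first by rewrite !lt_min !divr_gt0 ?ltr01.
move=> w v; rewrite !le_min => /and3P[wd _ _] /and3P[_ v1 v2].
have wd' : cabs w < d by apply: le_lt_trans wd _; rewrite ltr_pdivrMr // ltr_pMr // ltr1n.
have {wd'} Hw := Hd w wd'; have -> : mexp (w *: H) *m v - psi = (mexp (w *: H) - 1%:M) *m v + (v - psi).
  by rewrite mulmxBl mul1mx addrA subrK.
apply: le_trans (nmD _ _) _; rewrite [eps]splitr; apply: lerD => //.
apply: le_trans (nmM _ _) _.
have vk : nm v <= nm psi + 1.
  have -> : v = psi + (v - psi) by rewrite addrC subrK.
  by apply: le_trans (nmD _ _) _; rewrite lerD2l.
apply: (@le_trans _ _ (eps / 2 / (nm psi + 1) * (nm psi + 1))).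
  by apply: ler_pM => //; exact: nm_ge0.
by rewrite divfK // gt_eqF.
Qed.

Lemma cexp_cancel (a : C) (U V : 'M[C]_N) (v : 'cV[C]_N) :
  (cexp a *: U) *m ((cexp (- a) *: V) *m v) = U *m V *m v.
Proof. by rewrite -!scalemxAl -scalemxAr scalerA cexpNr scale1r mulmxA. Qed.

Lemma conj_rate (W V B A0 K0 : 'M[C]_N) (k : C) (u : 'cV[C]_N) :
  V *m W = 1%:M -> W *m V = 1%:M -> (B - A0) *m W = k *: (W *m K0) ->
  V *m B *m u + V *m - (A0 *m u) = k *: (K0 *m (V *m u)).
Proof.
move=> VW WV KE; have -> : k *: (K0 *m (V *m u)) = V *m (k *: (W *m K0)) *m V *m u.
  by rewrite -scalemxAr !mulmxA VW mul1mx -!scalemxAl.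
rewrite -KE -!mulmxA [W *m _]mulmxA WV mul1mx mulmxBl mulmxBr mulmxN.
by rewrite mulmxA.
Qed.

Lemma norm_lt_of_nm m n (B : 'M[C]_(m, n)) eps : 0 < eps -> nm B <= eps / 2 -> `|B| < eps%:C.
Proof.
move=> eps0 Be; apply: le_lt_trans (norm_le_nm B) _; rewrite ltcR.
by apply: le_lt_trans Be _; rewrite ltr_pdivrMr // ltr_pMr // ltr1n.
Qed.

Lemma carg_sector (x : C) : `|carg x| < pi / (2 * mu) ->
  `|carg x| < pi /\ mu * `|carg x| < pi / 2.
Proof.
have m1 : 1 < mu by rewrite ltrDr.
have m0 : 0 < mu := lt_trans ltr01 m1; have p0 := pi_gt0 R.
have n0 := normr_ge0 (carg x); rewrite invfM mulrA ltr_pdivlMr // mulrC => H; split=> //.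
by move: H; move: `|_| n0 => a n0 H; nra.
Qed.

Lemma clog_real (t : R) : 0 < t -> clog t%:C = (ln t)%:C.
Proof. by move=> t0; rewrite -{1}(lnK t0) clogR. Qed.

Lemma carg_real (t : R) : 0 < t -> carg t%:C = 0.
Proof. by move=> t0; rewrite -Im_clog clog_real. Qed.

Hypothesis dy : forall E w, mder (y E) w (K E w *m y E w).
Hypothesis ylim : forall E eps, 0 < eps -> exists T : R, forall z : C, 0 <= Re z ->
  T <= cabs z -> nm (y E (clog z) - psi) <= eps.
Hypothesis yuniq : forall E f, (forall w, mder f w (K E w *m f w)) ->
  (forall eps, 0 < eps -> exists V : R, forall v : R, V <= v -> nm (f v%:C - psi) <= eps) ->
  forall w, f w = y E w.
Hypothesis yE : forall E w, exists l, mder (fun E => y E w) E l.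

Definition Psi_sol x E : 'cV[C]_N := wkb E x *m y E (mu%:C * clog x).

(** Obtained by inverting the asymptotic factor, so that [Psi_asym] is an identity for every x and
    only the smallness involves the sector. *)
Definition Psi_rem E x : 'cV[C]_N :=
  cexp (lam%:C * S_fun hv M x E) *: (mexp (clog (q_fun hv M x E) *: Hop) *m Psi_sol x E) - psi.

Lemma mder_Psi E x : slit_plane x ->
  mder (fun x => Psi_sol x E) x (- (A E x *m Psi_sol x E)).
Proof.
move=> sx; have d1 := mder_wkb lam hv_gt0 M_gt0 Hop E sx.
have d2 := mder_comp (cderZ mu%:C (cder_clog sx)) (dy E (mu%:C * clog x)).
apply: mder_eq (mderM d1 d2) _; have := wkb_conj lam M_gt0 gradE gradE0 HL E sx.
move=> Kz.
have EK : wkb E x *m ((mu%:C * x^-1) *: (K E (mu%:C * clog x) *m y E (mu%:C * clog x))) =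
    (wkb_rate hv M lam Hop E x - A E x) *m wkb E x *m y E (mu%:C * clog x).
  by rewrite Kz -[LHS]scalemxAr -[RHS]scalemxAl -!mulmxA [mu%:C * _]mulrC.
by rewrite EK /Psi_sol mulmxBl mulNmx mulmxBl [in RHS]mulmxA addKr.
Qed.

Lemma Psi_solves E : solves_ode hv M Lop Eop E0op E (fun x => Psi_sol x E).
Proof.
move=> x sx; have dP := mder_is_derive (mder_Psi E sx); split; first exact: ex_derive.
by rewrite derive_val; exact: addNr.
Qed.

Lemma Psi_asym E x : Psi_sol x E = asym_factor hv M Hop lam E x *m (psi + Psi_rem E x).
Proof.
rewrite /Psi_rem addrC subrK /asym_factor -scalemxAl -scalemxAr scalerA mulNr cexpN scale1r.
by rewrite mulmxA mexpNK mul1mx.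
Qed.

(** The sector puts v in the strip |Im v| < pi / 2, so that Re exp v >= 0; it also gives M |arg x| <
    pi / 2, where log q is close to M log x. The remainder becomes exp(w h) y - psi with w and y -
    psi small. *)
Lemma Psi_rem_small E eps : 0 < eps -> exists T : R, forall x : C, T < cabs x ->
  `|carg x| < pi / (2 * mu) -> nm (Psi_rem E x) <= eps.
Proof.
move=> eps0; have [d d0 Hd] := mexp_perturb Hop eps0.
have [r r0 Hr] := clog_q_asymp hv_gt0 M_gt0 E d0; have [T HT] := ylim E d0.
have m0 : 0 < mu by rewrite ltr_wpDl ?ltr01 // ltW.
(* For |x| > exp(T / mu), |exp v| = exp(mu ln |x|) >= mu ln |x| >= T. *)
exists (Num.max r (expR (T / mu))) => x; rewrite gt_max => /andP[rx Tx] cx.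
have [c1 c2] := carg_sector cx; have x0 : 0 < cabs x := lt_trans r0 rx.
have sx : slit_plane x by apply: slit_of_carg => //; rewrite -cabs_gt0.
have Mc : M * `|carg x| < pi / 2.
  by apply: le_lt_trans c2; apply: ler_wpM2r; [exact: normr_ge0|rewrite lerDl ler01].
have [w wd EQ] := Hr x rx Mc sx.
have Iz : `|Im (mu%:C * clog x)| < pi / 2 by rewrite ImRM Im_clog normrM gtr0_norm.
have Iz' : `|Im (mu%:C * clog x)| < pi.
  by apply: lt_trans Iz _; rewrite ltr_pdivrMr // ltr_pMr ?pi_gt0 // ltr1n.
have [sz lz] := cexpK Iz'.
have yd : nm (y E (mu%:C * clog x) - psi) <= d.
  rewrite -lz; apply: HT.
    rewrite /cexp ReRM; apply: mulr_ge0; first exact: expR_ge0.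
    by apply: cos_ge0_pihalf; move: Iz; rewrite ltr_norml => /andP[/ltW a /ltW b]; apply/andP; split.
  rewrite cabs_cexp ReRM Re_clog; apply: le_trans (_ : mu * (T / mu) <= _).
    by rewrite mulrC divfK // gt_eqF.
  apply: le_trans (_ : mu * ln (cabs x) <= _); last first.
    by apply: le_trans (expR_ge1Dx _); rewrite lerDr ler01.
  by rewrite ler_pM2l // -[leLHS]expRK ler_ln ?posrE ?expR_gt0 // ltW.
have := Hd w _ wd yd; congr (nm _ <= _).
rewrite /Psi_rem /Psi_sol wkbE EQ; congr (_ - _).
rewrite scalemxAl mulNr cexp_cancel -mexpD.
have -> : M%:C * clog x + w + - M%:C * clog x = w by rewrite mulNr addrAC subrr add0r.
exact: erefl.
Qed.

Lemma Psi_positive E : asym_positive hv M Hop lam psi E (fun x => Psi_sol x E).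
Proof.
exists (fun t => Psi_rem E t%:C); split=> [t t0|eps eps0]; first exact: Psi_asym.
have e2 : 0 < eps / 2 by rewrite divr_gt0.
have [T HT] := Psi_rem_small E e2; exists (Num.max 0 T) => t; rewrite gt_max => /andP[t0 Tt].
apply: norm_lt_of_nm => //; apply: HT; first by rewrite cabsR gtr0_norm.
by rewrite carg_real // normr0 divr_gt0 ?pi_gt0 // mulr_gt0 // ltr_wpDl ?ltr01 // ltW.
Qed.

Lemma Psi_sector E delta : 0 < delta ->
  asym_sector hv M Hop lam psi E delta (fun x => Psi_sol x E).
Proof.
move=> d0; exists (Psi_rem E); split=> [x _|eps eps0]; first exact: Psi_asym.
have e2 : 0 < eps / 2 by rewrite divr_gt0.
have [T HT] := Psi_rem_small E e2; exists T => x Tx cx.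
apply: norm_lt_of_nm => //; apply: HT => //; apply: lt_trans cx _.
by rewrite ltrBlDr ltrDl.
Qed.

(** Removing the WKB factor from Phi gives a solution in v. Its limit on the real axis is psi by the
    assumed asymptotics, as q^(- h) and x^(- M h) agree up to a factor tending to 1; uniqueness in v
    then determines Phi on the slit plane. *)
Lemma Psi_unique E (Phi : C -> 'cV[C]_N) : solves_ode hv M Lop Eop E0op E Phi ->
  asym_positive hv M Hop lam psi E Phi -> forall x, slit_plane x -> Phi x = Psi_sol x E.
Proof.
move=> sol [r [rE rlim]] x sx; pose y1 x := wkbV E x *m Phi x.
have dy1 z : slit_plane z -> mder y1 z ((z^-1 * mu%:C) *: (K E (mu%:C * clog z) *m y1 z)).
  move=> sz; have [/derivable_mder dPhi PhiE] := sol z sz.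
  have {PhiE} PhiE : 'D_1 (Phi : C^o -> ('cV[C]_N : normedModType C)) z = - (A E z *m Phi z).
    by apply/eqP; rewrite -addr_eq0; apply/eqP.
  rewrite PhiE in dPhi.
  apply: mder_eq (mderM (mder_wkbV lam hv_gt0 M_gt0 Hop E sz) dPhi) _.
  have Kz := wkb_conj lam M_gt0 gradE gradE0 HL E sz.
  exact: conj_rate (wkbVK _ _ _ _ _ _) (wkbKV _ _ _ _ _ _) Kz.
have [f [df fE]] := slit_propagation dy1.
have fy w : f w = y E w.
  apply: yuniq => // eps eps0; have [d d0 Hd] := mexp_perturb Hop eps0.
  have [r1 r10 Hr] := clog_q_asymp hv_gt0 M_gt0 E d0.
  have m0 : 0 < mu by rewrite ltr_wpDl ?ltr01 // ltW.
  (* [nm] of a column is at most N times its norm; the added 1 keeps the divisor positive. *)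
  have k0 : 0 < d / (N%:R + 1) by rewrite divr_gt0 // ltr_wpDl.
  have [T HT] := rlim _ k0.
  exists (mu * (Num.max r1 T)) => v Vv; set t := expR (v / mu).
  have t0 : 0 < t := expR_gt0 _.
  have /andP[r1t Tt] : (r1 < t) && (T < t).
    rewrite -gt_max; apply: lt_le_trans (expR_ge1Dx _).
    by rewrite ltr_pwDl // ler_pdivlMr // mulrC.
  have vt : v%:C = mu%:C * clog t%:C :> C.
    by rewrite clog_real // expRK -rmorphM mulrC divfK // gt_eqF.
  have st : slit_plane t%:C by apply: slit_Re_gt0.
  have [w' wd EQ] : exists2 w, cabs w <= d & clog (q_fun hv M t%:C E) = M%:C * clog t%:C + w.
    apply: Hr => //; first by rewrite cabsR gtr0_norm.
    by rewrite carg_real // normr0 mulr0 divr_gt0 ?pi_gt0.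
  rewrite vt -fE // /y1 rE // wkbVE /asym_factor EQ.
  rewrite mulNr cexp_cancel -mexpD.
  have -> : M%:C * clog t%:C + - (M%:C * clog t%:C + w') = - w' by rewrite opprD addrA subrr add0r.
  apply: Hd; first by rewrite cabsN.
  rewrite addrC addKr.
  have n0 : 0 <= (N%:R + 1 : R) by rewrite addr_ge0.
  have := nm_le_norm (r t); have := HT t Tt.
  rewrite muln1 => h1 h2; rewrite -lecR; apply: le_trans h2 _.
  apply: le_trans (_ : (N%:R + 1)%:C * (d / (N%:R + 1))%:C <= _).
    apply: ler_pM; [exact: ler0n|exact: normr_ge0| |exact: ltW].
    by rewrite rmorphD rmorph_nat rmorph1 lerDl ler01.
  by rewrite -rmorphM mulrC divfK // gt_eqF // ltr_wpDl.
by rewrite /Psi_sol -fy -fE // /y1 mulmxA wkbKV mul1mx.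
Qed.

(** S is polynomial in E, x^(- M h) does not involve E, and y is differentiable in E by [yE]. *)
Lemma Psi_entire x E :
  derivable ((fun E => Psi_sol x E) : C^o -> ('cV[C]_N : normedModType C)) E 1.
Proof.
have [l dl] := yE E (mu%:C * clog x); have [k dk] := cder_S_E hv M x E.
have d1 := cder_comp (cderZ (- lam%:C) dk) (cder_cexp _).
have d2 := mderM (mderZl (mexp ((- M%:C * clog x) *: Hop)) d1) dl.
exact: @ex_derive _ _ _ _ _ _ _ (mder_is_derive d2).
Qed.

End Solution.

Theorem theorem3p4
  (R : realType)
  (* g : simple Lie algebra of type ADE, rank n, Chevalley generators e f h *)
  (n : nat) (A : 'M[int]_n) (L : lmodType R[i]) (br : L -> L -> L)
  (e f h : 'I_n -> L)
  (* beta = -theta the lowest root, a0 a nonzero element of g_{-theta} *)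
  (beta : 'I_n -> int) (a0 : L)
  (* hh = the element h of the Cartan subalgebra with alpha_i(h) = 1; ell in the Cartan *)
  (hh ell : L)
  (* evaluation representation V(zeta), V = C^N with g acting through rho *)
  (N : nat) (rho : L -> 'M[R[i]]_N) (zeta : R[i])
  (M : R) (lam : R) (psi : 'cV[R[i]]_N) :
  is_ADE_cartan A ->
  is_lie_bracket br -> is_simple_lie br ->
  chevalley_generators br A e f h ->
  is_lowest_root br A h beta ->
  a0 <> 0 -> in_root_space br A h beta a0 ->
  in_cartan h hh -> (forall i, br hh (e i) = e i) ->
  in_cartan h ell ->
  is_representation br rho -> zeta != 0 ->
  0 < M ->
  (* Lambda = e_0 + e acts on V(zeta) as zeta rho(a0) + sum_i rho(e_i) *)
  is_maximal_eigenvalue (zeta *: rho a0 + \sum_i rho (e i)) lam ->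
  psi != 0 -> (zeta *: rho a0 + \sum_i rho (e i)) *m psi = lam%:C *: psi ->
  let hv := dual_coxeter beta in
  let Lop := rho ell in
  let Eop := \sum_i rho (e i) in
  let E0op := zeta *: rho a0 in
  let Hop := rho hh in
  exists Psi : R[i] -> R[i] -> 'cV[R[i]]_N,
    (forall E : R[i],
       (* existence *)
       solves_ode hv M Lop Eop E0op E (fun x => Psi x E) /\
       asym_positive hv M Hop lam psi E (fun x => Psi x E) /\
       (* uniqueness *)
       (forall Phi : R[i] -> 'cV[R[i]]_N,
          solves_ode hv M Lop Eop E0op E Phi ->
          asym_positive hv M Hop lam psi E Phi ->
          forall x, slit_plane x -> Phi x = Psi x E) /\
       (* asymptotics in the sector *)
       (forall delta : R, 0 < delta -> asym_sector hv M Hop lam psi E delta (fun x => Psi x E))) /\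
    (* Psi(x, E) is entire in E *)
    (forall x : R[i], slit_plane x -> forall E : R[i],
       derivable ((fun E' => Psi x E') : R[i]^o -> ('cV[R[i]]_N : normedModType R[i])) E 1).
Proof.
move=> ADE lie simple chev low a00 a0r hhC hhe ellC rep _ M0 max _ psiE hv Lop Eop E0op Hop.
have hv1 : (1 < hv)%N := dual_coxeter_gt1 lie ADE simple chev low.
have hv0 : (0 < hv)%N := ltnW hv1.
have [gradE gradE0] := rho_grading lie ADE simple chev low a00 a0r hhC hhe rep zeta.
(* Both ell and h lie in the Cartan subalgebra, hence in the image of ad Lambda; the two preimages
   make up X. *)
have [X1 H1] := rho_cartan_in_image lie ADE chev low a0r rep zeta ellC.
have [X2 H2] := rho_cartan_in_image lie ADE chev low a0r rep zeta hhC.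
have HL : Hop *m Lop = Lop *m Hop.
  apply/eqP; rewrite -subr_eq0 -(rho_br rep) (cartan_abelian lie chev hhC ellC).
  by apply/eqP; exact: (rho0 lie rep).
have [X [P [Q0 [Q1 [c0 SD]]]]] := connection_system hv0 M0 gradE gradE0 max H1 H2.
have Bpsi : (((M + 1)^-1 * lam)%:C%:M - ((M + 1)^-1%:C *: Eop + (M + 1)^-1%:C *: E0op)) *m psi = 0.
  rewrite -scalerDr [Eop + _]addrC mulmxBl mul_scalar_mx -scalemxAl psiE scalerA rmorphM.
  exact: subrr.
have [y [dy ylim yuniq yE]] := subdominant_family SD Bpsi.
exists (Psi_sol hv M lam Hop y); split=> [E|x _ E]; last exact: Psi_entire.
split; first exact: (Psi_solves hv0 M0 gradE gradE0 HL dy).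
split; first exact: (Psi_positive lam hv0 M0 Hop ylim).
split=> [Phi sol asy x sx|delta d0]; last exact: (Psi_sector lam hv0 M0 Hop ylim E d0).
exact: (Psi_unique hv0 M0 gradE gradE0 HL yuniq sol asy sx).
Qed.
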